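(* Let $p=(p_t)_{t\ge 0}$ follow the jump-diffusion process $$p_t = p_0+\int_0^t \mu_u\,\mathrm{d}u+\int_0^t\sigma_u\,\mathrm{d}W_u+\sum_{i=1}^{N_t}J_i ,\qquad t\ge 0,$$ where $\mu$ is a locally bounded and predictable drift, $\sigma$ is a càdlàg volatility process, $W$ is a standard Brownian motion, $N=(N_t)_{t\ge0}$ is a finite activity simple counting process and the $J_i$ are non-zero random variables. Let $m\in\mathbb{N}$ be fixed and define the realized range-based variance $$RRV_b^{n,m}=\frac{1}{\lambda_{2,m}}\sum_{i=1}^n s_{p_{i\Delta,\Delta},m}^2 .$$ Then, as $n\to\infty$, $$RRV_b^{n,m}\ \overset{p}{\to}\ \int_0^1\sigma_u^2\,\mathrm{d}u+\frac{1}{\lambda_{2,m}}\sum_{i=1}^{N_1}J_i^2 ,$$ where $\overset{p}{\to}$ denotes convergence in probability.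
   Context: All processes are defined on a filtered probability space $(\Omega,\mathcal{F},(\mathcal{F}_t)_{t\ge0},\mathbb{P})$; $p$ and $\sigma$ are adapted and $W$ is an $(\mathcal{F}_t)$-Brownian motion. The counting process $N_t$ (number of jumps of $p$ up to and including time $t$) is of finite activity: $N_t<\infty$ for all $t\ge 0$ almost surely; ''simple'' means that it has jumps of size one; $J_i$ is the size of the $i$-th jump of $p$. The unit interval $[0,1]$ is considered. For $n,m\in\mathbb{N}$, $p$ is observed at the times $i/(nm)$, $i=0,1,\dots,nm$; write $\Delta=1/n$. The integer $m$ is kept fixed while $n\to\infty$. For $i=1,\dots,n$ the discretely observed range of $p$ over $[(i-1)/n,i/n]$ is $$s_{p_{i\Delta,\Delta},m}=\max_{s,t\in\{0,1,\dots,m\}}\Bigl(p_{\frac{i-1}{n}+\frac{t}{nm}}-p_{\frac{i-1}{n}+\frac{s}{nm}}\Bigr).$$ For $r\geq 0$, $\lambda_{r,m}=\mathbb{E}\bigl(s_{W,m}^r\bigr)$ with $s_{W,m}=\max_{s,t\in\{0,1,\dots,m\}}\{W_{t/m}-W_{s/m}\}$, $W$ a standard Brownian motion. *)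

(* Defs.v *)
(* Processes are functions X : R -> T -> R; only times
   t >= 0 are constrained. *)
From HB Require Import structures.
From mathcomp Require Import all_boot all_order all_algebra.
From mathcomp Require Import all_classical all_reals all_analysis.
Set Implicit Arguments.
Unset Strict Implicit.
Unset Printing Implicit Defensive.
Import Order.TTheory GRing.Theory Num.Theory.
Import numFieldNormedType.Exports.
Local Open Scope classical_set_scope.
Local Open Scope ring_scope.

Section Paths.
Context {R : realType}.

Definition cadlag (f : R -> R) : Prop :=
  (forall t : R, 0 <= t -> f s @[s --> t^'+] --> f t) /\
  (forall t : R, 0 < t -> cvg (f s @[s --> t^'-])).

Definition jump (f : R -> R) (t : R) : R := f t - lim (f s @[s --> t^'-]).

(* The values lie in nat, so a path counts finitely many jumps on [0, t]. *)
Definition simple_counting_path (c : R -> nat) : Prop :=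
  [/\ c 0 = 0%N,
      (forall s t : R, 0 <= s -> s <= t -> (c s <= c t)%N),
      cadlag (fun t => (c t)%:R) &
      forall t : R, 0 < t ->
        jump (fun s => (c s)%:R) t = 0 \/ jump (fun s => (c s)%:R) t = 1].

(* Discretely observed range over [a, a + delta]; the terms with s = t are 0,
   so taking 0 as the value of the empty maximum is harmless. *)
Definition discrete_range (f : R -> R) (a delta : R) (m : nat) : R :=
  \big[Num.max/0]_(s < m.+1) \big[Num.max/0]_(t < m.+1)
    (f (a + t%:R / m%:R * delta) - f (a + s%:R / m%:R * delta)).

End Paths.

Section Processes.
Context {d : measure_display} {T : measurableType d} {R : realType}.
Implicit Types (P : probability T R) (F : R -> set (set T)) (X W : R -> T -> R).

(* No completeness or right-continuity is assumed. *)
Definition filtration F : Prop :=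
  [/\ (forall t : R, 0 <= t -> sigma_algebra setT (F t)),
      (forall t : R, 0 <= t -> F t `<=` measurable) &
      (forall s t : R, 0 <= s -> s <= t -> F s `<=` F t)].

Definition measurable_wrt (G : set (set T)) (f : T -> R) : Prop :=
  forall B : set R, measurable B -> G (f @^-1` B).

Definition adapted F X : Prop := forall t : R, 0 <= t -> measurable_wrt (F t) (X t).

Definition cvg_in_probability P (X : nat -> T -> R) (Y : T -> R) : Prop :=
  forall eps : R, 0 < eps ->
    P [set w | eps <= `|X n w - Y w|] @[n --> \oo] --> 0%E.

Definition brownian_motion P F W : Prop :=
  [/\ adapted F W,
      {ae P, forall w, W 0 w = 0},
      {ae P, forall w, {within `[0, +oo[, continuous (W ^~ w)}},
      (forall s t : R, 0 <= s -> s < t -> forall B : set R, measurable B ->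
        P ((fun w => W t w - W s w) @^-1` B)
          = normal_prob 0 (Num.sqrt (t - s)) B) &
      (forall s t : R, 0 <= s -> s < t -> forall (A : set T) (B : set R),
        F s A -> measurable B ->
        P (A `&` (fun w => W t w - W s w) @^-1` B)
          = (P A * P ((fun w => (W t w - W s w)%R) @^-1` B))%E)].

Definition stopping_time F (tau : T -> \bar R) : Prop :=
  (forall w, (0 <= tau w)%E) /\
  (forall t : R, 0 <= t -> F t [set w | (tau w <= t%:E)%E]).

Definition locally_bounded P F X : Prop :=
  exists (tau : nat -> T -> \bar R) (C : nat -> R),
    [/\ (forall k, stopping_time F (tau k)),
        {ae P, forall w, forall k, (tau k w <= tau k.+1 w)%E},
        {ae P, forall w, tau k w @[k --> \oo] --> +oo%E} &
        forall k w (t : R), 0 < t -> (t%:E <= tau k w)%E -> `|X t w| <= C k].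

Definition predictable_rectangle F (C : set (R * T)) : Prop :=
  (exists2 A, F 0 A & C = [set 0] `*` A) \/
  (exists (s t : R) A, [/\ 0 <= s, s < t, F s A & C = `]s, t] `*` A]).

Definition predictable F X : Prop :=
  let D : set (R * T) := `[0, +oo[ `*` setT in
  forall B : set R, measurable B ->
    <<s D, predictable_rectangle F >> (D `&` (fun z => X z.1 z.2) @^-1` B).

(* The process t |-> \sum_(k < size) coef k * 1_(time k, time k.+1](t). *)
Record simple_process := SimpleProcess {
  sp_size : nat;
  sp_time : nat -> R;
  sp_coef : nat -> T -> R }.

Definition simple_process_wf F (H : simple_process) : Prop :=
  [/\ 0 <= sp_time H 0%N,
      (forall k, (k < sp_size H)%N -> sp_time H k < sp_time H k.+1) &
      (forall k, (k < sp_size H)%N ->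
        measurable_wrt (F (sp_time H k)) (sp_coef H k) /\
        exists C, forall w, `|sp_coef H k w| <= C)].

Definition sp_eval (H : simple_process) (t : R) (w : T) : R :=
  \sum_(k < sp_size H)
    sp_coef H k w * \1_(`]sp_time H k, sp_time H k.+1]) t.

Definition sp_integral (H : simple_process) W (t : R) (w : T) : R :=
  \sum_(k < sp_size H)
    sp_coef H k w *
    (W (Num.min t (sp_time H k.+1)) w - W (Num.min t (sp_time H k)) w).

(* I is a continuous version of the Ito integral of X with respect to W:
   the limit in probability of the elementary integrals of simple processes
   H j such that \int_0^t (H j - X)^2 tends to 0 in probability for every t. *)
Definition ito_integral P F W X (I : R -> T -> R) : Prop :=
  [/\ (forall t : R, 0 <= t -> measurable_fun setT (I t)),
      {ae P, forall w, {within `[0, +oo[, continuous (I ^~ w)}} &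
      exists H : nat -> simple_process,
        (forall j, simple_process_wf F (H j)) /\
        forall t : R, 0 <= t ->
          cvg_in_probability P
            (fun j w => \int[lebesgue_measure]_(u in `[0, t])
                          (sp_eval (H j) u w - X u w) ^+ 2)
            (cst 0) /\
          cvg_in_probability P (fun j => sp_integral (H j) W t) (I t)].

(* N and J i are random variables; N need not be adapted.  Finite activity is
   only an almost sure statement: on a null set N may be any nat-valued
   function. *)
Definition simple_counting_process P (N : R -> T -> nat) : Prop :=
  (forall t : R, 0 <= t -> measurable_fun setT (N t)) /\
  {ae P, forall w, simple_counting_path (N ^~ w)}.

(* J i is the size of the (i + 1)-th jump. *)
Definition jump_diffusion P F (p mu sigma W : R -> T -> R)
    (N : R -> T -> nat) (J : nat -> T -> R) : Prop :=
  exists2 I, ito_integral P F W sigma I &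
    {ae P, forall w, forall t : R, 0 <= t ->
      p t w = p 0 w + \int[lebesgue_measure]_(u in `[0, t]) mu u w
              + I t w + \sum_(i < N t w) J i w}.

(* lambda_(r, m); it depends on (P, W) only through the law of W, which is
   that of a standard Brownian motion. *)
Definition range_moment P W (r : R) (m : nat) : R :=
  fine ('E_P[fun w => (discrete_range (W ^~ w) 0 1 m `^ r)%R])%E.

Definition RRV P W (p : R -> T -> R) (m n : nat) (w : T) : R :=
  (range_moment P W 2 m)^-1 *
  \sum_(i < n) discrete_range (p ^~ w) (i%:R / n%:R) n%:R^-1 m ^+ 2.

End Processes.

(* Main.v *)
Require Import Defs.
From HB Require Import structures.
From mathcomp Require Import all_boot all_order all_algebra.
From mathcomp Require Import all_classical all_reals all_analysis.
From mathcomp Require Import measurable_realfun ring lra.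
Import Order.TTheory GRing.Theory Num.Theory.
Import numFieldNormedType.Exports.
Local Open Scope classical_set_scope.
Local Open Scope ring_scope.

Set Implicit Arguments.
Unset Strict Implicit.
Unset Printing Implicit Defensive.

(* The discretely observed range is a seminorm on paths, so every block can be
   perturbed: replacing a path f by f + g changes its range by at most the range
   of g.  Write I for the Ito integral of sigma.

   Along almost every path the drift is Lipschitz on [0, 1], I is uniformly
   continuous, and for n large every block contains at most one jump; on such a
   block the range of the jump part is |J|, and the sum of the squared ranges of
   p splits into those of I, the squared jumps and cross terms that vanish.

   For I, replace sigma by its value at the left end of the block.  The error is
   controlled by a Lenglart-type inequality for sums of squares of martingale
   blocks, applied to the simple processes defining I on a common refinement of
   their partition and of the grid; it only requires that the integral of
   (H - sigma)^2 is small in probability.  On a block of length 1/n the range of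
   W is independent of the past and is distributed as n^(-1/2) times the range
   over [0, 1]; the same inequality applied to the centered squared ranges,
   weighted by sigma^2, leaves lambda times a Riemann sum of sigma^2.

   Events are bounded through measurable supersets (outer_le), so the error
   terms need not be shown measurable. *)

(** * Independence and convergence in probability *)

(** The volatility is only bounded path by path, so no moment of sigma is available. The cut-off in
    [lenglart] does the work of a localization: every bound reads eta / eps plus the probability
    that a predictable sum exceeds eta, and involves no norm of sigma.

    The obstacle in the Ito part is the order of choices. The simple processes [H j] have partitions
    of their own, and their integrals converge to I only at each fixed time. So n is fixed before j:
    for this n only the finitely many points of the grid of step 1 / (n m) matter, and j is then
    taken large, depending on n. This is harmless because the Lenglart bound depends neither on j
    nor on the mesh of the common refinement.

    Squared ranges are compared through |r^2 - s^2| <= de s^2 + (1 + 1 / de) E^2 whenever |r - s| <=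
    E. The sum of the s^2 converges, hence is bounded in probability, so it is enough that the sum
    of the E^2 vanishes. *)

Section Subsigma.
Context d (T : measurableType d) (R : realType).
Implicit Types (G : set (set T)) (f g : T -> R).

(** Regards G as the sigma-algebra of the type [g_sigma_algebraType G], so that the closure
    properties of measurable functions apply to each [F t]. *)
Lemma measurable_wrtP G f : sigma_algebra setT G ->
  measurable_wrt G f <->
  measurable_fun [set: g_sigma_algebraType G] (f : g_sigma_algebraType G -> R).
Proof.
move=> sG; split => [mf _ B mB|mf B mB].
  by rewrite setTI; apply: sub_sigma_algebra; exact: mf.
rewrite -(sigma_algebra_id sG) -[X in <<s _>> X]setTI; exact: mf.
Qed.

Lemma measurable_wrt_fun G f : G `<=` measurable -> measurable_wrt G f ->
  measurable_fun setT f.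
Proof. by move=> Gm mf _ B mB; rewrite setTI; apply: Gm; exact: mf. Qed.

Lemma measurable_wrtS G G' f : G `<=` G' -> measurable_wrt G f ->
  measurable_wrt G' f.
Proof. by move=> GG' mf B mB; apply: GG'; exact: mf. Qed.

Lemma measurable_wrtM G f g : sigma_algebra setT G ->
  measurable_wrt G f -> measurable_wrt G g -> measurable_wrt G (f \* g).
Proof.
move=> sG /(measurable_wrtP _ sG) mf /(measurable_wrtP _ sG) mg.
by apply/(measurable_wrtP _ sG); exact: measurable_funM.
Qed.

End Subsigma.

Section Independence.
Context d (T : measurableType d) (R : realType) (P : probability T R).
Implicit Types (G : set (set T)) (U Y : T -> R).

Definition indep_of G Y := forall (A : set T) (B : set R),
  G A -> measurable B -> P (A `&` Y @^-1` B) = (P A * P (Y @^-1` B))%E.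

(** The joint law of U and Y agrees with the product of the laws on rectangles, hence everywhere;
    Tonelli then factors the integral. *)
Lemma ge0_indep_integralM d1 d2 (T1 : measurableType d1) (T2 : measurableType d2)
    (U : T -> T1) (Y : T -> T2) :
  measurable_fun setT U -> measurable_fun setT Y ->
  (forall A B, measurable A -> measurable B ->
    P (U @^-1` A `&` Y @^-1` B) = P (U @^-1` A) * P (Y @^-1` B))%E ->
  forall (f : T1 -> R) (g : T2 -> R),
  measurable_fun setT f -> measurable_fun setT g ->
  (forall x, 0 <= f x) -> (forall x, 0 <= g x) ->
  (\int[P]_w (f (U w) * g (Y w))%:E =
   \int[P]_w (f (U w))%:E * \int[P]_w (g (Y w))%:E)%E.
Proof.
move=> mU mY UY f g mf mg f0 g0.
pose U' : {mfun T >-> T1} := HB.pack U (isMeasurableFun.Build _ _ _ _ _ mU).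
pose Y' : {mfun T >-> T2} := HB.pack Y (isMeasurableFun.Build _ _ _ _ _ mY).
have mZ : measurable_fun setT (fun w => (U w, Y w)).
  by apply/measurable_fun_pairP; split.
pose Z : {mfun T >-> (T1 * T2)%type} :=
  HB.pack (fun w => (U w, Y w)) (isMeasurableFun.Build _ _ _ _ _ mZ).
pose pU := distribution P U'; pose pY := distribution P Y'.
pose pZ := distribution P Z.
have pE : forall X, measurable X -> (pU \x pY)%E X = pZ X.
  apply: product_measure_unique => A B mA mB.
  by rewrite /pZ /distribution /pushforward /= -UY.
pose h (z : T1 * T2) := (f z.1 * g z.2)%:E.
have mh : measurable_fun setT h.
  apply/measurable_EFinP; apply: measurable_funM.
    exact: measurableT_comp mf measurable_fst.
  exact: measurableT_comp mg measurable_snd.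
have h0 z : (0 <= h z)%E by rewrite lee_fin mulr_ge0.
transitivity (\int[pZ]_z h z)%E.
  by rewrite ge0_integral_distribution.
transitivity (\int[(pU \x pY)%E]_z h z)%E.
  by apply: eq_measure_integral => A mA _; apply: esym; exact: pE.
rewrite fubini_tonelli1 //.
transitivity (\int[pU]_x ((f x)%:E * \int[pY]_y (g y)%:E))%E.
  apply: eq_integral => x _; rewrite /fubini_F /h /=.
  under eq_integral do rewrite EFinM.
  rewrite ge0_integralZl_EFin //; [|exact/measurable_EFinP].
  by move=> y _; rewrite lee_fin.
rewrite ge0_integralZr //; last 3 first.
- exact/measurable_EFinP.
- by move=> x _; rewrite lee_fin.
- by apply: integral_ge0 => y _; rewrite lee_fin.
by rewrite !ge0_integral_distribution//; exact/measurable_EFinP.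
Qed.

Lemma sq_integrable (X : T -> R) : measurable_fun setT X ->
  (\int[P]_w ((X w) ^+ 2)%:E < +oo)%E -> P.-integrable setT (fun w => (X w)%:E).
Proof.
move=> mX fX; have mX2 : measurable_fun setT (fun w => (X w ^+ 2)%:E).
  by apply/measurable_EFinP; exact: measurable_funX.
have i1 : P.-integrable setT (fun w => (1 + X w ^+ 2)%:E).
  under eq_fun do rewrite EFinD; apply: integrableD => //.
    exact: finite_measure_integrable_cst.
  apply/integrableP; split => //.
  by under eq_integral do rewrite gee0_abs ?lee_fin ?sqr_ge0//.
apply: le_integrable i1 => //; first exact/measurable_EFinP.
move=> w _ /=; rewrite lee_fin (ger0_norm (addr_ge0 _ _)) ?sqr_ge0//.
rewrite ler_norml; have := sqr_ge0 (X w); have := sqr_ge0 (X w - 1).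
by have := sqr_ge0 (X w + 1); lra.
Qed.

(** U and Y are split into positive and negative parts, whose four products are integrable and
    factor. As Y is centered, its two parts have the same mean, so the positive contribution [f1]
    and the negative one [f2] have the same integral. *)
Lemma indep_integralM0 G U Y : sigma_algebra setT G -> G `<=` measurable ->
  measurable_wrt G U -> measurable_fun setT Y -> indep_of G Y ->
  P.-integrable setT (fun w => (U w)%:E) ->
  P.-integrable setT (fun w => (Y w)%:E) -> (\int[P]_w (Y w)%:E = 0)%E ->
  P.-integrable setT (fun w => (U w * Y w)%:E) /\
  (\int[P]_w (U w * Y w)%:E = 0)%E.
Proof.
move=> sG Gm mU mY iGY iU iY Y0.
have mU' : measurable_fun setT U by exact: measurable_wrt_fun mU.
have prodE := ge0_indep_integralM mU' mY
  (fun A B mA mB => iGY _ _ (mU _ mA) mB).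
pose pos (x : R) := Num.max x 0; pose neg (x : R) := Num.max (- x) 0.
have mpos : measurable_fun setT pos by exact: measurable_maxr.
have mneg : measurable_fun setT neg.
  by apply: measurable_maxr => //; exact: measurableT_comp.
have pos0 x : 0 <= pos x by rewrite le_max lexx orbT.
have neg0 x : 0 <= neg x by rewrite le_max lexx orbT.
have posnegE x : x = pos x - neg x.
  by rewrite /pos /neg; case: (leP x 0) => x0;
    [rewrite max_l ?oppr_ge0//|rewrite max_r ?oppr_le0 ?ltW//]; lra.
have posN x : pos x + neg x = `|x|.
  by rewrite /pos /neg; case: (leP x 0) => x0;
    [rewrite max_l ?oppr_ge0// ler0_norm//|
     rewrite max_r ?oppr_le0 ?ltW// gtr0_norm//]; lra.
have ipart (f : R -> R) (X : T -> R) : measurable_fun setT f ->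
    measurable_fun setT X -> (forall x, 0 <= f x) ->
    (forall x, f x <= `|x|) -> P.-integrable setT (fun w => (X w)%:E) ->
    P.-integrable setT (fun w => (f (X w))%:E).
  move=> mf mX f0 fle; apply: le_integrable => //.
    by apply/measurable_EFinP; exact: measurableT_comp mf mX.
  by move=> w _; rewrite lee_fin /= (ger0_norm (f0 _)).
have lepos x : pos x <= `|x| by rewrite -posN lerDl.
have leneg x : neg x <= `|x| by rewrite -posN lerDr.
have iposY := ipart _ _ mpos mY pos0 lepos iY.
have inegY := ipart _ _ mneg mY neg0 leneg iY.
have iposU := ipart _ _ mpos mU' pos0 lepos iU.
have inegU := ipart _ _ mneg mU' neg0 leneg iU.
have iM (f g : R -> R) : measurable_fun setT f -> measurable_fun setT g ->
    (forall x, 0 <= f x) -> (forall x, 0 <= g x) ->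
    P.-integrable setT (fun w => (f (U w))%:E) ->
    P.-integrable setT (fun w => (g (Y w))%:E) ->
    P.-integrable setT (fun w => (f (U w) * g (Y w))%:E).
  move=> mf mg f0 g0 fi gi; apply/integrableP; split.
    apply/measurable_EFinP; apply: measurable_funM.
      exact: measurableT_comp mf mU'.
    exact: measurableT_comp mg mY.
  under eq_integral do rewrite gee0_abs ?lee_fin ?mulr_ge0//.
  rewrite prodE // lte_mul_pinfty//.
  - by apply: integral_ge0 => w _; rewrite lee_fin.
  - exact: integrable_fin_num.
  - have /integrableP[_] := gi; apply: le_lt_trans.
    by apply: ge0_le_integral => //; [move=> ? _; rewrite lee_fin
      |exact: measurable_int gi
      |by apply: measurableT_comp => //; exact: measurable_int gi
      |by move=> w _; rewrite lee_fin ler_norm].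
have EYpn : (\int[P]_w (pos (Y w))%:E = \int[P]_w (neg (Y w))%:E)%E.
  move: Y0; under eq_integral do rewrite [Y _]posnegE EFinB.
  rewrite integralB_EFin //.
  have := integrable_fin_num measurableT inegY.
  have := integrable_fin_num measurableT iposY.
  case: (integral _ _ _) => // a _; case: (integral _ _ _) => // c _.
  by rewrite -EFinB => -[] /eqP; rewrite subr_eq0 => /eqP ->.
pose f1 w := pos (U w) * pos (Y w) + neg (U w) * neg (Y w).
pose f2 w := pos (U w) * neg (Y w) + neg (U w) * pos (Y w).
have i1 : P.-integrable setT (fun w => (f1 w)%:E).
  by under eq_fun do rewrite EFinD; apply: integrableD => //; exact: iM.
have i2 : P.-integrable setT (fun w => (f2 w)%:E).
  by under eq_fun do rewrite EFinD; apply: integrableD => //; exact: iM.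
have UYE w : U w * Y w = f1 w - f2 w.
  by rewrite [in LHS](posnegE (U w)) [in LHS](posnegE (Y w)) /f1 /f2; ring.
have -> : (fun w => (U w * Y w)%:E) = (fun w => (f1 w)%:E - (f2 w)%:E)%E.
  by apply/funext => w; rewrite UYE EFinB.
split; [exact: integrableB|rewrite integralB_EFin //].
have -> : (\int[P]_w (f1 w)%:E = \int[P]_w (f2 w)%:E)%E.
  under eq_integral do rewrite EFinD.
  under [RHS]eq_integral do rewrite EFinD.
  rewrite !integralD_EFin //; try exact: iM.
  by rewrite !prodE // EYpn.
by rewrite subee //; exact: integrable_fin_num.
Qed.

End Independence.

(** * Convergence in outer probability *)

Section OuterBound.
Context d (T : measurableType d) (R : realType) (P : probability T R).
Implicit Types (A B : set T) (X Y : nat -> T -> R).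

Lemma measurable_ge_set (f : T -> R) c : measurable_fun setT f ->
  measurable [set w | c <= f w].
Proof.
move=> mf; rewrite -[X in measurable X]setTI.
have -> : [set w | c <= f w] = f @^-1` `[c, +oo[%classic.
  by apply/seteqP; split => w; rewrite /= in_itv /= andbT.
exact: mf.
Qed.

Definition outer_le A (e : R) :=
  exists2 B, measurable B /\ A `<=` B & (P B <= e%:E)%E.

Lemma outer_leS A B e : A `<=` B -> outer_le B e -> outer_le A e.
Proof. by move=> AB [C [mC BC] PC]; exists C => //; split => //; exact: subset_trans BC. Qed.

Lemma outer_le_trans A a b : a <= b -> outer_le A a -> outer_le A b.
Proof. by move=> ab [C CA PC]; exists C => //; apply: le_trans PC _; rewrite lee_fin. Qed.

Lemma outer_leU A B a b : outer_le A a -> outer_le B b -> outer_le (A `|` B) (a + b).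
Proof.
move=> [C [mC AC] PC] [D [mD BD] PD]; exists (C `|` D).
  by split; [exact: measurableU|exact: setUSS].
by apply: le_trans (measureU2 _ mC mD) _; rewrite EFinD leeD.
Qed.

Definition ocvg0 X := forall eps eta, 0 < eps -> 0 < eta ->
  exists N, forall n, (N <= n)%N -> outer_le [set w | eps <= `|X n w|] eta.

Lemma ocvg0_le X Y : (forall n w, `|X n w| <= `|Y n w|) -> ocvg0 Y -> ocvg0 X.
Proof.
move=> XY cY eps eta e0 et0; have [N hN] := cY _ _ e0 et0.
exists N => n Nn; apply: outer_leS (hN n Nn) => w /= h.
exact: le_trans h (XY _ _).
Qed.

Lemma ocvg0D X Y : ocvg0 X -> ocvg0 Y -> ocvg0 (fun n w => X n w + Y n w).
Proof.
move=> cX cY eps eta e0 et0.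
have e20 : 0 < eps / 2 by rewrite divr_gt0.
have et20 : 0 < eta / 2 by rewrite divr_gt0.
have [N hN] := cX _ _ e20 et20; have [N' hN'] := cY _ _ e20 et20.
exists (maxn N N') => n; rewrite geq_max => /andP[Nn Nn'].
rewrite [eta]splitr; apply: outer_leS (outer_leU (hN _ Nn) (hN' _ Nn')) => w /= h.
have [Xs|] := leP (eps / 2) `|X n w|; [by left|right].
by have := ler_normD (X n w) (Y n w); lra.
Qed.

Lemma ocvg0Z X (c : R) : ocvg0 X -> ocvg0 (fun n w => c * X n w).
Proof.
move=> cX eps eta e0 et0; have c1 : 0 < `|c| + 1 by rewrite ltr_pwDr.
have [N hN] := cX _ _ (divr_gt0 e0 c1) et0.
exists N => n Nn; apply: outer_leS (hN _ Nn) => w /=.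
rewrite normrM ler_pdivrMr// mulrDr mulr1 [X in _ -> _ <= X + _]mulrC => h.
by apply: le_trans h _; rewrite lerDl.
Qed.

Lemma ocvg0_cvgp X (Y : T -> R) : (forall n, measurable_fun setT (X n)) ->
  measurable_fun setT Y -> ocvg0 (fun n w => X n w - Y w) ->
  cvg_in_probability P X Y.
Proof.
move=> mX mY cX eps e0; apply/fine_cvgP; split.
  apply: nearW => n; apply: fin_num_measure; apply: measurable_ge_set.
  by apply: measurableT_comp => //; exact: measurable_funB.
apply/cvgrPdist_le => eta et0; have [N hN] := cX _ _ e0 et0.
exists N => // n /= Nn; have [B [mB AB] PB] := hN _ Nn.
have mA : measurable [set w | eps <= `|X n w - Y w|].
  apply: measurable_ge_set; apply: measurableT_comp => //.
  exact: measurable_funB.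
rewrite sub0r normrN ger0_norm ?fine_ge0// -lee_fin fineK ?fin_num_measure//.
by apply: le_trans PB; apply: le_measure; rewrite ?inE.
Qed.

Lemma cvgp_ocvg0 X (Y : T -> R) : (forall n, measurable_fun setT (X n)) ->
  measurable_fun setT Y -> cvg_in_probability P X Y ->
  ocvg0 (fun n w => X n w - Y w).
Proof.
move=> mX mY cX eps eta e0 et0.
have /fine_cvgP[_ /cvgrPdist_le/(_ _ et0)[N _ hN]] := cX _ e0.
have mA n : measurable [set w | eps <= `|X n w - Y w|].
  apply: measurable_ge_set; apply: measurableT_comp => //.
  exact: measurable_funB.
exists N => n Nn; exists [set w | eps <= `|X n w - Y w|]; first by split; [exact: mA|].

have := hN n Nn; rewrite /= sub0r normrN ger0_norm ?fine_ge0//.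
by rewrite -lee_fin (fineK (fin_num_measure P _ (mA n))).
Qed.

(** Egorov's theorem: off a set of probability below eta the convergence is uniform, and that set
    serves as the measurable superset for all large n. *)
Lemma ae_ocvg0 X : (forall n, measurable_fun setT (X n)) ->
  {ae P, forall w, X n w @[n --> \oo] --> (0 : R)} -> ocvg0 X.
Proof.
move=> mX aeX eps eta e0 et0.
have [|||||B [mB PB cB]] := @ae_pointwise_almost_uniform _ _ _ P X (cst 0) setT eta mX.
- exact: measurable_cst.
- by [].
- by apply: (le_lt_trans (probability_le1 P measurableT)); rewrite ltry.
- have [E [mE E0 hE]] := aeX; exists E; split => // w nw; apply: hE => h.
  by apply: nw => _; exact: h.
- exact: et0.
have /cB [N _ hN] : nbhs (cst 0 : {uniform` (setT `\` B) -> R})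
    (fun h : {uniform` (setT `\` B) -> R} =>
      forall w, (setT `\` B) w -> `|(h : T -> R) w| < eps).
  apply/uniform_nbhs; exists [set xy : R * R | ball xy.1 (PosNum e0)%:num xy.2].
  split; first exact: entourage_ball.
  by move=> h /= hB w Bw; have := hB w Bw; rewrite /ball /= sub0r normrN.
exists N => n Nn; exists B; [split => // w /= Xw|exact: ltW].
apply: contrapT => nB; have /= := hN n Nn w.
by rewrite ltNge Xw => /(_ (conj I nB)).
Qed.

End OuterBound.

(** * A Lenglart-type inequality *)

Section Lenglart.
Context d (T : measurableType d) (R : realType) (P : probability T R).

(** Independence from the past stands in for conditional expectations: it gives E[(G Y)^2] = E[G^2]
    E[Y^2] for G known in the past. Positivity of [v k] allows a bound on G^2 v to be turned into a
    bound on G. *)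
Definition mart_diff (FF : nat -> set (set T)) (M : nat) (Y : nat -> T -> R)
    (v : nat -> R) : Prop :=
  [/\ forall k, sigma_algebra setT (FF k), forall k, FF k `<=` measurable,
      forall k, FF k `<=` FF k.+1 &
      forall k, (k < M)%N -> [/\ measurable_wrt (FF k.+1) (Y k),
        indep_of P (FF k) (Y k), (\int[P]_w (Y k w)%:E = 0)%E, 0 < v k &
        (\int[P]_w ((Y k w) ^+ 2)%:E <= (v k)%:E)%E]].

Lemma integral_sqrD (S X : T -> R) :
  P.-integrable setT (fun w => (S w ^+ 2)%:E) ->
  P.-integrable setT (fun w => (X w ^+ 2)%:E) ->
  P.-integrable setT (fun w => (S w * X w)%:E) ->
  (\int[P]_w (S w * X w)%:E = 0)%E ->
  (\int[P]_w ((S w + X w) ^+ 2)%:E =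
   \int[P]_w (S w ^+ 2)%:E + \int[P]_w (X w ^+ 2)%:E)%E.
Proof.
move=> iS iX iSX SX0.
have -> : (fun w => ((S w + X w) ^+ 2)%:E) =
    (fun w => ((S w ^+ 2)%:E + ((X w ^+ 2)%:E + 2%:E * (S w * X w)%:E))%E).
  apply/funext => w; rewrite -EFinM -!EFinD; congr EFin; ring.
rewrite integralD //; last by apply: integrableD => //; exact: integrableZl.
rewrite integralD //; last exact: integrableZl.
by rewrite integralZl // SX0 mule0 adde0.
Qed.

(** Orthogonality: the partial sum times [G c] is known at step c, while [Y c] is centered and
    independent of that past, so the cross term vanishes. The bounds [C k] give integrability and do
    not enter the estimate. *)
Lemma mart_diff_block FF M Y v (G : nat -> T -> R) (C : nat -> R) a c :
  mart_diff FF M Y v ->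
  (forall k, (k < M)%N -> measurable_wrt (FF k) (G k)) ->
  (forall k w, (k < M)%N -> `|G k w| <= C k) ->
  (a <= c <= M)%N ->
  let S w := \sum_(a <= k < c) G k w * Y k w in
  measurable_wrt (FF c) S /\
  (\int[P]_w ((S w) ^+ 2)%:E <=
   \sum_(a <= k < c) \int[P]_w ((G k w) ^+ 2 * v k)%:E)%E.
Proof.
move=> [sF Fm FS hY] mG GC /andP[ac].
rewrite -(subnKC ac); move: (c - a)%N => {c ac} e.
elim: e => [|e IH] eM /=.
  rewrite addn0; split; last first.
    under eq_integral do rewrite big_geq// expr0n/=.
    by rewrite integral0 big_geq.
  apply/measurable_wrtP => //.
  by under eq_fun do rewrite big_geq//; exact: measurable_cst.
set c := (a + e)%N; have ac : (a <= c)%N by rewrite leq_addr.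
have cM : (c < M)%N by rewrite -addnS.
have [mS leS] := IH (ltnW cM).
have cE : (a + e.+1)%N = c.+1 by rewrite addnS.
rewrite cE; set S := (fun w => \sum_(a <= k < c) _) in mS leS.
have [mY iGY Y0 v0 Y2] := hY _ cM.
have SE w : \sum_(a <= k < c.+1) G k w * Y k w = S w + G c w * Y c w.
  by rewrite big_nat_recr.
rewrite -/c in mS leS.
have mGc := mG _ cM.
have mGf : measurable_fun setT (G c) := measurable_wrt_fun (Fm c) mGc.
have mYf : measurable_fun setT (Y c) := measurable_wrt_fun (Fm _) mY.
have mSf : measurable_fun setT S := measurable_wrt_fun (Fm _) mS.
split.
  have -> : (fun w => \sum_(a <= k < c.+1) G k w * Y k w) =
      (fun w => S w + G c w * Y c w) by apply/funext.
  apply/measurable_wrtP => //; apply: measurable_funD.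
    by apply/measurable_wrtP => //; exact: measurable_wrtS mS.
  apply/measurable_wrtP => //; apply: measurable_wrtM => //.
  exact: measurable_wrtS mGc.
have sqint (X : T -> R) : measurable_fun setT X ->
    (\int[P]_w (X w ^+ 2)%:E < +oo)%E ->
    P.-integrable setT (fun w => (X w ^+ 2)%:E).
  move=> mX fX; apply/integrableP; split.
    by apply/measurable_EFinP; exact: measurable_funX.
  by under eq_integral do rewrite gee0_abs ?lee_fin ?sqr_ge0//.
have G2fin k : (k < M)%N -> (\int[P]_w (G k w ^+ 2 * v k)%:E < +oo)%E.
  move=> kM; have [_ _ _ vk0 _] := hY _ kM.
  apply: (@le_lt_trans _ _ (\int[P]_w ((C k) ^+ 2 * v k)%:E)%E); last first.
    by rewrite integral_cst//= probability_setT mule1 ltry.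
  apply: ge0_le_integral => //=.
  - by move=> w _; rewrite lee_fin mulr_ge0 ?sqr_ge0 // ltW.
  - apply/measurable_EFinP; apply: measurable_funM => //.
    by apply: measurable_funX; exact: measurable_wrt_fun (mG _ kM).
  - move=> w _; rewrite lee_fin (ler_wpM2r (ltW vk0))// -real_normK ?num_real//.
    by rewrite lerXn2r ?nnegrE// ?(le_trans (normr_ge0 _) (GC k w kM)) ?GC.
have S2fin : (\int[P]_w (S w ^+ 2)%:E < +oo)%E.
  apply: le_lt_trans leS _; rewrite big_nat lte_sum_pinfty// => k /andP[_ kc].
  exact/G2fin/(ltn_trans kc).
have X2 : (\int[P]_w ((G c w * Y c w) ^+ 2)%:E <=
    \int[P]_w (G c w ^+ 2 * v c)%:E)%E.
  under eq_integral do rewrite exprMn.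
  rewrite (@ge0_indep_integralM _ _ _ P _ _ _ _ (G c) (Y c)
    mGf mYf _ (fun x => x ^+ 2) (fun x => x ^+ 2)); last 5 first.
  - by move=> A B mA mB; apply: iGY => //; exact: mGc.
  - exact: measurable_funX.
  - exact: measurable_funX.
  - by move=> x; exact: sqr_ge0.
  - by move=> x; exact: sqr_ge0.
  under [leRHS]eq_integral do rewrite EFinM.
  rewrite ge0_integralZr //; last 3 first.
  - by apply/measurable_EFinP; exact: measurable_funX.
  - by move=> x _; rewrite lee_fin sqr_ge0.
  - by rewrite lee_fin ltW.
  by apply: lee_wpmul2l => //; apply: integral_ge0 => w _; rewrite lee_fin sqr_ge0.
have iY : P.-integrable setT (fun w => (Y c w)%:E).
  by apply: sq_integrable => //; exact: le_lt_trans Y2 (ltry _).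
have iS : P.-integrable setT (fun w => (S w)%:E) by exact: sq_integrable.
have iSG : P.-integrable setT (fun w => (S w * G c w)%:E).
  apply: (@le_integrable _ _ _ P _ measurableT _
    (fun w => ((C c)%:E * (S w)%:E)%E)).
  - by apply/measurable_EFinP; exact: measurable_funM.
  - move=> w _ /=; rewrite lee_fin normrM (normrM (C c)) mulrC.
    by rewrite ler_wpM2r// (le_trans (GC c w cM))// ler_norm.
  - exact: integrableZl.
have [iSX SX0] := indep_integralM0 (sF c) (Fm c)
  (measurable_wrtM (sF c) mS mGc) mYf iGY iSG iY Y0.
have mX : measurable_fun setT (fun w => G c w * Y c w) by exact: measurable_funM.
under eq_integral do rewrite SE.
rewrite integral_sqrD; first last.
- by under eq_integral do rewrite mulrA.
- by under eq_fun do rewrite mulrA.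
- by apply: sqint => //; apply: le_lt_trans X2 (G2fin _ cM).
- exact: sqint.
by rewrite big_nat_recr//= leeD.
Qed.

Lemma big_blocks (V : Type) (idx : V) (op : Monoid.law idx) (f : nat -> V)
    (b : nat -> nat) L :
  (forall l, (b l <= b l.+1)%N) ->
  \big[op/idx]_(l < L) \big[op/idx]_(b l <= k < b l.+1) f k =
  \big[op/idx]_(b 0%N <= k < b L) f k.
Proof.
move=> bS; elim: L => [|L IH]; first by rewrite big_ord0 big_geq.
rewrite big_ord_recr /= IH -big_cat_nat //.
by elim: L {IH} => // L IH; exact: leq_trans IH (bS L).
Qed.

Lemma measurable_sum_nat d' (T' : measurableType d') (h : nat -> T' -> R) a c :
  (forall k, (a <= k < c)%N -> measurable_fun setT (h k)) ->
  measurable_fun setT (fun x => \sum_(a <= k < c) h k x).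
Proof.
move=> mh; pose h' k := if (a <= k < c)%N then h k else cst 0.
have -> : (fun x => \sum_(a <= k < c) h k x) = (fun x => \sum_(a <= k < c) h' k x).
  apply/funext => x; rewrite big_nat [RHS]big_nat; apply: eq_bigr => k kac.
  by rewrite /h' kac.
by apply: measurable_sum => k; rewrite /h'; case: ifPn => // /mh.
Qed.

(* G is cut off once the predictable sum of G_k^2 v_k exceeds eta; the cut-off
   sums are square integrable, with orthogonal terms. *)
Lemma lenglart FF M Y v (G : nat -> T -> R) (b : nat -> nat) L eps eta q :
  mart_diff FF M Y v ->
  (forall k, (k < M)%N -> measurable_wrt (FF k) (G k)) ->
  (forall l, (b l <= b l.+1)%N) -> (b L <= M)%N -> 0 < eps -> 0 < eta ->
  outer_le P [set w | eta < \sum_(0 <= k < M) G k w ^+ 2 * v k] q ->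
  outer_le P
    [set w | eps <= \sum_(l < L) (\sum_(b l <= k < b l.+1) G k w * Y k w) ^+ 2]
    (eta / eps + q).
Proof.
move=> hY mG bS bL e0 eta0 Ve; have [sF Fm FS hY'] := hY.
have Fle j k : (j <= k)%N -> FF j `<=` FF k.
  move=> /subnKC <-; elim: (k - j)%N => [|e IH]; first by rewrite addn0.
  by rewrite addnS; apply: subset_trans IH (FS _).
have bmono l l' : (l <= l')%N -> (b l <= b l')%N.
  move=> /subnKC <-; elim: (l' - l)%N => [|e IH]; first by rewrite addn0.
  by rewrite addnS; apply: leq_trans IH (bS _).
pose S k w := \sum_(0 <= j < k) G j w ^+ 2 * v j.
(* [S k.+1] already contains the term of index k and is still known at step k. Testing it rather
   than [S k] keeps the truncated sum below eta without overshoot. *)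
pose G' k w := if (k < M)%N && (S k.+1 w <= eta) then G k w else 0.
have v0 k : (k < M)%N -> 0 < v k by move=> /hY'[].
have SM k w : (k <= M)%N -> S k w <= S M w.
  move=> kM; rewrite /S (big_cat_nat (leq0n k) kM) //= lerDl.
  rewrite big_nat sumr_ge0 // => j /andP[_ jM].
  by rewrite mulr_ge0 ?sqr_ge0 // ltW // v0.
have mS k : (k < M)%N -> measurable_wrt (FF k) (S k.+1).
  move=> kM; apply/measurable_wrtP => //; apply: measurable_sum_nat => j /andP[_ jk].
  apply: measurable_funM => //; apply: measurable_funX.
  apply/measurable_wrtP => //; apply: measurable_wrtS (mG _ _).
    exact: Fle.
  exact: leq_trans jk kM.
have mG' k : (k < M)%N -> measurable_wrt (FF k) (G' k).
  move=> kM; apply/measurable_wrtP => //; rewrite /G' kM /=.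
  apply: measurable_fun_ifT => //=.
    apply: measurable_fun_ler => //; apply/measurable_wrtP => //; exact: mS.
  by apply/measurable_wrtP => //; exact: mG.
have sum_le k w : (k <= M)%N ->
    \sum_(0 <= j < k) G' j w ^+ 2 * v j <= S k w /\
    \sum_(0 <= j < k) G' j w ^+ 2 * v j <= eta.
  elim: k => [|k IH] kM; first by rewrite /S !big_geq//; split => //; exact: ltW.
  have [IH1 IH2] := IH (ltnW kM); have vk := v0 _ kM.
  rewrite big_nat_recr //=.
  have SE : S k.+1 w = S k w + G k w ^+ 2 * v k by rewrite /S big_nat_recr.
  have : 0 <= G k w ^+ 2 * v k by rewrite mulr_ge0 ?sqr_ge0// ltW.
  rewrite /G' kM /=; case: ifPn => [Sle|_]; last by rewrite expr0n mul0r SE; lra.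
  by move=> _; split; [rewrite SE|apply: le_trans Sle; rewrite SE]; rewrite lerD2r.
(* From G'^2 v <= eta and |x| <= x^2 + 1. *)
have G'C k w : (k < M)%N -> `|G' k w| <= eta / v k + 1.
  move=> kM; have vk := v0 _ kM.
  have : G' k w ^+ 2 * v k <= eta.
    have [_] := sum_le k.+1 w kM; apply: le_trans; rewrite big_nat_recr//= lerDr.
    rewrite big_nat sumr_ge0// => j /andP[_ jk]; rewrite mulr_ge0 ?sqr_ge0// ltW// v0//.
    exact: leq_trans jk (ltnW kM).
  rewrite -ler_pdivlMr // => h; apply: le_trans (_ : G' k w ^+ 2 + 1 <= _).
    rewrite ler_norml; have := sqr_ge0 (G' k w - 1); have := sqr_ge0 (G' k w + 1).
    by have := sqr_ge0 (G' k w); lra.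
  by rewrite lerD2r.
pose Q (H : nat -> T -> R) w :=
  \sum_(l < L) (\sum_(b l <= k < b l.+1) H k w * Y k w) ^+ 2.
have bM l : (l < L)%N -> (b l.+1 <= M)%N.
  by move=> lL; apply: leq_trans bL; exact: bmono.
have mQ (H : nat -> T -> R) : (forall k, (k < M)%N -> measurable_wrt (FF k) (H k)) ->
    measurable_fun setT (Q H).
  move=> mH; apply: measurable_sum => l; apply: measurable_funX.
  apply: measurable_sum_nat => k /andP[_ kl].
  have kM := leq_trans kl (bM _ (ltn_ord l)); have [mY _ _ _ _] := hY' _ kM.
  by apply: measurable_funM; [exact: measurable_wrt_fun (mH _ kM)
    |exact: measurable_wrt_fun mY].
have mG'T k : measurable_fun setT (G' k).
  have [kM|Mk] := ltnP k M; first exact: measurable_wrt_fun (mG' _ kM).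
  by rewrite /G' ltnNge Mk /=; exact: measurable_cst.
have G'v0 k w : 0 <= G' k w ^+ 2 * v k.
  have [kM|Mk] := ltnP k M; first by rewrite mulr_ge0 ?sqr_ge0// ltW// v0.
  by rewrite /G' ltnNge Mk /= expr0n mul0r.
have EQ : (\int[P]_w (Q G' w)%:E <= eta%:E)%E.
  rewrite /Q; under eq_integral do rewrite -sumEFin.
  rewrite ge0_integral_sum //; last 2 first.
  - move=> l; apply/measurable_EFinP; apply: measurable_funX.
    apply: measurable_sum_nat => k /andP[_ kl].
    have kM := leq_trans kl (bM _ (ltn_ord l)); have [mY _ _ _ _] := hY' _ kM.
    by apply: measurable_funM => //; exact: measurable_wrt_fun mY.
  - by move=> l w _; rewrite lee_fin sqr_ge0.
  apply: (@le_trans _ _ (\sum_(l < L) \sum_(b l <= k < b l.+1)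
      \int[P]_w (G' k w ^+ 2 * v k)%:E)%E).
    apply: lee_sum => l _.
    by have [] := mart_diff_block hY mG' G'C
      (_ : (b l <= b l.+1 <= M)%N); rewrite ?bS ?bM.
  have iG0 k : (0 <= \int[P]_w (G' k w ^+ 2 * v k)%:E)%E.
    by apply: integral_ge0 => w _; rewrite lee_fin.
  rewrite (big_blocks _ (fun k => \int[P]_w (G' k w ^+ 2 * v k)%:E)%E) //.
  apply: (@le_trans _ _ (\sum_(0 <= k < M) \int[P]_w (G' k w ^+ 2 * v k)%:E)%E).
    rewrite [leRHS](big_cat_nat (leq0n (b 0%N)) (leq_trans (bmono _ _ (leq0n L)) bL)) /=.
    rewrite [in leRHS](big_cat_nat (bmono _ _ (leq0n L)) bL) /=.
    apply: le_trans (leeDr _ _); last exact: sume_ge0.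
    by apply: leeDl; exact: sume_ge0.
  rewrite -ge0_integral_sum //; last 2 first.
  - move=> k; apply/measurable_EFinP; apply: measurable_funM => //.
    exact: measurable_funX.
  - by move=> k w _; rewrite lee_fin.
  apply: (@le_trans _ _ (\int[P]_w (cst eta%:E w))%E); last first.
    by rewrite integral_cst//= probability_setT mule1.
  apply: ge0_le_integral => //=.
  - by move=> w _; rewrite sume_ge0// => k _; rewrite lee_fin.
  - apply: emeasurable_sum => k; apply/measurable_EFinP.
    by apply: measurable_funM => //; exact: measurable_funX.
  - by move=> w _; rewrite sumEFin lee_fin; have [] := sum_le M w (leqnn _).
have QG'0 w : 0 <= Q G' w by apply: sumr_ge0 => l _; exact: sqr_ge0.
have mE : measurable [set w | eps <= Q G' w] by apply: measurable_ge_set; exact: mQ.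
have mI : measurable_fun setT (\1_[set w | eps <= Q G' w] : T -> R).
  exact: measurable_indic.
(* Markov's inequality for the expectation bound [EQ]. *)
have markovQ : (P [set w | (eps <= Q G' w)%R] <= (eta / eps)%:E)%E.
  rewrite EFinM lee_pdivlMr//; apply: le_trans EQ.
  rewrite -(setIT [set w | _]) -integral_indic//.
  rewrite muleC -ge0_integralZl_EFin//; [|exact/measurable_EFinP|exact: ltW].
  apply: ge0_le_integral => //=.
  - by move=> w _; rewrite lee_fin mulr_ge0 // ltW.
  - by apply/measurable_EFinP; exact: measurable_funM.
  - by apply/measurable_EFinP; exact: mQ.
  - move=> w _; rewrite lee_fin indicE; case: (boolP (w \in _)) => [/set_mem/=|_].
      by rewrite mulr1.
    by rewrite mulr0.
have h1 : outer_le P [set w | eps <= Q G' w] (eta / eps).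
  by exists [set w | eps <= Q G' w]; first by split.
(* Where the full predictable sum is at most eta nothing has been cut off, and the sums for [G'] and
   [G] coincide. *)
apply: outer_leS (outer_leU h1 Ve) => w /= he; have [?|Sle] := ltP eta (S M w); [by right|left].
apply: le_trans he _; rewrite le_eqVlt; apply/orP; left; apply/eqP.
apply: eq_bigr => l _; congr (_ ^+ 2); rewrite big_nat [RHS]big_nat.
apply: eq_bigr => k /andP[_ kl]; congr (_ * _).
have kM := leq_trans kl (bM _ (ltn_ord l)).
by rewrite /G' kM /= (le_trans (SM k.+1 w kM) Sle).
Qed.

End Lenglart.

(** * Normal laws and the range of Brownian motion *)

Section Density.
Context d (T : measurableType d) (R : realType).
Variables (mu nu : {measure set T -> \bar R}) (f : T -> R).

Import HBNNSimple.

(** Holds for indicators by assumption, for simple functions by linearity, and in general by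
    monotone convergence. It turns Gaussian expectations into Lebesgue integrals. *)
Lemma ge0_integral_density (g : T -> R) : measurable_fun setT f ->
  (forall x, 0 <= f x) -> measurable_fun setT g -> (forall x, 0 <= g x) ->
  (forall A, measurable A -> nu A = \int[mu]_(x in A) (f x)%:E)%E ->
  (\int[nu]_x (g x)%:E = \int[mu]_x (g x * f x)%:E)%E.
Proof.
move=> mf f0 mg g0 nuE.
have indicE' E : measurable E ->
    (\int[nu]_x (\1_E x)%:E = \int[mu]_x (\1_E x * f x)%:E)%E.
  move=> mE; rewrite integral_indic// setIT nuE// integral_mkcond.
  apply: eq_integral => x _; rewrite patchE indicE.
  by case: ifPn => _; rewrite ?mul1r ?mul0r.
have nnE (h : {nnsfun T >-> R}) :
    (\int[nu]_x (h x)%:E = \int[mu]_x (h x * f x)%:E)%E.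
  under [LHS]eq_integral do rewrite fimfunE -fsumEFin//.
  rewrite [LHS]ge0_integral_fsum//; last 2 first.
    - by move=> r; exact/measurable_EFinP/measurableT_comp.
    - by move=> n x _; rewrite EFinM nnfun_muleindic_ge0.
  under [RHS]eq_integral.
    move=> x xD; rewrite EFinM fimfunE -fsumEFin// ge0_mule_fsuml; last first.
      by move=> r; rewrite EFinM nnfun_muleindic_ge0.
    over.
  rewrite [RHS]ge0_integral_fsum//; last 2 first.
    - move=> r; apply/measurable_EFinP; apply: measurable_funM => //.
      by apply: measurable_funM => //; exact: measurable_indic.
    - by move=> n x _; rewrite EFinM mule_ge0 ?EFinM ?nnfun_muleindic_ge0// lee_fin.
  apply: eq_fsbigr => r rh; rewrite integralZl_indic_nnsfun//.
  have r0 : 0 <= r.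
    move: rh; rewrite inE => -[x _ <-]; exact: fun_ge0.
  under [RHS]eq_integral do rewrite -EFinM -mulrA EFinM.
  rewrite ge0_integralZl//; last 2 first.
    - apply/measurable_EFinP; apply: measurable_funM => //.
    - by move=> x _; rewrite lee_fin mulr_ge0.
  by rewrite indicE'.
have mgE : measurable_fun setT (fun x => (g x)%:E) by exact/measurable_EFinP.
pose h := nnsfun_approx measurableT mgE.
have hcvg x : (h n x)%:E @[n --> \oo] --> (g x)%:E.
  by apply: cvg_nnsfun_approx => // y _; rewrite lee_fin.
transitivity (limn (fun n => \int[nu]_x (h n x)%:E))%E.
  rewrite -monotone_convergence//=.
  - by apply: eq_integral => x _; apply/esym/cvg_lim => //; exact: hcvg.
  - by move=> n; exact/measurable_EFinP.
  - by move=> n x _; rewrite lee_fin.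
  - by move=> x _ a b ab; rewrite lee_fin; exact/lefP/nd_nnsfun_approx.
transitivity (limn (fun n => \int[mu]_x (h n x * f x)%:E))%E.
  by congr (limn _); apply/funext => n; exact: nnE.
rewrite -monotone_convergence//=.
- apply: eq_integral => x _; apply/cvg_lim => //.
  under eq_fun do rewrite EFinM muleC.
  by rewrite EFinM muleC; apply: cvgeZl => //; exact: hcvg.
- by move=> n; apply/measurable_EFinP; exact: measurable_funM.
- by move=> n x _; rewrite lee_fin mulr_ge0.
- move=> x _ a b ab; rewrite lee_fin ler_wpM2r//; exact/lefP/nd_nnsfun_approx.
Qed.

End Density.

Section Normal.
Context (R : realType).
Local Notation mu := (@lebesgue_measure R).
Implicit Types (s a : R) (B : set R).

(** The image measure multiplied by a agrees with Lebesgue measure on half-open intervals, which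
    determine it. *)
Lemma lebesgue_measure_scale a B : 0 < a -> measurable B ->
  (mu ((fun x => (a * x)%R) @^-1` B) = a^-1%:E * mu B)%E.
Proof.
move=> a0 mB.
have mf : measurable_fun setT (fun x : R => a * x) by exact: measurable_funM.
have a0' : 0 <= a by exact: ltW.
suff key : mscale (NngNum a0') (pushforward mu
    ((fun x => a * x) : _ -> measurableTypeR R)) B = mu B.
  by rewrite -(key mf) /mscale /= muleA -EFinM mulVf ?gt_eqF// mul1e.
move=> mf'; apply/esym/lebesgue_measure_unique => // _ [[u v]] _ <-.
change (mu `]u, v] = a%:E * mu ((fun x => (a * x)%R) @^-1` `]u, v]))%E.
have -> : (fun x => a * x) @^-1` `]u, v] = `](u / a), (v / a)]%classic.
  apply/seteqP; split => x; rewrite /= !in_itv /=;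
  by rewrite ltr_pdivrMr// ler_pdivlMr// mulrC.
rewrite !lebesgue_measure_itv /= !lte_fin ltr_pM2r ?invr_gt0//.
case: ifPn => _; last by rewrite mule0.
by rewrite -EFinB -EFinM -mulrBl mulrC mulfVK ?gt_eqF// EFinB.
Qed.

Lemma normal_prob_scale s a B : 0 < a -> s != 0 -> measurable B ->
  normal_prob 0 s ((fun x => a * x) @^-1` B) = normal_prob 0 (a * s) B.
Proof.
move=> a0 s0 mB.
have mf : measurable_fun setT (fun x : R => a * x) by exact: measurable_funM.
have as0 : a * s != 0 by rewrite mulf_neq0// gt_eqF.
have pdfE x : normal_pdf 0 s x = a * normal_pdf 0 (a * s) (a * x).
  rewrite !normal_pdfE// /normal_peak /normal_fun !subr0 mulrA; congr (_ * expR _).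
    have -> : (a * s) ^+ 2 * pi *+ 2 = a ^+ 2 * (s ^+ 2 * pi *+ 2).
      by rewrite exprMn -mulrA mulrnAr.
    rewrite sqrtrM ?sqr_ge0// sqrtr_sqr gtr0_norm//.
    by rewrite invfM mulrA mulfV ?gt_eqF// mul1r.
  by field; rewrite s0 gt_eqF.
have a0' : 0 <= a by exact: ltW.
rewrite /normal_prob.
under eq_integral do rewrite pdfE.
have mf' : measurable_fun [set: measurableTypeR R]
    (fun x => a * x : measurableTypeR R) by exact: mf.
rewrite -(@ge0_integral_pushforward _ _ _ _ R
  (fun x : measurableTypeR R => a * x : measurableTypeR R) mf' _ B
  (fun y => (a * normal_pdf 0 (a * s) y)%:E)) //; last 2 first.
- apply/measurable_EFinP/measurable_funTS; apply: measurable_funM => //.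
  exact: measurable_normal_pdf.
- by move=> y _; rewrite lee_fin mulr_ge0 ?normal_pdf_ge0.
under eq_integral do rewrite EFinM.
rewrite ge0_integralZl//; last 2 first.
- apply/measurable_EFinP/measurable_funTS; exact: measurable_normal_pdf.
- by move=> y _; rewrite lee_fin normal_pdf_ge0.
have ai0 : 0 <= a^-1 by rewrite invr_ge0.
transitivity (a%:E * \int[mscale (NngNum ai0) mu]_(y in B) (normal_pdf 0 (a * s) y)%:E)%E.
  congr (_ * _)%E; apply: eq_measure_integral => A mA _ /=.
  rewrite /mscale /=; exact: (lebesgue_measure_scale a0 mA).
rewrite ge0_integral_mscale//=; last first.
- by move=> y _; rewrite lee_fin normal_pdf_ge0.
- by apply/measurable_EFinP/measurable_funTS; exact: measurable_normal_pdf.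
by rewrite muleA -EFinM mulfV ?gt_eqF// mul1e.
Qed.

Lemma normal_probN s B : s != 0 -> measurable B ->
  normal_prob 0 s (-%R @^-1` B) = normal_prob 0 s B.
Proof.
move=> s0 mB; rewrite /normal_prob.
have pdfN x : normal_pdf 0 s (- x) = normal_pdf 0 s x.
  by rewrite !normal_pdfE// /normal_fun !subr0 sqrrN.
have mN : measurable_fun [set: measurableTypeR R]
    (fun x : measurableTypeR R => - x : measurableTypeR R).
  exact: oppr_measurable.
under eq_integral do rewrite -pdfN.
rewrite -(@ge0_integral_pushforward _ _ _ _ R
  (fun x : measurableTypeR R => - x : measurableTypeR R) mN _ B
  (fun y => (normal_pdf 0 s y)%:E)) //; last 2 first.
- by apply/measurable_EFinP/measurable_funTS; exact: measurable_normal_pdf.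
- by move=> y _; rewrite lee_fin normal_pdf_ge0.
by apply: eq_measure_integral => A mA _; exact: lebesgue_measureN.
Qed.

(** Multiplying the density of standard deviation s by exp(3 x^2 / (8 s^2)) gives exactly twice the
    density of standard deviation 2 s, because 1/2 - 3/8 = 1/8. Moments are thus bounded without
    being computed, with constants that are not sharp. *)
Lemma integral_normal_le s (g : R -> R) K : 0 < s -> measurable_fun setT g ->
  (forall x, 0 <= g x) -> 0 <= K ->
  (forall x, g x <= K * expR (3 * x ^+ 2 / (8 * s ^+ 2))) ->
  (\int[normal_prob 0 s]_x (g x)%:E <= (2 * K)%:E)%E.
Proof.
move=> s0 mg g0 K0 gK; have sn0 : s != 0 by rewrite gt_eqF.
rewrite (@ge0_integral_density _ _ R mu _ (normal_pdf 0 s)) //; last 2 first.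
- exact: measurable_normal_pdf.
- exact: normal_pdf_ge0.
have pdfle x : g x * normal_pdf 0 s x <= 2 * K * normal_pdf 0 (2 * s) x.
  have s20 : 2 * s != 0 by rewrite mulf_neq0.
  apply: le_trans (_ : K * expR (3 * x ^+ 2 / (8 * s ^+ 2)) * normal_pdf 0 s x <= _).
    by rewrite ler_wpM2r// normal_pdf_ge0.
  rewrite !normal_pdfE// /normal_peak /normal_fun !subr0.
  have -> : (Num.sqrt ((2 * s) ^+ 2 * pi *+ 2))^-1 =
      2^-1 * (Num.sqrt (s ^+ 2 * pi *+ 2))^-1.
    have -> : (2 * s) ^+ 2 * pi *+ 2 = 2 ^+ 2 * (s ^+ 2 * pi *+ 2).
      by rewrite exprMn -mulrA mulrnAr.
    by rewrite sqrtrM ?sqr_ge0// sqrtr_sqr gtr0_norm// invfM.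
  rewrite [leLHS](_ : _ = K * (Num.sqrt (s ^+ 2 * pi *+ 2))^-1 *
    (expR (3 * x ^+ 2 / (8 * s ^+ 2)) * expR (- x ^+ 2 / (s ^+ 2 *+ 2)))); last by ring.
  rewrite -expRD [X in expR X](_ : _ = - x ^+ 2 / ((2 * s) ^+ 2 *+ 2)); last by field.
  move: (_^-1) => c; move: (expR _) => e.
  by rewrite le_eqVlt; apply/orP; left; apply/eqP; field.
apply: (@le_trans _ _ (\int[mu]_x (2 * K * normal_pdf 0 (2 * s) x)%:E)%E).
  apply: ge0_le_integral => //.
  - by move=> x _; rewrite lee_fin mulr_ge0 ?normal_pdf_ge0.
  - apply/measurable_EFinP; apply: measurable_funM => //; exact: measurable_normal_pdf.
  - apply/measurable_EFinP; apply: measurable_funM => //; exact: measurable_normal_pdf.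
  - by move=> x _; rewrite lee_fin.
under eq_integral do rewrite EFinM.
rewrite ge0_integralZl//; last 3 first.
- apply/measurable_EFinP; exact: measurable_normal_pdf.
- by move=> x _; rewrite lee_fin normal_pdf_ge0.
- by rewrite lee_fin mulr_ge0.
by rewrite integral_normal_pdf mule1.
Qed.

Lemma integral_normal_sqr_le s : 0 < s ->
  (\int[normal_prob 0 s]_x (x ^+ 2)%:E <= (8 * s ^+ 2)%:E)%E.
Proof.
move=> s0; have s20 : 0 < s ^+ 2 by exact: exprn_gt0.
(* K = 4 s^2 works since x^2 = (8/3) s^2 y and y <= exp y, where y is the exponent. Only the order
   s^2 matters later. *)
rewrite (_ : 8 * s ^+ 2 = 2 * (4 * s ^+ 2)); last by ring.
apply: integral_normal_le => //.
- by move=> x; exact: sqr_ge0.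
- by rewrite mulr_ge0// ltW.
move=> x; set y := _ / _.
have xy : x ^+ 2 = 8 / 3 * s ^+ 2 * y by rewrite /y; field; rewrite gt_eqF.
have y0 : 0 <= y by apply: divr_ge0; apply: mulr_ge0 => //; apply: sqr_ge0.
have := expR_ge1Dx y; rewrite xy => h.
apply: le_trans (_ : 4 * s ^+ 2 * y <= _); last first.
  by rewrite ler_wpM2l ?mulr_ge0// ?ltW//; lra.
by rewrite ler_wpM2r// ler_wpM2r ?ltW//; lra.
Qed.

Lemma integral_normal_pow4_le s : 0 < s ->
  (\int[normal_prob 0 s]_x (x ^+ 4)%:E <= (64 * s ^+ 4)%:E)%E.
Proof.
move=> s0; have s40 : 0 < s ^+ 4 by exact: exprn_gt0.
rewrite (_ : 64 * s ^+ 4 = 2 * (32 * s ^+ 4)); last by ring.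
apply: integral_normal_le => //.
- by move=> x; rewrite exprn_even_ge0.
- by rewrite mulr_ge0// ltW.
move=> x; set y := _ / _.
have xy : x ^+ 4 = 64 / 9 * s ^+ 4 * y ^+ 2 by rewrite /y; field; rewrite gt_eqF.
have y0 : 0 <= y by apply: divr_ge0; apply: mulr_ge0 => //; apply: sqr_ge0.
have := expR_ge1Dx (y / 2); rewrite xy => h.
(* The square of y / 2 <= exp(y / 2). The constant 32 above is a round bound for 4 times 64 / 9. *)
have h2 : y ^+ 2 <= 4 * expR y.
  have -> : expR y = expR (y / 2) ^+ 2.
    by rewrite -expRM_natl; congr expR; field.
  have : (y / 2) ^+ 2 <= expR (y / 2) ^+ 2.
    have yh : y / 2 <= expR (y / 2) by lra.
    by apply: lerXn2r => //; rewrite nnegrE; [lra|exact: expR_ge0].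
  by rewrite exprMn exprVn; lra.
rewrite [leLHS](_ : _ = s ^+ 4 * (64 / 9 * y ^+ 2)); last by field.
rewrite [leRHS](_ : _ = s ^+ 4 * (32 * expR y)); last by ring.
by apply: ler_wpM2l; [exact: ltW|have := expR_ge0 y; lra].
Qed.

(** Boxes are stable under intersection and generate the sigma-algebra of tuples. *)
Lemma measure_tuple_unique n (m1 m2 : {measure set (n.-tuple R) -> \bar R}) :
  (m1 setT < +oo)%E ->
  (forall B : 'I_n -> set R, (forall i, measurable (B i)) ->
    m1 [set x | forall i, B i (tnth x i)] = m2 [set x | forall i, B i (tnth x i)]) ->
  forall X, measurable X -> m1 X = m2 X.
Proof.
move=> m1oo m12.
pose C : set (set (n.-tuple R)) := [set X | exists2 B : 'I_n -> set R,
  (forall i, measurable (B i)) & X = [set x | forall i, B i (tnth x i)]].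
apply: (measure_unique C (fun _ => setT)) => //.
- apply/seteqP; split.
    rewrite [X in X `<=` _]/measurable /= /g_sigma_preimage.
    apply: sub_smallest2r => //; elim/big_ind: _ => // [A1 A2 h1 h2|i _].
      by rewrite subUset.
    move=> _ [A mA <-]; exists (fun j => if j == i then A else setT).
      by move=> j; case: ifPn.
    apply/seteqP; split => x /=.
      by move=> [_ Ax] j; case: eqP => // ->.
    by move=> /(_ i); rewrite eqxx.
  apply: smallest_sub; first exact: sigma_algebra_measurable.
  move=> _ [B mB ->]; rewrite (_ : [set x | _] =
    \bigcap_(i in [set: 'I_n]) ((fun x => tnth x i) @^-1` B i)); last first.
    apply/seteqP; split => x /= h i => [_|]; first exact: h.
    by have := h i I.
  apply: fin_bigcap_measurable => // i _; rewrite -[X in measurable X]setTI.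
  exact: measurable_tnth.
- move=> _ _ [B mB ->] [B' mB' ->]; exists (fun i => B i `&` B' i).
    by move=> i; exact: measurableI.
  apply/seteqP; split => x /=; first by move=> [h h'] i; split.
  by move=> h; split => i; have [] := h i.
- move=> _; exists (fun _ => setT) => //.
  by apply/seteqP; split.
- by apply/seteqP; split => // x _; exists 0%N.
- by move=> _ [B mB ->]; exact: m12.
Qed.

End Normal.

(** * The range as a seminorm on lists of increments *)

Section PathRange.
Context {R : realType}.
Implicit Types (x y : nat -> R) (f g : R -> R).

(* x lists the m consecutive increments of the path. *)
Definition path_range m x : R :=
  \big[Num.max/0]_(s < m.+1) \big[Num.max/0]_(t < m.+1)
    (\sum_(0 <= k < t) x k - \sum_(0 <= k < s) x k).

Definition grid_incr f (a delta : R) (m k : nat) : R :=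
  f (a + k.+1%:R / m%:R * delta) - f (a + k%:R / m%:R * delta).

Lemma discrete_rangeE f a delta m :
  discrete_range f a delta m = path_range m (grid_incr f a delta m).
Proof.
apply: eq_bigr => s _; apply: eq_bigr => t _.
rewrite (telescope_sumr (fun k => f (a + k%:R / m%:R * delta)))//.
by rewrite (telescope_sumr (fun k => f (a + k%:R / m%:R * delta)))//; ring.
Qed.

Lemma path_range_ge0 m x : 0 <= path_range m x.
Proof. exact: bigmax_ge_id. Qed.

Lemma path_range_le m x c : 0 <= c ->
  (forall s t, (s <= m)%N -> (t <= m)%N ->
    \sum_(0 <= k < t) x k - \sum_(0 <= k < s) x k <= c) -> path_range m x <= c.
Proof.
move=> c0 h; apply/bigmax_leP; split => // s _; apply/bigmax_leP; split => // t _.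
by apply: h; rewrite -ltnS.
Qed.

Lemma le_path_range m x s t : (s <= m)%N -> (t <= m)%N ->
  \sum_(0 <= k < t) x k - \sum_(0 <= k < s) x k <= path_range m x.
Proof.
rewrite -!(ltnS _ m) => sm tm.
apply: le_trans (le_bigmax _ _ (Ordinal sm)).
exact: le_trans (le_bigmax _ _ (Ordinal tm)).
Qed.

Lemma eq_path_range m x y : (forall k, (k < m)%N -> x k = y k) ->
  path_range m x = path_range m y.
Proof.
move=> xy; apply: eq_bigr => s _; apply: eq_bigr => t _; congr (_ - _);
rewrite big_nat [RHS]big_nat; apply: eq_bigr => k /andP[_ kt]; apply: xy;
by rewrite (leq_trans kt)// -ltnS.
Qed.

Lemma path_rangeN m x : path_range m (fun k => - x k) = path_range m x.
Proof.
have le y : path_range m (fun k => - y k) <= path_range m y.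
  apply: path_range_le => [|s t sm tm]; first exact: path_range_ge0.
  by rewrite !sumrN opprK addrC; exact: le_path_range.
apply/eqP; rewrite eq_le le /=.
rewrite [leLHS](_ : _ = path_range m (fun k => - - x k)); first exact: le.
by apply: eq_path_range => k _; rewrite opprK.
Qed.

Lemma path_rangeZ m x c : path_range m (fun k => c * x k) = `|c| * path_range m x.
Proof.
wlog c0 : c / 0 <= c.
  move=> h; have [c0|c0] := leP 0 c; first exact: h.
  rewrite -normrN -h ?oppr_ge0 ?ltW// -path_rangeN.
  by apply: eq_path_range => k _; rewrite mulNr.
rewrite ger0_norm//.
have le e y : 0 <= e -> path_range m (fun k => e * y k) <= e * path_range m y.
  move=> e0; apply: path_range_le => [|s t sm tm].
    by rewrite mulr_ge0 ?path_range_ge0.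
  by rewrite -!mulr_sumr -mulrBr ler_wpM2l// le_path_range.
apply/eqP; rewrite eq_le le//=.
have [->|cn0] := eqVneq c 0; first by rewrite mul0r path_range_ge0.
rewrite -ler_pdivlMl ?lt_neqAle ?(eq_sym 0) ?cn0// .
rewrite [leLHS](_ : _ = path_range m (fun k => c^-1 * (c * x k))).
  by apply: le; rewrite invr_ge0.
by apply: eq_path_range => k _; rewrite mulKf.
Qed.

Lemma path_rangeD m x y :
  path_range m (fun k => x k + y k) <= path_range m x + path_range m y.
Proof.
apply: path_range_le => [|s t sm tm]; first by rewrite addr_ge0 ?path_range_ge0.
by rewrite !big_split /= opprD addrACA lerD ?le_path_range.
Qed.

Lemma path_range_dist m x y :
  `|path_range m x - path_range m y| <= path_range m (fun k => x k - y k).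
Proof.
have le u v : path_range m u - path_range m v <= path_range m (fun k => u k - v k).
  rewrite lerBlDr; apply: le_trans (path_rangeD _ _ _).
  by rewrite le_eqVlt; apply/orP; left; apply/eqP; apply: eq_path_range => k _;
     rewrite subrK.
rewrite ler_norml le andbT lerNl opprB; apply: le_trans (le y x) _.
rewrite -path_rangeN.
by rewrite le_eqVlt; apply/orP; left; apply/eqP; apply: eq_path_range => k _;
   rewrite opprB.
Qed.

Lemma path_range_le_sum m x : path_range m x <= \sum_(0 <= k < m) `|x k|.
Proof.
have sub a b : (a <= b)%N -> (b <= m)%N ->
    `|\sum_(a <= k < b) x k| <= \sum_(0 <= k < m) `|x k|.
  move=> ab bm; apply: le_trans (ler_norm_sum _ _ _) _.
  rewrite [leRHS](big_cat_nat (leq0n a) (leq_trans ab bm)) /=.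
  rewrite [in leRHS](big_cat_nat ab bm) /=.
  have := @sumr_ge0 R _ (index_iota 0 a) xpredT (fun k => `|x k|) (fun _ _ => normr_ge0 _).
  have := @sumr_ge0 R _ (index_iota b m) xpredT (fun k => `|x k|) (fun _ _ => normr_ge0 _).
  lra.
apply: path_range_le => [|s t sm tm]; first exact: sumr_ge0.
have [st|/ltnW ts] := leqP s t.
  rewrite (big_cat_nat (leq0n s) st) /= addrAC subrr add0r.
  exact: le_trans (ler_norm _) (sub _ _ st tm).
rewrite (big_cat_nat (leq0n t) ts) /= opprD addrA subrr add0r.
by apply: le_trans (sub _ _ ts sm); rewrite -normrN ler_norm.
Qed.

End PathRange.

(** * Law of the range of Brownian motion on a block *)

Section RangeLaw.
Context d (T : measurableType d) (R : realType) (P : probability T R).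

(** Q and Q' are general measures, because [discrete_range_law] uses P restricted to an event A on
    one side and P multiplied by the probability of A on the other. *)
Lemma tuple_law_unique n (Q Q' : {measure set T -> \bar R}) (D E : T -> n.-tuple R) :
  measurable_fun setT D -> measurable_fun setT E -> (Q setT < +oo)%E ->
  (forall B : 'I_n -> set R, (forall i, measurable (B i)) ->
    Q [set w | forall i, B i (tnth (D w) i)] =
    Q' [set w | forall i, B i (tnth (E w) i)]) ->
  forall X, measurable X -> Q (D @^-1` X) = Q' (E @^-1` X).
Proof.
move=> mD mE Qoo h X mX.
change (pushforward Q D X = pushforward Q' E X).
exact: measure_tuple_unique.
Qed.

Variables (F : R -> set (set T)) (W : R -> T -> R).
Hypotheses (hF : filtration F) (hW : brownian_motion P F W).

Lemma measurable_wrt_incr s t : 0 <= s -> s <= t ->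
  measurable_wrt (F t) (fun w => W t w - W s w).
Proof.
move=> s0 st; have t0 := le_trans s0 st; have [sF _ mF] := hF.
have [aW _ _ _ _] := hW.
apply/measurable_wrtP; first exact: sF.
apply: measurable_funB; apply/measurable_wrtP; try exact: sF.
  exact: aW.
by apply: measurable_wrtS (aW _ s0); exact: mF.
Qed.

(** The last increment is peeled off by its independence from [F (u m)]; for this the induction has
    to carry that the event built so far belongs to [F (u m)]. *)
Lemma increments_law (u : nat -> R) (B : nat -> set R) A m : 0 <= u 0%N ->
  (forall k, (k < m)%N -> u k < u k.+1) -> F (u 0%N) A ->
  (forall k, measurable (B k)) ->
  let AB := A `&` [set w | forall k, (k < m)%N -> B k (W (u k.+1) w - W (u k) w)] in
  F (u m) AB /\
  P AB = (P A * (\prod_(0 <= k < m)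
    fine (normal_prob 0 (Num.sqrt (u k.+1 - u k)) (B k)))%:E)%E.
Proof.
have [sF Fm FS] := hF; have [_ _ _ lawW indW] := hW.
move=> u0; elim: m => [|m IH] uS FA mB /=.
  rewrite big_geq// mule1 (_ : [set w | _] = setT) ?setIT//.
  by apply/seteqP; split => // w _ k.
have [] := IH (fun k km => uS k (ltnW km)) FA mB; set AB := A `&` _ => FAB PAB.
have um k : (k <= m)%N -> 0 <= u k.
  elim: k => // k IHk km; apply: le_trans (IHk (ltnW km)) _.
  exact/ltW/uS/(leq_trans km).
have um0 := um _ (leqnn m); have uum := uS m (ltnSn m).
pose D w := W (u m.+1) w - W (u m) w.
have -> : A `&` [set w | forall k, (k < m.+1)%N -> B k (W (u k.+1) w - W (u k) w)]
    = AB `&` D @^-1` (B m).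
  apply/seteqP; split => w /=.
    move=> [Aw h]; split; last exact: h.
    by split => // k km; apply: h; exact: leqW.
  move=> [[Aw h] hm]; split => // k; rewrite ltnS leq_eqVlt => /orP[/eqP ->//|].
  exact: h.
split.
  have s1 := sF _ (le_trans um0 (ltW uum)).
  have : F (u m.+1) AB by exact: (FS _ _ um0 (ltW uum) _ FAB).
  have : F (u m.+1) (D @^-1` (B m)).
    by apply: measurable_wrt_incr => //; exact: ltW.
  rewrite -(sigma_algebra_id s1) => mD mAB.
  exact: (@measurableI _ (g_sigma_algebraType (F (u m.+1))) AB _ mAB mD).
rewrite indW// lawW// PAB big_nat_recr//= EFinM muleA; congr (_ * _)%E.
by rewrite fineK//; apply: fin_num_measure; exact: mB.
Qed.

Lemma measurable_path_range d' (T' : measurableType d') (x : nat -> T' -> R) m :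
  (forall k, (k < m)%N -> measurable_fun setT (x k)) ->
  measurable_fun setT (fun w => path_range m (x ^~ w)).
Proof.
move=> mx; rewrite /path_range.
have mbig I (r : seq I) (h : I -> T' -> R) : (forall i, measurable_fun setT (h i)) ->
    measurable_fun setT (fun w => \big[Num.max/0]_(i <- r) h i w).
  move=> mh; elim: r => [|i r IH].
    by under eq_fun do rewrite big_nil; exact: measurable_cst.
  by under eq_fun do rewrite big_cons; exact: measurable_maxr.
apply: (mbig _) => s; apply: (mbig _) => t.
by apply: measurable_funB; apply: measurable_sum_nat => k /andP[_ kt]; apply: mx;
  rewrite (leq_trans kt)// -ltnS.
Qed.

(** The range is a function [Psi] of the m increments. On boxes, [increments_law] gives the same
    product of normal probabilities for the block at a and for [0, 1] rescaled by the root of delta,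
    up to the factor P A; uniqueness extends this to all events. Taking A to be the whole space
    gives Brownian scaling, a general A the independence from [F a]. *)
Lemma discrete_range_law a delta m A B : (0 < m)%N -> 0 <= a -> 0 < delta ->
  F a A -> measurable B ->
  P (A `&` (fun w => discrete_range (W ^~ w) a delta m) @^-1` B) =
  (P A * P ((fun w => (Num.sqrt delta * discrete_range (W ^~ w) 0 1 m)%R) @^-1` B))%E.
Proof.
move=> m0 a0 d0 FA mB.
have [sF Fm FS] := hF; have m0' : 0 < m%:R :> R by rewrite ltr0n.
have mA : measurable A by exact: (Fm _ a0).
pose grid b e k : R := b + k%:R / m%:R * e.
have gridB b e k : grid b e k.+1 - grid b e k = e / m%:R.
  by rewrite /grid -natr1; field; rewrite gt_eqF.
have gridS b e k : 0 < e -> grid b e k < grid b e k.+1.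
  by move=> e0; rewrite -subr_gt0 gridB divr_gt0.
have grid0 b e : grid b e 0%N = b by rewrite /grid mul0r mul0r addr0.
have grid_ge0 b e k : 0 <= b -> 0 < e -> 0 <= grid b e k.
  by move=> b0 e0; rewrite /grid addr_ge0// mulr_ge0 ?divr_ge0// ltW.
have mincr b e k : 0 <= b -> 0 < e ->
    measurable_fun setT (fun w => grid_incr (W ^~ w) b e m k).
  move=> b0 e0; apply: (measurable_wrt_fun (Fm _ (grid_ge0 b e k.+1 b0 e0))).
  by apply: measurable_wrt_incr; [exact: grid_ge0|exact/ltW/gridS].
pose sd : R := Num.sqrt delta.
have sd0 : 0 < sd by rewrite sqrtr_gt0.
pose D w : m.-tuple R := [tuple grid_incr (W ^~ w) a delta m i | i < m].
pose E w : m.-tuple R := [tuple sd * grid_incr (W ^~ w) 0 1 m i | i < m].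
have mD : measurable_fun setT D.
  apply/measurable_fun_tnthP => i; rewrite /D /comp.
  by under eq_fun do rewrite tnth_mktuple; exact: mincr.
have mE : measurable_fun setT E.
  apply/measurable_fun_tnthP => i; rewrite /E /comp.
  under eq_fun do rewrite tnth_mktuple.
  by apply: measurable_funM => //; exact: mincr.
pose Psi (x : m.-tuple R) := path_range m (fun k => nth 0 x k).
have mPsi : measurable_fun setT Psi.
  apply: measurable_path_range => k km.
  rewrite [X in measurable_fun _ X](_ : _ = (fun x => tnth x (Ordinal km))).
    exact: measurable_tnth.
  by apply/funext => x; rewrite (tnth_nth 0).
have PsiD w : Psi (D w) = discrete_range (W ^~ w) a delta m.
  rewrite discrete_rangeE; apply: eq_path_range => k km.
  by rewrite -(tnth_nth 0 _ (Ordinal km)) tnth_mktuple.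
have PsiE w : Psi (E w) = sd * discrete_range (W ^~ w) 0 1 m.
  rewrite discrete_rangeE -[X in X * _](gtr0_norm sd0) -path_rangeZ.
  apply: eq_path_range => k km.
  by rewrite -(tnth_nth 0 _ (Ordinal km)) tnth_mktuple.
pose Q' := mscale (NngNum (fine_ge0 (measure_ge0 P A))) P.
have key : forall X, measurable X -> mrestr P mA (D @^-1` X) = Q' (E @^-1` X).
  apply: tuple_law_unique => //.
    by change (P (setT `&` A) < +oo)%E; rewrite setTI (le_lt_trans (probability_le1 P mA))// ltry.
  move=> B' mB'; change (P ([set w | forall i, B' i (tnth (D w) i)] `&` A) =
    (fine (P A))%:E * P [set w | forall i, B' i (tnth (E w) i)])%E.
  (* [increments_law] takes constraints indexed by all naturals; those beyond the tuple are made
     void. *)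
  pose B'' (k : nat) := if insub k is Some i then B' i else setT.
  have mB'' k : measurable (B'' k) by rewrite /B''; case: insub.
  have B''E (i : 'I_m) : B'' i = B' i by rewrite /B'' valK.
  have [||||_ PD] := @increments_law (grid a delta) B'' A m; rewrite ?grid0//.
    by move=> k km; exact: gridS.
  have m01 : F 0 setT.
    have s0 := sF _ (lexx 0); rewrite -(sigma_algebra_id s0).
    exact: (@measurableT _ (g_sigma_algebraType (F 0))).
  have [||||_ PE] := @increments_law (grid 0 1) (fun k => (fun x => sd * x) @^-1` B'' k) setT m;
    rewrite ?grid0//.
  - by move=> k km; exact: gridS.
  - move=> k; rewrite -[X in measurable X]setTI; apply: (_ : measurable_fun _ _) => //.
    exact: measurable_funM.
  rewrite setIC (_ : [set w | _] = [set w | forall k, (k < m)%N ->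
      B'' k (W (grid a delta k.+1) w - W (grid a delta k) w)]); last first.
    apply/seteqP; split => w /= h.
      by move=> k km; have := h (Ordinal km); rewrite tnth_mktuple -B''E.
    by move=> i; rewrite tnth_mktuple -B''E; exact: h.
  rewrite (fineK (fin_num_measure P _ mA)).
  apply: (etrans PD).
  apply: (congr1 (fun z => P A * z)%E).
  rewrite (_ : [set w | _] = setT `&` [set w | forall k, (k < m)%N ->
      ((fun x => sd * x) @^-1` B'' k) (W (grid 0 1 k.+1) w - W (grid 0 1 k) w)]); last first.
    rewrite setTI; apply/seteqP; split => w /= h.
      by move=> k km; have := h (Ordinal km); rewrite tnth_mktuple -B''E.
    by move=> i; rewrite tnth_mktuple -B''E; exact: h.
  rewrite PE probability_setT mul1e.
  apply: (congr1 EFin); apply: eq_bigr => k _; apply: (congr1 fine).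
  rewrite !gridB normal_prob_scale//; last first.
    by rewrite gt_eqF// sqrtr_gt0 divr_gt0.
  have -> // : sd * Num.sqrt (1 / m%:R) = Num.sqrt (delta / m%:R).
  by rewrite -sqrtrM ?ltW// mul1r.
have mPB : measurable (Psi @^-1` B) by rewrite -[X in measurable X]setTI; exact: mPsi.
have : (P ((D @^-1` (Psi @^-1` B)) `&` A) =
    (fine (P A))%:E * P (E @^-1` (Psi @^-1` B)))%E by exact: key mPB.
rewrite fineK ?fin_num_measure// => h.
have -> : (fun w => discrete_range (W ^~ w) a delta m) = Psi \o D.
  by apply/funext => w; rewrite /= PsiD.
have -> : (fun w => sd * discrete_range (W ^~ w) 0 1 m) = Psi \o E.
  by apply/funext => w; rewrite /= PsiE.
by rewrite setIC -h.
Qed.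

End RangeLaw.

(** Cauchy-Schwarz against the constant 1; the induction step is (S - m x)^2 / m >= 0. *)
Lemma sqr_sum_le (R : realFieldType) (a : nat -> R) m :
  (\sum_(0 <= k < m) a k) ^+ 2 <= m%:R * \sum_(0 <= k < m) a k ^+ 2.
Proof.
elim: m => [|m IH]; first by rewrite !big_geq// expr0n mul0r.
rewrite !big_nat_recr//=; move: IH.
set S := \sum_(0 <= k < m) a k; set Q := \sum_(0 <= k < m) a k ^+ 2; set x := a m.
have [->|m0] := posnP m.
  rewrite mul0r => S0; have /eqP : S ^+ 2 = 0 by apply/eqP; rewrite eq_le S0 sqr_ge0.
  rewrite sqrf_eq0 => /eqP ->; have : 0 <= Q by apply: sumr_ge0 => k _; exact: sqr_ge0.
  by rewrite add0r mul1r; lra.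
have m0' : 0 < m%:R :> R by rewrite ltr0n.
move=> IH; rewrite -natr1.
have : 0 <= (S - m%:R * x) ^+ 2 / m%:R by rewrite divr_ge0 ?sqr_ge0// ltW.
have -> : (S - m%:R * x) ^+ 2 / m%:R = S ^+ 2 / m%:R - 2 * S * x + m%:R * x ^+ 2.
  by field; rewrite gt_eqF.
have : S ^+ 2 / m%:R <= Q by rewrite ler_pdivrMr// mulrC.
by rewrite sqrrD; lra.
Qed.

(** * Moments of Brownian increments and of their range *)

Section Moments.
Context d (T : measurableType d) (R : realType) (P : probability T R).

Lemma law_integral d' (S : measurableType d') (nu : {measure set S -> \bar R})
    (D : T -> S) (g : S -> R) :
  measurable_fun setT D -> (forall B, measurable B -> P (D @^-1` B) = nu B) ->
  measurable_fun setT g -> (forall x, 0 <= g x) ->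
  (\int[P]_w (g (D w))%:E = \int[nu]_x (g x)%:E)%E.
Proof.
move=> mD lD mg g0.
pose D' : {mfun T >-> S} := HB.pack D (isMeasurableFun.Build _ _ _ _ _ mD).
rewrite -(@ge0_integral_distribution _ _ _ _ _ P D' (EFin \o g)); last 2 first.
- exact/measurable_EFinP.
- by move=> x; rewrite lee_fin.
by apply: eq_measure_integral => A mA _; exact: lD.
Qed.

Variables (F : R -> set (set T)) (W : R -> T -> R).
Hypotheses (hF : filtration F) (hW : brownian_motion P F W).

Section Increment.
Variables s t : R.
Hypotheses (s0 : 0 <= s) (st : s < t).
Let D w := W t w - W s w.
Let sd := Num.sqrt (t - s).

Let sd0 : 0 < sd. Proof. by rewrite sqrtr_gt0 subr_gt0. Qed.

Lemma measurable_incr : measurable_fun setT D.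
Proof.
have [_ Fm _] := hF; have t0 : 0 <= t by exact: le_trans (ltW st).
by apply: (measurable_wrt_fun (Fm _ t0)); exact: (measurable_wrt_incr hF hW s0 (ltW st)).
Qed.

Let lawD B : measurable B -> P (D @^-1` B) = normal_prob 0 sd B.
Proof. by move=> mB; have [_ _ _ lawW _] := hW; exact: lawW. Qed.

Lemma incr_indep : indep_of P (F s) D.
Proof. by move=> A B FA mB; have [_ _ _ _ indW] := hW; exact: indW. Qed.

Lemma incr_sqr_le : (\int[P]_w (D w ^+ 2)%:E <= (8 * (t - s))%:E)%E.
Proof.
rewrite (law_integral (nu := normal_prob 0 sd) measurable_incr lawD
  (g := fun x => x ^+ 2)) //; last by move=> x; exact: sqr_ge0.
by apply: le_trans (integral_normal_sqr_le sd0) _; rewrite sqr_sqrtr// subr_ge0 ltW.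
Qed.

Lemma incr_pow4_le : (\int[P]_w (D w ^+ 4)%:E <= (64 * (t - s) ^+ 2)%:E)%E.
Proof.
rewrite (law_integral (nu := normal_prob 0 sd) measurable_incr lawD
  (g := fun x => x ^+ 4)) //; last by move=> x; exact: exprn_even_ge0.
apply: le_trans (integral_normal_pow4_le sd0) _.
by rewrite (exprM sd 2 2) sqr_sqrtr// subr_ge0 ltW.
Qed.

(** By symmetry D and -D have the same law, so the positive and the negative part of D have the same
    finite integral. *)
Lemma incr_integral0 : (\int[P]_w (D w)%:E = 0)%E.
Proof.
have iD : P.-integrable setT (fun w => (D w)%:E).
  by apply: sq_integrable; [exact: measurable_incr|exact: le_lt_trans incr_sqr_le (ltry _)].
have mN : measurable_fun setT (fun w => - D w).
  by apply: measurableT_comp => //; exact: measurable_incr.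
have lawN B : measurable B -> P ((fun w => - D w) @^-1` B) = normal_prob 0 sd B.
  move=> mB; rewrite -normal_probN ?gt_eqF// -lawD//.
  by rewrite -[X in measurable X]setTI; exact: oppr_measurable.
pose g (x : R) := Num.max x 0.
have mg : measurable_fun setT g by exact: measurable_maxr.
have g0 x : 0 <= g x by rewrite le_max lexx orbT.
have E1 := law_integral (nu := normal_prob 0 sd) measurable_incr lawD mg g0.
have E2 := law_integral (nu := normal_prob 0 sd) mN lawN mg g0.
rewrite integralE.
rewrite [X in (X - _)%E](_ : _ = \int[P]_w (g (D w))%:E)%E; last first.
  by apply: eq_integral => w _; rewrite funeposE EFin_max.
rewrite [X in (_ - X)%E](_ : _ = \int[P]_w (g (- D w))%:E)%E; last first.
  by apply: eq_integral => w _; rewrite funenegE EFin_max.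
rewrite E1 E2 subee// -E1.
apply: integrable_fin_num => //; apply: le_integrable iD => //.
  by apply/measurable_EFinP; exact: measurableT_comp mg measurable_incr.
move=> w _ /=; rewrite lee_fin ger0_norm// /g ge_max normr_ge0 andbT; exact: ler_norm.
Qed.

(** A zero second moment would concentrate the normal law at 0, but it is absolutely continuous and
    gives no mass to a point. This is what makes lambda positive. *)
Lemma incr_sqr_neq0 : (\int[P]_w (D w ^+ 2)%:E != 0)%E.
Proof.
rewrite (law_integral (nu := normal_prob 0 sd) measurable_incr lawD
  (g := fun x => x ^+ 2)) //; last by move=> x; exact: sqr_ge0.
apply/eqP => D20.
have /ae_eq_integral_abs : (\int[normal_prob 0 sd]_x `|(x ^+ 2)%:E| = 0)%E.
  by under eq_integral do rewrite gee0_abs ?lee_fin ?sqr_ge0//.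
move=> /(_ measurableT) [].
  by apply/measurable_EFinP; exact: exprn_measurable.
move=> N [mN N0 NE].
have n00 : normal_prob 0 sd [set 0] = 0%E.
  have /null_content_dominatesP h := normal_prob_dominates (0 : R) sd.
  by apply: h => //; exact: lebesgue_measure_set1.
have : (normal_prob 0 sd setT <= normal_prob 0 sd (N `|` [set 0%R]))%E.
  apply: le_measure; rewrite ?inE//; first exact: measurableU.
  move=> x _; have [->|x0] := eqVneq x 0; [by right|left].
  by apply: NE => /= /(_ I) [] /eqP; rewrite sqrf_eq0 (negbTE x0).
rewrite probability_setT measureU0// N0.
by rewrite leNgt lte01.
Qed.

End Increment.

Section Block.
Variable m : nat.
Hypothesis m0 : (0 < m)%N.
Let m0' : 0 < m%:R :> R. Proof. by rewrite ltr0n. Qed.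
Let Rg a delta w := discrete_range (W ^~ w) a delta m.

Lemma measurable_wrt_discrete_range a delta : 0 <= a -> 0 < delta ->
  measurable_wrt (F (a + delta)) (Rg a delta).
Proof.
move=> a0 d0; have [sF Fm FS] := hF.
have grid_ge0 k : 0 <= a + k%:R / m%:R * delta.
  by rewrite addr_ge0// mulr_ge0 ?divr_ge0// ltW.
have ad0 : 0 <= a + delta by rewrite addr_ge0// ltW.
apply/measurable_wrtP; first exact: sF.
rewrite [X in measurable_fun _ X](_ : _ =
    (fun w => path_range m (grid_incr (W ^~ w) a delta m))); last first.
  by apply/funext => w; rewrite /Rg discrete_rangeE.
apply: (@measurable_path_range _ _ (g_sigma_algebraType (F (a + delta)))
  (fun k w => grid_incr (W ^~ w) a delta m k)).
move=> k km; apply/measurable_wrtP; first exact: sF.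
have kS : a + k%:R / m%:R * delta <= a + k.+1%:R / m%:R * delta.
  by rewrite lerD2l ler_wpM2r ?ltW// ltr_pM2r ?invr_gt0// ltr_nat.
apply: measurable_wrtS (measurable_wrt_incr hF hW (grid_ge0 k) kS).
apply: FS; first exact: grid_ge0.
rewrite lerD2l -[leRHS]mul1r; apply: ler_wpM2r; first exact: ltW.
by rewrite ler_pdivrMr// mul1r ler_nat.
Qed.

(** The range is at most the sum of the |D k|, and Cauchy-Schwarz used twice bounds its fourth power
    by m^3 times the sum of the D^4. Fourth moments are needed for the variance of the squared
    range. *)
Lemma discrete_range_pow4_lty : (\int[P]_w (Rg 0 1 w ^+ 4)%:E < +oo)%E.
Proof.
have grid_ge0 k : 0 <= 0 + k%:R / m%:R * 1 :> R.
  by rewrite add0r mulr1 divr_ge0.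
have kS k : 0 + k%:R / m%:R * 1 < 0 + k.+1%:R / m%:R * 1 :> R.
  by rewrite !add0r !mulr1 ltr_pM2r ?invr_gt0// ltr_nat.
pose D k w := grid_incr (W ^~ w) 0 1 m k.
have mD k : measurable_fun setT (D k) by exact: (measurable_incr (grid_ge0 k) (kS k)).
apply: (@le_lt_trans _ _ (\int[P]_w (\sum_(0 <= k < m) (m%:R ^+ 3 * D k w ^+ 4)%:E))%E).
  apply: ge0_le_integral => //.
  - by move=> w _; rewrite lee_fin exprn_even_ge0.
  - have [_ Fm _] := hF; apply/measurable_EFinP; apply: measurable_funX.
    apply: (measurable_wrt_fun (Fm (0 + 1) _)); last exact: measurable_wrt_discrete_range.
    by rewrite add0r.
  - apply: emeasurable_sum => k; apply/measurable_EFinP; apply: measurable_funM => //.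
    exact: measurable_funX.
  - move=> w _; rewrite sumEFin lee_fin -mulr_sumr /Rg discrete_rangeE.
    have h1 := path_range_le_sum m (grid_incr (W ^~ w) 0 1 m).
    have h2 := sqr_sum_le (fun k => `|D k w|) m.
    have h3 := sqr_sum_le (fun k => `|D k w| ^+ 2) m.
    have h4 : path_range m (grid_incr (W ^~ w) 0 1 m) ^+ 2 <=
        (\sum_(0 <= k < m) `|D k w|) ^+ 2.
      by rewrite lerXn2r ?nnegrE ?path_range_ge0 ?sumr_ge0.
    rewrite (exprM _ 2 2).
    apply: (@le_trans _ _ ((m%:R * \sum_(0 <= k < m) `|D k w| ^+ 2) ^+ 2)).
      apply: lerXn2r (le_trans h4 h2); rewrite nnegrE ?sqr_ge0//.
      by rewrite mulr_ge0// sumr_ge0// => k _; exact: sqr_ge0.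
    rewrite exprMn [leRHS](_ : _ = m%:R ^+ 2 *
      (m%:R * \sum_(0 <= i < m) D i w ^+ 4)); last by ring.
    apply: ler_wpM2l; first exact: sqr_ge0.
    apply: le_trans h3 _; rewrite le_eqVlt; apply/orP; left; apply/eqP.
    congr (_ * _); apply: eq_bigr => k _.
    by rewrite -exprM -normrX ger0_norm// exprn_even_ge0.
rewrite ge0_integral_sum//; last 2 first.
- move=> k; apply/measurable_EFinP; apply: measurable_funM => //; exact: measurable_funX.
- by move=> k w _; rewrite lee_fin; apply: mulr_ge0; [exact: exprn_ge0|exact: exprn_even_ge0].
apply/lte_sum_pinfty => k _; under eq_integral do rewrite EFinM.
rewrite ge0_integralZl_EFin//; last 2 first.
- by move=> w _; rewrite lee_fin exprn_even_ge0.
- by apply/measurable_EFinP; exact: measurable_funX.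
rewrite lte_mul_pinfty ?lee_fin ?exprn_ge0//.
exact: le_lt_trans (incr_pow4_le (grid_ge0 k) (kS k)) (ltry _).
Qed.

Lemma measurable_discrete_range a delta : 0 <= a -> 0 < delta ->
  measurable_fun setT (Rg a delta).
Proof.
move=> a0 d0; have [_ Fm _] := hF.
apply: (measurable_wrt_fun (Fm (a + delta) _)).
  by rewrite addr_ge0// ltW.
exact: measurable_wrt_discrete_range.
Qed.

Let lam := range_moment P W 2 m.

Let mR01 : measurable_fun setT (Rg 0 1).
Proof. exact: measurable_discrete_range. Qed.

(** The second moment is finite because the fourth one is, so [fine] in [range_moment] loses
    nothing. *)
Lemma range_momentE : (\int[P]_w (Rg 0 1 w ^+ 2)%:E = lam%:E)%E.
Proof.
rewrite /lam /range_moment unlock.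
under [in RHS]eq_integral do rewrite powR_mulrn ?discrete_rangeE ?path_range_ge0//.
under [in RHS]eq_integral do rewrite -discrete_rangeE.
rewrite fineK//; apply: integrable_fin_num => //.
apply: sq_integrable; first exact: measurable_funX.
by under eq_integral do rewrite -exprM; exact: discrete_range_pow4_lty.
Qed.

(** The range dominates |W 1 - W 0|, since both endpoints are observed as m > 0. *)
Lemma range_moment_gt0 : 0 < lam.
Proof.
have lam0 : 0 <= lam.
  by rewrite -lee_fin -range_momentE; apply: integral_ge0 => w _; rewrite lee_fin sqr_ge0.
rewrite lt_neqAle lam0 andbT eq_sym; apply/eqP => l0.
have := incr_sqr_neq0 (lexx 0) (ltr01 : (0 : R) < 1); apply/negP; rewrite negbK.
rewrite eq_le integral_ge0 ?andbT; last by move=> w _; rewrite lee_fin sqr_ge0.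
apply: (@le_trans _ _ lam%:E); last by rewrite l0.
rewrite -range_momentE; apply: ge0_le_integral => //.
- by move=> w _; rewrite lee_fin sqr_ge0.
- apply/measurable_EFinP; apply: measurable_funX.
  exact: (measurable_incr (lexx 0) ltr01).
- by apply/measurable_EFinP; exact: measurable_funX.
move=> w _; rewrite lee_fin -real_normK ?num_real// lerXn2r ?nnegrE//.
  by rewrite /Rg discrete_rangeE path_range_ge0.
have E : \sum_(0 <= k < m) grid_incr (W ^~ w) 0 1 m k = W 1 w - W 0 w.
  rewrite (telescope_sumr (fun k => W (0 + k%:R / m%:R * 1) w))//.
  by rewrite mul0r mulfV ?gt_eqF// !(addr0, add0r, mulr1, mul1r).
rewrite -E /Rg discrete_rangeE ler_norml lerNl.
have h1 := le_path_range (grid_incr (W ^~ w) 0 1 m) (leq0n m) (leqnn m).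
have h2 := le_path_range (grid_incr (W ^~ w) 0 1 m) (leqnn m) (leq0n m).
by move: h1 h2; rewrite [X in _ - X](big_geq)// subr0 [X in X - _]big_geq// sub0r => -> ->.
Qed.

Lemma discrete_range_integral a delta n : 0 <= a -> 0 < delta ->
  (\int[P]_w (Rg a delta w ^+ n)%:E =
   \int[P]_w ((Num.sqrt delta * Rg 0 1 w) ^+ n)%:E)%E.
Proof.
move=> a0 d0; have [sF Fm _] := hF.
have mR := measurable_discrete_range a0 d0.
have mR' : measurable_fun setT (fun w => Num.sqrt delta * Rg 0 1 w).
  exact: measurable_funM.
pose R' : {mfun T >-> R} := HB.pack (fun w => Num.sqrt delta * Rg 0 1 w)
  (isMeasurableFun.Build _ _ _ _ _ mR').
(* [law_integral] asks for a function that is non-negative on the whole line; as ranges are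
   non-negative, the absolute value changes nothing. *)
pose g (x : R) := `|x| ^+ n.
have mg : measurable_fun setT g by apply: measurable_funX; exact: normr_measurable.
have g0 x : 0 <= g x by exact: exprn_ge0.
have lawR B : measurable B -> P (Rg a delta @^-1` B) = distribution P R' B.
  move=> mB; have FaT : F a setT.
    have s0 := sF _ a0; rewrite -(sigma_algebra_id s0).
    exact: (@measurableT _ (g_sigma_algebraType (F a))).
  have := discrete_range_law hF hW m0 a0 d0 FaT mB.
  by rewrite setTI probability_setT mul1e.
have := law_integral mR lawR mg g0.
rewrite ge0_integral_distribution//; last exact/measurable_EFinP.
have R0 b e w : 0 <= Rg b e w by rewrite /Rg discrete_rangeE path_range_ge0.
under eq_integral do rewrite /g ger0_norm//.
move=> ->; apply: eq_integral => w _.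
by rewrite /g /= ger0_norm// mulr_ge0.
Qed.

Definition centered_range a delta w := Rg a delta w ^+ 2 - delta * lam.

Lemma measurable_wrt_centered_range a delta : 0 <= a -> 0 < delta ->
  measurable_wrt (F (a + delta)) (centered_range a delta).
Proof.
move=> a0 d0; have [sF _ _] := hF.
have ad0 : 0 <= a + delta by rewrite addr_ge0// ltW.
apply/measurable_wrtP; first exact: sF.
apply: measurable_funB => //; apply: measurable_funX; apply/measurable_wrtP.
  exact: sF.
exact: measurable_wrt_discrete_range.
Qed.

Lemma centered_range_indep a delta : 0 <= a -> 0 < delta ->
  indep_of P (F a) (centered_range a delta).
Proof.
move=> a0 d0 A B FA mB; have [sF _ _] := hF.
pose g (x : R) := x ^+ 2 - delta * lam.
have mg : measurable_fun setT g.
  by apply: measurable_funB => //; exact: exprn_measurable.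
have mgB : measurable (g @^-1` B) by rewrite -[X in measurable X]setTI; exact: mg.
have FaT : F a setT.
  have s0 := sF _ a0; rewrite -(sigma_algebra_id s0).
  exact: (@measurableT _ (g_sigma_algebraType (F a))).
have hA := discrete_range_law hF hW m0 a0 d0 FA mgB.
have := discrete_range_law hF hW m0 a0 d0 FaT mgB.
rewrite setTI probability_setT mul1e => hT.
by rewrite -hT in hA.
Qed.

Lemma centered_range_integral0 a delta : 0 <= a -> 0 < delta ->
  (\int[P]_w (centered_range a delta w)%:E = 0)%E.
Proof.
move=> a0 d0; have mR := measurable_discrete_range a0 d0.
have ER : (\int[P]_w (Rg a delta w ^+ 2)%:E = (delta * lam)%:E)%E.
  rewrite discrete_range_integral//.
  under eq_integral do rewrite exprMn sqr_sqrtr ?(ltW d0)// EFinM.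
  rewrite ge0_integralZl_EFin ?(ltW d0)//; last 2 first.
  - by move=> w _; rewrite lee_fin sqr_ge0.
  - by apply/measurable_EFinP; exact: measurable_funX.
  by rewrite range_momentE.
have iR : P.-integrable setT (fun w => (Rg a delta w ^+ 2)%:E).
  apply/integrableP; split; first by apply/measurable_EFinP; exact: measurable_funX.
  by under eq_integral do rewrite gee0_abs ?lee_fin ?sqr_ge0//; rewrite ER ltry.
under eq_integral do rewrite /centered_range EFinB.
rewrite integralB//; last exact: finite_measure_integrable_cst.
by rewrite ER integral_cst//= probability_setT mule1 subee.
Qed.

(** By scaling, the fourth moment of the range is delta^2 times its value over [0, 1], and (x - y)^2
    <= 2 x^2 + 2 y^2. With delta = 1 / n the n variances add up to order 1 / n, which is the law of
    large numbers behind the result. *)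
Lemma centered_range_sqr_le : exists2 K : R, 0 < K & forall a delta,
  0 <= a -> 0 < delta ->
  (\int[P]_w (centered_range a delta w ^+ 2)%:E <= (K * delta ^+ 2)%:E)%E.
Proof.
pose kappa := fine (\int[P]_w (Rg 0 1 w ^+ 4)%:E)%E.
have k0 : 0 <= kappa.
  by apply/fine_ge0/integral_ge0 => w _; rewrite lee_fin exprn_even_ge0.
have kE : (\int[P]_w (Rg 0 1 w ^+ 4)%:E = kappa%:E)%E.
  rewrite /kappa fineK// ge0_fin_numE ?discrete_range_pow4_lty//.
  by apply: integral_ge0 => w _; rewrite lee_fin exprn_even_ge0.
exists (2 * kappa + 2 * lam ^+ 2).
  by have := range_moment_gt0 => l0; have := exprn_gt0 2 l0; rewrite /lam; lra.
move=> a delta a0 d0; have mR := measurable_discrete_range a0 d0.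
have mR4 : measurable_fun setT (fun w => (Rg a delta w ^+ 4)%:E).
  by apply/measurable_EFinP; exact: measurable_funX.
apply: (@le_trans _ _ (\int[P]_w (2%:E * (Rg a delta w ^+ 4)%:E +
    (2 * (delta * lam) ^+ 2)%:E))%E).
  apply: ge0_le_integral => //.
  - by move=> w _; rewrite lee_fin sqr_ge0.
  - apply/measurable_EFinP; apply: measurable_funX; apply: measurable_funB => //.
    exact: measurable_funX.
  - by apply: emeasurable_funD => //; exact: measurable_funeM.
  - move=> w _; rewrite -EFinM -EFinD lee_fin /centered_range (exprM _ 2 2).
    by have := sqr_ge0 (Rg a delta w ^+ 2 + delta * lam); rewrite sqrrB sqrrD; lra.
rewrite ge0_integralD//; last 3 first.
- by move=> w _; rewrite mule_ge0// lee_fin exprn_even_ge0.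
- exact: measurable_funeM.
- by move=> w _; rewrite lee_fin mulr_ge0// sqr_ge0.
rewrite ge0_integralZl_EFin//; last first.
  by move=> w _; rewrite lee_fin exprn_even_ge0.
rewrite integral_cst//= probability_setT mule1 discrete_range_integral//.
under eq_integral do rewrite exprMn (exprM (Num.sqrt _) 2 2) sqr_sqrtr ?(ltW d0)// EFinM.
rewrite ge0_integralZl_EFin ?sqr_ge0//; last 2 first.
- by move=> w _; rewrite lee_fin exprn_even_ge0.
- by apply/measurable_EFinP; exact: measurable_funX.
by rewrite kE -!EFinM -EFinD lee_fin exprMn; lra.
Qed.

End Block.

End Moments.

(** * Cadlag functions *)

Section UnitCover.
Context {R : realType}.

Lemma unit_cover (delta : R -> R) : (forall x, 0 <= x <= 1 -> 0 < delta x) ->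
  exists s : seq R, (forall x, x \in s -> 0 <= x <= 1) /\
    forall u, 0 <= u <= 1 -> exists2 x, x \in s & `|x - u| < delta x.
Proof.
move=> d0; have := @segment_compact R 0 1; rewrite compact_cover.
move=> /(_ _ `[0, 1]%classic (fun x : R => ball (x : R^o) (delta x))) [].
- by move=> x; rewrite /= in_itv /= => /d0 dx; exact: ball_open.
- move=> x; rewrite /= in_itv /= => x01; exists x; first by rewrite /= in_itv.
  exact: ballxx (d0 _ x01).
move=> D' D'01 cov; exists (finmap.enum_fset D'); split => [x xD|u u01].
  by have := D'01 x xD; rewrite in_setE /= in_itv.
have [|x xD ux] := cov u; first by rewrite /= in_itv.
by exists x.
Qed.

(** The radii of a finite cover are halved: if s is within delta x / 2 of a center x, then t close
    to s is still within delta x. Both the uniform continuity of I and the separation of jumps are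
    instances. *)
Lemma unit_lebesgue_number (Q : R -> R -> Prop) :
  (forall x, 0 <= x <= 1 -> exists2 delta, 0 < delta &
    forall s t, 0 <= s <= 1 -> 0 <= t <= 1 -> `|x - s| < delta ->
      `|x - t| < delta -> Q s t) ->
  exists2 delta, 0 < delta & forall s t, 0 <= s <= 1 -> 0 <= t <= 1 ->
    `|s - t| < delta -> Q s t.
Proof.
move=> h; pose ex x (x01 : 0 <= x <= 1) := h x x01.
have /choice[delta hd] : forall x, exists delta, 0 <= x <= 1 -> 0 < delta /\
    forall s t, 0 <= s <= 1 -> 0 <= t <= 1 -> `|x - s| < delta ->
      `|x - t| < delta -> Q s t.
  move=> x; have [x01|nx] := boolP (0 <= x <= 1); last by exists 1.
  by have [e e0 he] := h x x01; exists e.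
have [|s [s01 cov]] := @unit_cover (fun x => delta x / 2).
  by move=> x /hd [dx _]; rewrite divr_gt0.
have [e e0 he] : exists2 e, 0 < e & forall x, x \in s -> e <= delta x / 2.
  elim: s s01 {cov} => [|x s IH] s01; first by exists 1.
  have [|e e0 he] := IH; first by move=> y ys; apply: s01; rewrite inE ys orbT.
  have dx : 0 < delta x / 2.
    by rewrite divr_gt0//; have [] := hd x (s01 x (mem_head _ _)).
  exists (Num.min e (delta x / 2)); first by rewrite lt_min e0.
  by move=> y; rewrite inE => /orP[/eqP ->|/he ey]; rewrite ge_min ?lexx ?orbT// ey.
exists e => // u v u01 v01 uv; have [x xs xu] := cov _ u01.
have [dx hx] := hd _ (s01 _ xs); apply: hx => //; first by lra.
have := he _ xs; have := ler_distD u x v; lra.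
Qed.

End UnitCover.

Section Cadlag.
Context {R : realType}.
Implicit Types (f : R -> R).
Local Notation mu := (@lebesgue_measure R).

(** At x = 0 the clause about the left limit is vacuous, so that limit need not exist. *)
Lemma cadlag_local f x eps : cadlag f -> 0 <= x -> 0 < eps ->
  exists delta, [/\ 0 < delta,
    forall u, x <= u -> u < x + delta -> `|f x - f u| < eps &
    forall u, 0 <= u -> u < x -> x < u + delta ->
      `|lim (f s @[s --> x^'-]) - f u| < eps].
Proof.
move=> [fr fl] x0 e0.
have [e1 e10 he1] : exists2 e, 0 < e & forall u, x <= u -> u < x + e -> `|f x - f u| < eps.
  have /cvgrPdist_lt/(_ _ e0) /nbhs_ballP[e /= ep he] := fr _ x0.
  exists e => // u; rewrite le_eqVlt => /orP[/eqP <- _|xu ux].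
    by rewrite subrr normr0.
  by apply: he => //; rewrite /ball /= ltr_distlC; lra.
have [xgt|x_le] := ltP 0 x; last first.
  exists e1; split => // u u0 ux; have : u < 0 by exact: lt_le_trans ux x_le.
  by rewrite ltNge u0.
have /cvgrPdist_lt/(_ _ e0) /nbhs_ballP[e2 /= e20 he2] := fl _ xgt.
exists (Num.min e1 e2); split; first by rewrite lt_min e10.
  by move=> u xu ux; apply: he1 => //; apply: lt_le_trans ux _; rewrite lerD2l ge_min lexx.
move=> u u0 ux xu; apply: he2 => //; rewrite /ball /= ltr_distlC.
have : Num.min e1 e2 <= e2 by rewrite ge_min lexx orbT.
by lra.
Qed.

Lemma cadlag_bounded f : cadlag f ->
  exists2 M, 0 <= M & forall u, 0 <= u <= 1 -> `|f u| <= M.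
Proof.
move=> cf.
have /choice[g hg] : forall x, exists p : R * R, 0 <= x <= 1 -> 0 < p.1 /\
    forall u, 0 <= u <= 1 -> `|x - u| < p.1 -> `|f u| <= p.2.
  move=> x; have [x01|nx] := boolP (0 <= x <= 1); last by exists (1, 1).
  have [delta [d0 hr hl]] := cadlag_local cf (proj1 (andP x01)) ltr01.
  set l := lim _ in hl.
  exists (delta, `|f x| + `|l| + 1) => _ /=; split => // u u01; rewrite ltr_distlC => xu.
  have [ux|xu'] := leP x u.
    have : `|f x - f u| < 1 by apply: hr => //; lra.
    have := ler_distD 0 (f u) (f x); have := lerB_dist (f u) (f x); rewrite distrC.
    by have := normr_ge0 l; lra.
  have : `|l - f u| < 1 by apply: hl => //; lra.
  by have := lerB_dist (f u) l; rewrite distrC; have := normr_ge0 (f x); lra.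
have [|s [s01 cov]] := @unit_cover R (fun x => (g x).1); first by move=> x /hg[].
exists (\sum_(x <- s) `|(g x).2|) => [|u u01]; first exact: sumr_ge0.
have [x xs xu] := cov _ u01; have [_ /(_ _ u01 xu) h] := hg _ (s01 _ xs).
apply: le_trans h _; rewrite (big_rem x)//=.
by apply: le_trans (ler_norm _) _; rewrite lerDl sumr_ge0.
Qed.

(** Near x every value of c is within 1/4 of c x or of its left limit, and these differ by at most
    1. Two values thus differ by less than 2, hence by at most 1 since they are integers. *)
Lemma counting_path_incr_le1 (c : R -> nat) : simple_counting_path c ->
  exists2 delta, 0 < delta & forall s t, 0 <= s <= 1 -> 0 <= t <= 1 ->
    `|s - t| < delta -> (c t <= (c s).+1)%N.
Proof.
move=> [_ _ cc cj]; apply: unit_lebesgue_number => x /andP[x0 x1].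
have q0 : 0 < 4^-1 :> R by [].
have [delta [d0 hr hl]] := cadlag_local cc x0 q0.
exists delta => // s t /andP[s0 _] /andP[t0 _]; rewrite !ltr_distlC => xs xt.
suff : (c t)%:R < (c s).+2%:R :> R by rewrite ltr_nat ltnS.
rewrite -[(c s).+2]addn2 natrD.
have far u : 0 <= u -> x - delta < u < x + delta -> x <= u \/ (0 < x /\
    `|lim (((c v)%:R : R) @[v --> x^'-]) - (c u)%:R| < 4^-1).
  move=> u0 /andP[xu ux]; have [|ux'] := leP x u; [by left|right].
  by split; [exact: le_lt_trans u0 ux'|apply: hl => //; lra].
have [xs'|[x0' hs]] := far _ s0 xs; have [xt'|[x0'' ht]] := far _ t0 xt.
- have : `|(c x)%:R - (c s)%:R : R| < 4^-1 by apply: hr => //; lra.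
  have : `|(c x)%:R - (c t)%:R : R| < 4^-1 by apply: hr => //; lra.
  by rewrite !ltr_distl; lra.
- have : `|(c x)%:R - (c s)%:R : R| < 4^-1 by apply: hr => //; lra.
  move: ht; have := cj _ x0''; rewrite /jump; set l := lim _.
  by rewrite !ltr_distl => -[]; lra.
- have : `|(c x)%:R - (c t)%:R : R| < 4^-1 by apply: hr => //; lra.
  move: hs; have := cj _ x0'; rewrite /jump; set l := lim _.
  by rewrite !ltr_distl => -[]; lra.
- by move: hs ht; set l := lim _; rewrite !ltr_distl; lra.
Qed.

End Cadlag.

Section StepMeasurable.
Context {R : realType}.

Lemma measurable_truncn : measurable_fun setT (@Num.truncn R).
Proof.
have mle k : measurable [set u : R | (k <= Num.truncn u)%N].
  case: k => [|k]; first by rewrite (_ : [set _ | _] = setT)//; apply/seteqP.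
  rewrite (_ : [set _ | _] = `[k.+1%:R, +oo[%classic) //.
  by apply/seteqP; split => u /=; rewrite truncn_gt_nat in_itv /= andbT.
move=> _ Y _; rewrite setTI (_ : _ @^-1` _ = \bigcup_(k in Y)
  ([set u : R | (k <= Num.truncn u)%N] `\` [set u : R | (k.+1 <= Num.truncn u)%N])).
  by apply: bigcup_measurable => k _; exact: measurableD.
apply/seteqP; split => u /=.
  by move=> Yu; exists (Num.truncn u) => //; split; rewrite /= ?ltnn.
by move=> [k Yk [/= h1 /negP]]; rewrite -leqNgt => h2;
  have <- : k = Num.truncn u by apply/eqP; rewrite eqn_leq h1.
Qed.

Lemma measurable_fun_nat_index d (T : measurableType d) (g : T -> nat)
    (Y : nat -> T -> R) :
  measurable_fun setT g -> (forall k, measurable_fun setT (Y k)) ->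
  measurable_fun setT (fun z => Y (g z) z).
Proof.
move=> mg mY _ B mB; rewrite setTI (_ : _ @^-1` _ = \bigcup_k
  (g @^-1` [set k] `&` Y k @^-1` B)).
  apply: bigcup_measurable => k _; apply: measurableI.
    by rewrite -[X in measurable X]setTI; exact: mg.
  by rewrite -[X in measurable X]setTI; exact: mY.
apply/seteqP; split => z /=; first by move=> Bz; exists (g z).
by move=> [k _ [/= -> ]].
Qed.

(** The successor places the grid point strictly to the right of x, at distance at most 1 / (n + 1),
    so right-continuity suffices. *)
Lemma cvg_right_grid (f : R -> R) x : cadlag f -> 0 <= x ->
  f ((Num.truncn (n.+1%:R * x)).+1%:R / n.+1%:R) @[n --> \oo] --> f x.
Proof.
move=> [fr _] x0; have /cvg_at_rightP := fr _ x0; apply.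
have gt n : x < (Num.truncn (n.+1%:R * x)).+1%:R / n.+1%:R.
  by rewrite ltr_pdivlMr// mulrC truncnS_gt.
split => //; apply: (@squeeze_cvgr _ _ _ _ (fun=> x) (fun n => x + n.+1%:R^-1)).
- near=> n; rewrite (ltW (gt n)) /= ler_pdivrMr// mulrDl mulVf// mulrC -natr1 lerD2r.
  by rewrite truncn_le mulr_ge0.
- exact: cvg_cst.
- rewrite -[X in _ --> X]addr0; apply: cvgD; first exact: cvg_cst.
  exact: cvg_harmonic.
Unshelve. all: by end_near. Qed.

(* Extending X by X 0 to negative times gives a jointly measurable function;
   by right-continuity it is the limit of its steps at the right grid points. *)
Lemma measurable_cadlag_process d (T : measurableType d) (X : R -> T -> R) :
  (forall t, 0 <= t -> measurable_fun setT (X t)) ->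
  (forall w, cadlag (X ^~ w)) ->
  measurable_fun setT (fun z : R * T => X (Num.max z.1 0) z.2).
Proof.
move=> mX cX.
apply: (measurable_fun_cvg (h := fun n (z : R * T) =>
  X ((Num.truncn (n.+1%:R * Num.max z.1 0)).+1%:R / n.+1%:R) z.2)).
  move=> n; apply: (measurable_fun_nat_index
    (g := fun z : R * T => Num.truncn (n.+1%:R * Num.max z.1 0))
    (Y := fun k (z : R * T) => X (k.+1%:R / n.+1%:R) z.2)).
    apply: (measurableT_comp measurable_truncn); apply: measurable_funM => //.
    by apply: measurable_maxr.
  move=> k; apply: (measurableT_comp (mX _ _) measurable_snd).
  by rewrite divr_ge0.
move=> z _; apply: (cvg_right_grid (cX z.2)).
by rewrite le_max lexx orbT.
Qed.

End StepMeasurable.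

(** * Integrals of cadlag paths along grids *)

Section IntegralPartition.
Context {R : realType}.
Local Notation mu := (@lebesgue_measure R).

Lemma integral_partition (t : nat -> R) (phi : R -> \bar R) M :
  (forall k, (k < M)%N -> t k <= t k.+1) ->
  measurable_fun setT phi -> (forall u, (0 <= phi u)%E) ->
  (\sum_(0 <= k < M) \int[mu]_(u in `]t k, t k.+1]) phi u =
   \int[mu]_(u in `]t 0%N, t M]) phi u)%E.
Proof.
move=> tS mphi phi0.
suff : t 0%N <= t M /\ (\sum_(0 <= k < M) \int[mu]_(u in `]t k, t k.+1]) phi u =
   \int[mu]_(u in `]t 0%N, t M]) phi u)%E by case.
elim: M tS => [|M IH] tS.
  by rewrite big_geq// set_itv_ge ?integral_set0// bnd_simp ltxx.
have [t0M IHE] := IH (fun k kM => tS k (leqW kM)).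
have tM := tS M (ltnSn M); split; first exact: (le_trans t0M tM).
rewrite big_nat_recr//= IHE -ge0_integral_setU//=.
- congr (integral _ _ _); rewrite -itv_bndbnd_setU ?bnd_simp//.
- exact: measurable_funTS.
- rewrite disj_set2E; apply/eqP/seteqP; split => // u [] /=; rewrite !in_itv /=.
  by move=> /andP[_ u1] /andP[u2 _]; have := le_lt_trans u1 u2; rewrite ltxx.
Qed.

Lemma integral_grid_step (h : nat -> R) n : (forall k, 0 <= h k) ->
  (\int[mu]_(u in `[0%R, 1%R]) (h (Num.truncn (n.+1%:R * u)))%:E =
   (n.+1%:R^-1 * \sum_(0 <= k < n.+1) h k)%:E)%E.
Proof.
move=> h0; pose t k : R := k%:R / n.+1%:R.
have mh : measurable_fun setT (fun u : R => (h (Num.truncn (n.+1%:R * u)))%:E).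
  apply/measurable_EFinP; apply: (measurable_fun_nat_index (Y := fun k _ => h k)) => //.
  by apply: (measurableT_comp measurable_truncn); exact: measurable_funM.
have tS k : t k <= t k.+1 by rewrite ler_pM2r ?invr_gt0// ler_nat.
have t0 : t 0%N = 0 by rewrite /t mul0r.
have t1 : t n.+1 = 1 by rewrite /t mulfV.
rewrite -integral_itv_obnd_cbnd; last exact: measurable_funTS.
rewrite -[X in `]X, _]]t0 -[X in `]_, X]]t1 -integral_partition//; last first.
  by move=> u; rewrite lee_fin.
rewrite mulr_sumr -sumEFin; apply: eq_bigr => k _.
rewrite integral_itv_bndoo; last exact: measurable_funTS.
rewrite (eq_integral (fun=> (h k)%:E)); last first.
  move=> u; rewrite in_setE /= in_itv /= => /andP[tu ut]; congr (h _)%:E.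
  apply: truncn_def; move: tu ut; rewrite /t ltr_pdivrMr// ltr_pdivlMr//.
  by rewrite mulrC => /ltW -> ->.
rewrite integral_cst//= lebesgue_measure_itv /= lte_fin ltr_pM2r ?invr_gt0// ltr_nat ltnSn.
by rewrite -EFinB -EFinM -mulrBl -natr1 addrAC subrr add0r mul1r mulrC.
Qed.

End IntegralPartition.

Section CadlagIntegral.
Context {R : realType}.
Local Notation mu := (@lebesgue_measure R).
Implicit Types (f : R -> R).

(** The exceptional points are the centers of a finite cover. Any other u lies strictly on one side
    of a center x, and so do its neighbours; there f stays within eps / 2 of f x or of the left
    limit at x. *)
Lemma cadlag_finite_osc f eps : cadlag f -> 0 < eps ->
  exists s : seq R, forall u, 0 <= u <= 1 -> u \notin s ->
    exists2 delta, 0 < delta & forall v, 0 <= v <= 1 -> `|u - v| < delta ->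
      `|f u - f v| < eps.
Proof.
move=> cf e0; have e20 : 0 < eps / 2 by rewrite divr_gt0.
have /choice[delta hd] : forall x, exists delta, 0 <= x <= 1 -> [/\ 0 < delta,
    forall u, x <= u -> u < x + delta -> `|f x - f u| < eps / 2 &
    forall u, 0 <= u -> u < x -> x < u + delta ->
      `|lim (f s @[s --> x^'-]) - f u| < eps / 2].
  move=> x; have [x01|nx] := boolP (0 <= x <= 1); last by exists 1.
  by have [e he] := cadlag_local cf (proj1 (andP x01)) e20; exists e.
have [|s [s01 cov]] := @unit_cover R delta; first by move=> x /hd[].
exists s => u u01 us; have [x xs xu] := cov _ u01.
have [d0 hr hl] := hd _ (s01 _ xs).
have xneu : x != u by apply: contraNneq us => <-.
exists (Num.min (delta x - `|x - u|) `|x - u|).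
  by rewrite lt_min subr_gt0 xu normr_gt0 subr_eq0.
move=> v /andP[v0 v1]; rewrite lt_min => /andP[uv1 uv2]; move: xneu u01 => xneu /andP[u0 u1].
have [ux|xu'|e] := ltgtP u x; last by rewrite e eqxx in xneu.
  rewrite (gtr0_norm (_ : 0 < x - u)) ?subr_gt0// in xu uv1 uv2.
  have : `|lim (f s @[s --> x^'-]) - f u| < eps / 2 by apply: hl => //; lra.
  have : `|lim (f s @[s --> x^'-]) - f v| < eps / 2.
    by apply: hl => //; move: uv1 uv2; rewrite !ltr_distl; lra.
  by set l := lim _; rewrite !ltr_distl; lra.
rewrite (ltr0_norm (_ : x - u < 0)) ?subr_lt0// in xu uv1 uv2.
have : `|f x - f u| < eps / 2 by apply: hr; lra.
have : `|f x - f v| < eps / 2 by apply: hr; move: uv1 uv2; rewrite !ltr_distl; lra.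
by rewrite !ltr_distl; lra.
Qed.

Lemma grid_floor_dist (u : R) n : 0 <= u ->
  0 <= u - (Num.truncn (n.+1%:R * u))%:R / n.+1%:R < n.+1%:R^-1.
Proof.
move=> u0; have nu : 0 <= n.+1%:R * u by rewrite mulr_ge0.
have /andP[h1 h2] := truncn_itv nu.
have -> : u - (Num.truncn (n.+1%:R * u))%:R / n.+1%:R =
    (n.+1%:R * u - (Num.truncn (n.+1%:R * u))%:R) / n.+1%:R.
  by rewrite mulrBl mulrAC mulfV// mul1r.
rewrite divr_ge0 ?subr_ge0//= -[ltRHS]mul1r ltr_pM2r ?invr_gt0//.
by rewrite ltrBlDl natr1.
Qed.

(** Grid points approach u from the left, so convergence may fail where f jumps. The finite
    exceptional sets for the tolerances 1 / (k + 1) have a countable, hence null, union. *)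
Lemma cadlag_ae_grid f : cadlag f ->
  {ae mu, forall u, `[0, 1]%classic u ->
    f ((Num.truncn (n.+1%:R * u))%:R / n.+1%:R) @[n --> \oo] --> f u}.
Proof.
move=> cf.
have /choice[s hs] : forall k : nat, exists s : seq R, forall u, 0 <= u <= 1 -> u \notin s ->
    exists2 delta, 0 < delta & forall v, 0 <= v <= 1 -> `|u - v| < delta ->
      `|f u - f v| < k.+1%:R^-1.
  by move=> k; apply: cadlag_finite_osc.
have mN : countable (\bigcup_k [set` s k]).
  by apply: bigcup_countable => // k _; exact: finite_set_countable.
exists (\bigcup_k [set` s k]); split.
- by apply: countable_measurable => // t; exact: measurable_set1.
- exact: countable_lebesgue_measure0.
move=> u /= nu; apply: contrapT => us; apply: nu => u01.
have u01' : 0 <= u <= 1 by move: u01; rewrite /= in_itv.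
have /andP[u0 u1] := u01'.
apply/cvgrPdist_lt => eps e0.
have [k _ /(_ k (leqnn k)) ke] := near_infty_natSinv_lt (PosNum e0).
have [|delta d0 hd] := hs k u u01'.
  by apply/negP => usk; apply: us; exists k.
have [N _ hN] := near_infty_natSinv_lt (PosNum d0).
exists N => // n Nn /=; apply: lt_trans ke.
have /andP[h1 h2] := grid_floor_dist n u0.
apply: hd; last by rewrite ger0_norm// (lt_trans h2)//; exact: hN.
by apply/andP; split; [rewrite divr_ge0|apply: le_trans u1; rewrite -subr_ge0].
Qed.

Lemma measurable_cadlag f : cadlag f -> measurable_fun setT (fun u : R => f (Num.max u 0)).
Proof.
move=> cf.
have := @measurable_cadlag_process R _ unit (fun t _ => f t) (fun _ _ => measurable_cst _)
  (fun _ => cf).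
move=> h; exact: (measurableT_comp h (measurable_pair2 tt)).
Qed.

Lemma measurable_grid_step f n :
  measurable_fun setT (fun u : R => f ((Num.truncn (n.+1%:R * u))%:R / n.+1%:R)).
Proof.
apply: (measurable_fun_nat_index (Y := fun k _ => f (k%:R / n.+1%:R))) => //.
by apply: (measurableT_comp measurable_truncn); exact: measurable_funM.
Qed.

Lemma integrable_unit_cst (c : R) : mu.-integrable `[0, 1] (cst c%:E).
Proof.
apply/integrableP; split; first exact: measurable_cst.
have -> : (fun x : R => `|cst c%:E x|%E) = cst (`|c|%:E) by apply/funext.
by rewrite integral_cst//= lebesgue_measure_itv /= lte_fin ltr01 -EFinB -EFinM ltry.
Qed.

Lemma cadlag_grid_L2 f : cadlag f ->
  (\int[mu]_(u in `[0%R, 1%R])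
    ((f (Num.max u 0) - f ((Num.truncn (n.+1%:R * u))%:R / n.+1%:R)) ^+ 2)%:E)%E
    @[n --> \oo] --> 0%E.
Proof.
move=> cf; have [M M0 fM] := cadlag_bounded cf.
pose g n (u : R) := ((f (Num.max u 0) - f ((Num.truncn (n.+1%:R * u))%:R / n.+1%:R)) ^+ 2)%:E.
have := @dominated_convergence _ _ _ mu `[0, 1]%classic _ g (cst 0%E)
  (cst ((2 * M) ^+ 2)%:E).
case.
- by [].
- move=> n; apply: measurable_funTS; apply/measurable_EFinP; apply: measurable_funX.
  by apply: measurable_funB; [exact: measurable_cadlag|exact: measurable_grid_step].
- exact: measurable_cst.
- have [E [mE E0 hE]] := cadlag_ae_grid cf; exists E; split => // u nu; apply: hE => /= h.
  apply: nu => u01; have {}h := h u01.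
  have u0 : 0 <= u by move: u01; rewrite /= in_itv => /andP[].
  rewrite /g; apply: cvg_EFin; first by apply: nearW.
  rewrite /= max_l// -[X in _ --> X](_ : (f u - f u) ^+ 2 = 0); last by rewrite subrr expr0n.
  under eq_fun do rewrite expr2.
  rewrite expr2; apply: cvgM; apply: cvgB; by [exact: cvg_cst|exact: h].
- exact: integrable_unit_cst.
- apply: nearW => u n /=; rewrite in_itv /= => /andP[u0 u1].
  rewrite lee_fin ger0_norm ?sqr_ge0// max_l// -real_normK ?num_real//.
  have h1 : `|f u| <= M by apply: fM; rewrite u0.
  have /andP[h2 h3] := grid_floor_dist n u0.
  have h4 : `|f ((Num.truncn (n.+1%:R * u))%:R / n.+1%:R)| <= M.
    by apply: fM; rewrite divr_ge0//=; apply: le_trans u1; rewrite -subr_ge0.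
  apply: lerXn2r; rewrite ?nnegrE ?mulr_ge0//.
  by apply: le_trans (ler_normB _ _) _; lra.
by move=> _ _; rewrite integral0.
Qed.

(** The Riemann sums are integrals of the step functions on the grid, which are bounded and converge
    almost everywhere. *)
Lemma cadlag_riemann f : cadlag f ->
  n.+1%:R^-1 * \sum_(0 <= k < n.+1) f (k%:R / n.+1%:R) ^+ 2 @[n --> \oo] -->
  (\int[mu]_(u in `[0, 1]) f u ^+ 2)%R.
Proof.
move=> cf; have [M M0 fM] := cadlag_bounded cf.
pose g n (u : R) := (f ((Num.truncn (n.+1%:R * u))%:R / n.+1%:R) ^+ 2)%:E.
have := @dominated_convergence _ _ _ mu `[0, 1]%classic _ g
  (fun u : R => (f (Num.max u 0) ^+ 2)%:E) (cst (M ^+ 2)%:E).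
case.
- by [].
- move=> n; apply: measurable_funTS; apply/measurable_EFinP; apply: measurable_funX.
  exact: measurable_grid_step.
- apply: measurable_funTS; apply/measurable_EFinP; apply: measurable_funX.
  exact: measurable_cadlag.
- have [E [mE E0 hE]] := cadlag_ae_grid cf; exists E; split => // u nu; apply: hE => /= h.
  apply: nu => u01; have {}h := h u01.
  have u0 : 0 <= u by move: u01; rewrite /= in_itv => /andP[].
  rewrite /g max_l//; apply: cvg_EFin; first by apply: nearW.
  under eq_fun do rewrite /= expr2.
  by rewrite expr2; apply: cvgM; exact: h.
- exact: integrable_unit_cst.
- apply: nearW => u n /=; rewrite in_itv /= => /andP[u0 u1].
  rewrite lee_fin ger0_norm ?sqr_ge0// -real_normK ?num_real//.
  have /andP[h2 h3] := grid_floor_dist n u0.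
  apply: lerXn2r; rewrite ?nnegrE//.
  by apply: fM; rewrite divr_ge0//=; apply: le_trans u1; rewrite -subr_ge0.
move=> intf _.
rewrite (_ : (fun n => _) = (fun n => (n.+1%:R^-1 *
    \sum_(0 <= k < n.+1) f (k%:R / n.+1%:R) ^+ 2)%:E)); last first.
  apply/funext => n.
  exact: (integral_grid_step (h := fun k => f (k%:R / n.+1%:R) ^+ 2) n
    (fun k => sqr_ge0 _)).
rewrite -[X in _ --> X]fineK; last exact: integrable_fin_num.
have -> : (\int[mu]_(u in `[0%R, 1%R]) (f (Num.max u 0) ^+ 2)%:E =
    \int[mu]_(u in `[0%R, 1%R]) (f u ^+ 2)%:E)%E.
  by apply: eq_integral => u; rewrite in_setE /= in_itv /= => /andP[u0 _]; rewrite max_l.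
exact: fine_cvg.
Qed.

End CadlagIntegral.

(** * Approximation of the Ito integral on a grid *)

Section Refine.
Context {R : realType}.

(** t enumerates in increasing order the x l and the points of tau lying between x 0 and x L, and b
    l is the position of x l. Past the last point t stays at x L, whence strict growth only below b
    L. Points of tau outside the interval satisfy the last clause trivially. *)
Lemma partition_refine (x : nat -> R) L (tau : seq R) :
  (forall l, (l < L)%N -> x l < x l.+1) ->
  exists (t : nat -> R) (b : nat -> nat),
    [/\ (forall k, t k <= t k.+1),
        (forall k, (k < b L)%N -> t k < t k.+1),
        (forall l, (l <= L)%N -> t (b l) = x l),
        b 0%N = 0%N /\ (forall l, (b l <= b l.+1)%N) &
        forall k y, (k < b L)%N -> y \in tau -> y <= t k \/ t k.+1 <= y].
Proof.
move=> xS.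
have xmono l l' : (l <= l')%N -> (l' <= L)%N -> x l <= x l'.
  move=> /subnKC <-; elim: (l' - l)%N => [|e IH]; first by rewrite addn0.
  by rewrite addnS => h; apply: le_trans (IH (ltnW h)) (ltW (xS _ h)).
have xsmono l l' : (l < l')%N -> (l' <= L)%N -> x l < x l'.
  by move=> ll' l'L; apply: lt_le_trans (xS l (leq_trans ll' l'L)) (xmono _ _ ll' l'L).
pose s0 := [seq x l | l <- iota 0 L.+1] ++ [seq y <- tau | x 0%N <= y <= x L].
pose s := sort <=%O (undup s0).
have s_sorted : sorted <%O s by rewrite sort_lt_sorted undup_uniq.
have s_le : sorted <=%O s by move: s_sorted; rewrite lt_sorted_uniq_le => /andP[].
have mems y : (y \in s) = (y \in s0) by rewrite mem_sort mem_undup.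
have xs l : (l <= L)%N -> x l \in s.
  by move=> lL; rewrite mems mem_cat map_f// mem_iota add0n ltnS.
have sxx y : y \in s -> x 0%N <= y <= x L.
  rewrite mems mem_cat => /orP[/mapP[l]|]; last by rewrite mem_filter => /andP[].
  by rewrite mem_iota add0n ltnS => /= lL ->; rewrite !xmono.
pose t k := nth (x L) s k.
pose b l := index (x (minn l L)) s.
have tb l : (l <= L)%N -> t (b l) = x l.
  by move=> lL; rewrite /t /b (minn_idPl lL) nth_index// xs.
have bs l : (b l < size s)%N by rewrite /b index_mem xs// geq_minr.
have tlt k k' : (k < k')%N -> (k' < size s)%N -> t k < t k'.
  by move=> kk' k's; rewrite /t lt_sorted_ltn_nth// inE (ltn_trans kk').
have tle k k' : (k <= k')%N -> (k' < size s)%N -> t k <= t k'.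
  by move=> kk' k's; rewrite /t le_sorted_leq_nth// inE (leq_ltn_trans kk').
have bL k : (k < size s)%N -> (k <= b L)%N.
  move=> ks; rewrite leqNgt; apply/negP => /tlt/(_ ks); rewrite tb//.
  by rewrite ltNge; have /andP[_ ->] := sxx _ (mem_nth (x L) ks).
have bLs k : (k < b L)%N -> (k.+1 < size s)%N by move=> kb; exact: leq_ltn_trans kb (bs L).
exists t, b; split.
- move=> k; have [ks|sk] := ltnP k.+1 (size s); first exact: tle.
  rewrite {2}/t nth_default//; have [ks|sk'] := ltnP k (size s).
    by have /andP[] := sxx _ (mem_nth (x L) ks).
  by rewrite /t nth_default.
- by move=> k kb; apply: tlt => //; exact: bLs.
- exact: tb.
- split=> [|l].
    apply/eqP; rewrite -leqn0 leqNgt; apply/negP => /tlt/(_ (bs _)); rewrite tb//.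
    rewrite ltNge; have s_pos : (0 < size s)%N by exact: leq_ltn_trans (bs 0%N).
    by have /andP[->] := sxx _ (mem_nth (x L) s_pos).
  have [lL|Ll] := ltnP l L; last by rewrite /b !(minn_idPr _) ?(leq_trans Ll).
  rewrite leqNgt; apply/negP => /tlt/(_ (bs _)); rewrite !tb ?(ltnW lL)//.
  by rewrite ltNge ltW// xS.
- move=> k y kb ytau; have ks := bLs _ kb; have ks' := ltnW ks.
  have [/andP[y0 yL]|] := boolP (x 0%N <= y <= x L).
    have ys : y \in s by rewrite mems mem_cat mem_filter ytau y0 yL orbT.
    have yE : y = t (index y s) by rewrite /t nth_index.
    have iy : (index y s < size s)%N by rewrite index_mem.
    have [ik|ki] := leqP (index y s) k; [left|right]; rewrite yE; exact: tle.
  rewrite negb_and -!ltNge => /orP[y0|yL]; [left|right].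
    by apply: ltW; apply: lt_le_trans y0 _; have /andP[] := sxx _ (mem_nth (x L) ks').
  by apply: ltW; apply: le_lt_trans yL; have /andP[] := sxx _ (mem_nth (x L) ks).
Qed.

End Refine.

(** * Simple processes between two consecutive points of a refined partition *)

Section SimpleProcess.
Context d (T : measurableType d) (R : realType) (P : probability T R).
Variables (F : R -> set (set T)) (W : R -> T -> R) (H : simple_process (T := T) (R := R)).
Hypotheses (hF : filtration F) (wfH : simple_process_wf F H).

Definition sp_times : seq R := [seq sp_time H j | j <- iota 0 (sp_size H).+1].

Lemma mem_sp_times k : (k <= sp_size H)%N -> sp_time H k \in sp_times.
Proof. by move=> kn; rewrite map_f// mem_iota add0n ltnS. Qed.

Lemma sp_time_ge0 k : (k <= sp_size H)%N -> 0 <= sp_time H k.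
Proof.
have [h0 hS _] := wfH; elim: k => // k IH kn.
by apply: le_trans (IH (ltnW kn)) (ltW (hS _ kn)).
Qed.

Section Gap.
Variables t t' : R.
Hypotheses (tt' : t < t')
  (gap : forall y, y \in sp_times -> y <= t \/ t' <= y).

Lemma sp_eval_gap u w : t < u -> u <= t' -> sp_eval H u w = sp_eval H t' w.
Proof.
move=> tu ut'; apply: eq_bigr => k _; congr (_ * _).
have := gap (mem_sp_times (ltnW (ltn_ord k))); have := gap (mem_sp_times (ltn_ord k)).
rewrite !indicE !mem_setE !in_itv /=.
by move=> [h1|h1] [h2|h2]; congr ((_ : bool)%:R); apply/idP/idP => /andP[? ?]; lra.
Qed.

(** Each interval of H either contains ]t, t'] or misses it, so the increment reduces to one
    product. *)
Lemma sp_integral_gap w : sp_integral H W t' w - sp_integral H W t w =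
  sp_eval H t' w * (W t' w - W t w).
Proof.
rewrite /sp_integral /sp_eval -sumrB mulr_suml; apply: eq_bigr => k _.
have [_ hS _] := wfH; have tauS := hS _ (ltn_ord k).
have aux y : y <= t \/ t' <= y ->
    W (Num.min t' y) w - W (Num.min t y) w = (t' <= y)%R%:R * (W t' w - W t w).
  move=> [yt|ty].
    rewrite !min_r ?(le_trans yt (ltW tt'))// subrr leNgt (le_lt_trans yt tt').
    by rewrite mul0r.
  by rewrite ty !min_l ?(le_trans (ltW tt') ty)// mul1r.
have a1 := aux _ (gap (mem_sp_times (ltnW (ltn_ord k)))).
have a2 := aux _ (gap (mem_sp_times (ltn_ord k))).
rewrite -mulrBr -mulrA; congr (_ * _); rewrite indicE mem_setE in_itv /=.
rewrite (_ : (_ - _) = (W (Num.min t' (sp_time H k.+1)) w - W (Num.min t (sp_time H k.+1)) w)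
  - (W (Num.min t' (sp_time H k)) w - W (Num.min t (sp_time H k)) w)); last by ring.
rewrite a1 a2 -mulrBl; congr (_ * _).
have [t'k|kt'] := leP t' (sp_time H k).
  by rewrite (le_trans t'k (ltW tauS)) subrr.
by rewrite subr0.
Qed.

(** An interval of H that contains t' must start at or before t, so its coefficient is known at
    t. *)
Lemma measurable_wrt_sp_eval : 0 <= t -> measurable_wrt (F t) (sp_eval H t').
Proof.
move=> t0; have [sF Fm FS] := hF; have [_ hS hc] := wfH.
apply/measurable_wrtP; first exact: sF.
apply: measurable_sum => k; rewrite indicE mem_setE in_itv /=.
have [kt'|_] := ltP (sp_time H k) t'; last first.
  by under eq_fun do rewrite mulr0; exact: measurable_cst.
apply: measurable_funM => //; apply/measurable_wrtP; first exact: sF.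
have k0 := sp_time_ge0 (ltnW (ltn_ord k)).
have [|t'k] := gap (mem_sp_times (ltnW (ltn_ord k))); last first.
  by move: kt'; rewrite ltNge t'k.
move=> kt; apply: measurable_wrtS (proj1 (hc _ (ltn_ord k))).
exact: FS.
Qed.

End Gap.
End SimpleProcess.

Section ItoStep.
Context d (T : measurableType d) (R : realType) (P : probability T R).
Local Notation mu := (@lebesgue_measure R).
Variables (F : R -> set (set T)) (W sigma : R -> T -> R).
Hypotheses (hF : filtration F) (hW : brownian_motion P F W).
Hypotheses (hs : adapted F sigma) (cs : forall w, cadlag (sigma ^~ w)).

(* Grids are indexed by n.+1: at n = 0 the step 1 / n would be the junk value 0. *)
Definition grid_floor n (u : R) : R := (Num.truncn (n.+1%:R * u))%:R / n.+1%:R.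

Lemma grid_floor_ge0 n u : 0 <= grid_floor n u.
Proof. by rewrite divr_ge0. Qed.

Section Fixed.
Variables (H : simple_process (T := T) (R := R)) (n m : nat).
Hypotheses (wfH : simple_process_wf F H) (m0 : (0 < m)%N).

Lemma measurable_sp_eval w : measurable_fun setT (fun u => sp_eval H u w).
Proof.
apply: measurable_sum => k; apply: measurable_funM => //.
Qed.

Let sq_err (w : T) : \bar R := (\int[mu]_(u in `[0%R, 1%R])
  ((sp_eval H u w - sigma u w) ^+ 2)%:E)%E.
Let sq_grid (w : T) : \bar R := (\int[mu]_(u in `[0%R, 1%R])
  ((sigma (Num.max u 0) w - sigma (grid_floor n u) w) ^+ 2)%:E)%E.

(** The factor 8 is the variance constant of [incr_sqr_le]; 16 is 8 times the 2 of (a - c)^2 <= 2 (a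
    - b)^2 + 2 (b - c)^2, with sigma u as the middle term. [grid_floor] may jump at the right end of
    a piece, hence the strict inequality there; endpoints are null. *)
Lemma sum_gap_le (t : nat -> R) M w :
  (forall k, (k < M)%N -> t k < t k.+1) -> t 0%N = 0 -> t M = 1 ->
  (forall k u, (k < M)%N -> t k < u -> u <= t k.+1 ->
     sp_eval H u w = sp_eval H (t k.+1) w) ->
  (forall k u, (k < M)%N -> t k < u -> u < t k.+1 ->
     grid_floor n u = grid_floor n (t k)) ->
  ((\sum_(0 <= k < M)
     (sp_eval H (t k.+1) w - sigma (grid_floor n (t k)) w) ^+ 2 *
     (8 * (t k.+1 - t k)))%:E <= 16%:E * (sq_err w + sq_grid w))%E.
Proof.
move=> tS t0 t1 Hgap ggap.
pose phi u : \bar R := ((sp_eval H u w - sigma (grid_floor n u) w) ^+ 2)%:E.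
have mphi : measurable_fun setT phi.
  apply/measurable_EFinP; apply: measurable_funX; apply: measurable_funB.
    exact: measurable_sp_eval.
  exact: (measurable_grid_step (sigma ^~ w) n).
have phi0 u : (0 <= phi u)%E by rewrite lee_fin sqr_ge0.
apply: (@le_trans _ _ (8%:E * \int[mu]_(u in `[0%R, 1%R]) phi u)%E).
  rewrite -integral_itv_obnd_cbnd; last exact: measurable_funTS.
  rewrite -[X in `]X, _]]t0 -[X in `]_, X]]t1 -integral_partition//; last first.
    by move=> k /tS/ltW.
  rewrite -sumEFin ge0_sume_distrr; last by move=> k _; exact: integral_ge0.
  rewrite le_eqVlt; apply/orP; left; apply/eqP.
  rewrite big_nat [RHS]big_nat; apply: eq_bigr => k /andP[_ kM].
  rewrite integral_itv_bndoo; last exact: measurable_funTS.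
  rewrite (eq_integral (cst ((sp_eval H (t k.+1) w - sigma (grid_floor n (t k)) w) ^+ 2)%:E)).
    rewrite integral_cst//= lebesgue_measure_itv /= lte_fin tS//.
    by rewrite -EFinB -!EFinM; congr EFin; ring.
  move=> u; rewrite inE /= in_itv /= => /andP[tu ut].
  by rewrite /phi (Hgap k u) ?(ltW ut)// (ggap k u).
have merr : measurable_fun setT (fun u : R => ((sp_eval H u w - sigma (Num.max u 0) w) ^+ 2)%:E).
  apply/measurable_EFinP; apply: measurable_funX; apply: measurable_funB.
    exact: measurable_sp_eval.
  exact: (measurable_cadlag (cs w)).
have mgrid : measurable_fun setT
    (fun u : R => ((sigma (Num.max u 0) w - sigma (grid_floor n u) w) ^+ 2)%:E).
  apply/measurable_EFinP; apply: measurable_funX; apply: measurable_funB.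
    exact: (measurable_cadlag (cs w)).
  exact: (measurable_grid_step (sigma ^~ w) n).
have -> : sq_err w = (\int[mu]_(u in `[0%R, 1%R])
    ((sp_eval H u w - sigma (Num.max u 0) w) ^+ 2)%:E)%E.
  apply: eq_integral => u; rewrite inE /= in_itv /= => /andP[u0 _].
  by rewrite max_l.
rewrite -ge0_integralD//=; last 4 first.
- by move=> u _; rewrite lee_fin sqr_ge0.
- exact: measurable_funTS.
- by move=> u _; rewrite lee_fin sqr_ge0.
- exact: measurable_funTS.
have -> : 16%:E = (8%:E * 2%:E)%E :> \bar R by rewrite -EFinM; congr EFin; ring.
rewrite -muleA; apply: lee_wpmul2l => //.
rewrite -ge0_integralZl_EFin//=; last 2 first.
- by move=> u _; rewrite adde_ge0// lee_fin sqr_ge0.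
- by apply: measurable_funTS; exact: emeasurable_funD.
apply: ge0_le_integral => //=.
- exact: measurable_funTS.
- by apply: measurable_funTS; apply: measurable_funeM; exact: emeasurable_funD.
move=> u _; rewrite -EFinD -EFinM lee_fin.
set a := sp_eval H u w; set b := sigma (Num.max u 0) w; set c := sigma _ w.
have := sqr_ge0 (a - b - (b - c)).
have -> : (a - c) ^+ 2 = (a - b) ^+ 2 + (b - c) ^+ 2 + 2 * (a - b) * (b - c) by ring.
have -> : (a - b - (b - c)) ^+ 2 = (a - b) ^+ 2 + (b - c) ^+ 2 - 2 * (a - b) * (b - c) by ring.
by lra.
Qed.

Lemma truncn_fine_grid l (u : R) : l%:R / (n.+1 * m)%:R <= u ->
  u < l.+1%:R / (n.+1 * m)%:R -> Num.truncn (n.+1%:R * u) = (l %/ m)%N.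
Proof.
have m0' : 0 < m%:R :> R by rewrite ltr0n.
rewrite natrM => lu ul; apply: truncn_def.
have -> : n.+1%:R * u = (n.+1%:R * m%:R * u) / m%:R by field; rewrite gt_eqF.
have nm0 : 0 < n.+1%:R * m%:R :> R by rewrite mulr_gt0.
rewrite ler_pdivlMr// ltr_pdivrMr//; apply/andP; split.
  apply: (@le_trans _ _ l%:R); last by rewrite mulrC -ler_pdivrMr.
  by rewrite -natrM ler_nat leq_trunc_div.
apply: (@lt_le_trans _ _ l.+1%:R); first by rewrite mulrC -ltr_pdivlMr.
by rewrite -natrM ler_nat ltn_ceil.
Qed.

(** On each piece of the refinement both H and the step version of sigma are constant and known at
    its left end, so their difference is an admissible weight in [lenglart]. The blocks are the
    intervals of the grid of step 1 / ((n + 1) m). *)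
Lemma sp_increments_outer eps eta q : 0 < eps -> 0 < eta ->
  outer_le P [set w | (eta%:E < 16%:E * (sq_err w + sq_grid w))%E] q ->
  let x l : R := l%:R / (n.+1 * m)%:R in
  outer_le P [set w | eps <= \sum_(l < n.+1 * m)
    (sp_integral H W (x l.+1) w - sp_integral H W (x l) w -
     sigma (grid_floor n (x l)) w * (W (x l.+1) w - W (x l) w)) ^+ 2]
   (eta / eps + q).
Proof.
move=> e0 eta0 Vq x; have [sF Fm FS] := hF.
have nm0 : (0 < n.+1 * m)%N by rewrite muln_gt0.
have nm0' : 0 < (n.+1 * m)%:R :> R by rewrite ltr0n.
have xS l : x l < x l.+1 by rewrite ltr_pM2r ?invr_gt0// ltr_nat.
pose L := (n.+1 * m)%N.
(* The coarse points i / (n + 1) already occur among the x l; listing them in tau makes the gap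
   clause of [partition_refine] apply to them. *)
pose tau := sp_times H ++ [seq i%:R / n.+1%:R : R | i <- iota 0 n.+2].
have [t [b [tS tS' tb [b0 bS] gap]]] :=
  @partition_refine R x L tau (fun l _ => xS l).
have tmono k k' : (k <= k')%N -> t k <= t k'.
  move=> /subnKC <-; elim: (k' - k)%N => [|e IH]; first by rewrite addn0.
  by rewrite addnS; apply: le_trans IH (tS _).
have bmono l l' : (l <= l')%N -> (b l <= b l')%N.
  move=> /subnKC <-; elim: (l' - l)%N => [|e IH]; first by rewrite addn0.
  by rewrite addnS; apply: leq_trans IH (bS _).
have t0 : t 0%N = 0 by rewrite -b0 tb// /x mul0r.
have t1 : t (b L) = 1 by rewrite tb// /x mulfV// gt_eqF.
have tge0 k : 0 <= t k by rewrite -t0 tmono.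
have gapH k y : (k < b L)%N -> y \in sp_times H -> y <= t k \/ t k.+1 <= y.
  by move=> kb yH; apply: gap => //; rewrite mem_cat yH.
have ggap k u : (k < b L)%N -> t k < u -> u < t k.+1 ->
    grid_floor n u = grid_floor n (t k).
  move=> kb tu ut; rewrite /grid_floor; congr (_%:R / _).
  have /andP[h1 h2] := truncn_itv (mulr_ge0 (ler0n R n.+1) (tge0 k)).
  set i := Num.truncn (n.+1%:R * t k) in h1 h2 *.
  have tk1 : t k < 1.
    by apply: lt_le_trans (tS' _ kb) _; rewrite -t1 tmono.
  have iN : (i < n.+1)%N.
    rewrite -(ltr_nat R); apply: le_lt_trans h1 _.
    by rewrite -[ltRHS]mulr1 ltr_pM2l.
  have yE : i.+1%:R / n.+1%:R \in tau.
    rewrite mem_cat; apply/orP; right; apply/mapP; exists i.+1 => //.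
    by rewrite mem_iota add0n !ltnS.
  have [yt|ty] := gap k _ kb yE.
    by move: h2; rewrite ltNge mulrC -ler_pdivrMr// yt.
  apply: truncn_def; apply/andP; split.
    by apply: le_trans h1 _; rewrite ler_pM2l// ltW.
  by rewrite mulrC -ltr_pdivlMr//; exact: lt_le_trans ut ty.
pose FF k := F (t k).
pose G k w := sp_eval H (t k.+1) w - sigma (grid_floor n (t k)) w.
pose Y k w := W (t k.+1) w - W (t k) w.
pose v k := 8 * (t k.+1 - t k).
have hY : mart_diff P FF (b L) Y v.
  split => [k|k|k|k kb]; [exact: sF|exact: Fm|exact: FS|].
  have tk := tS' _ kb; split.
  - exact: (measurable_wrt_incr hF hW (tge0 k) (ltW tk)).
  - exact: (incr_indep hW (tge0 k) tk).
  - exact: (incr_integral0 hF hW (tge0 k) tk).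
  - by rewrite mulr_gt0// subr_gt0.
  - exact: (incr_sqr_le hF hW (tge0 k) tk).
have mG k : (k < b L)%N -> measurable_wrt (FF k) (G k).
  move=> kb; apply/measurable_wrtP; first exact: sF.
  apply: measurable_funB; apply/measurable_wrtP; try exact: sF.
    exact: (measurable_wrt_sp_eval hF wfH (fun y => gapH k y kb) (tge0 k)).
  apply: measurable_wrtS (hs (grid_floor_ge0 n (t k))).
  apply: FS; first exact: grid_floor_ge0.
  by have /andP[h _] := grid_floor_dist n (tge0 k); rewrite -subr_ge0.
have Vle w : ((\sum_(0 <= k < b L) G k w ^+ 2 * v k)%:E <=
    16%:E * (sq_err w + sq_grid w))%E.
  apply: sum_gap_le => // k u kb tu ut.
  exact: (sp_eval_gap (fun y => gapH k y kb) w tu ut).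
have := lenglart hY mG bS (leqnn _) e0 eta0 (q := q).
move=> h; apply: outer_leS (h _); last first.
  apply: outer_leS Vq => w /= hw; apply: lt_le_trans (Vle w).
  by rewrite lte_fin.
move=> w /= hw; apply: le_trans hw _; rewrite le_eqVlt; apply/orP; left; apply/eqP.
apply: eq_bigr => l _; congr (_ ^+ 2).
have lL := ltn_ord l.
transitivity (\sum_(b l <= k < b l.+1)
  ((sp_integral H W (t k.+1) w - sp_integral H W (t k) w) -
   sigma (grid_floor n (x l)) w * (W (t k.+1) w - W (t k) w))).
  rewrite sumrB -mulr_sumr.
  rewrite (telescope_sumr (fun k => sp_integral H W (t k) w)) ?bS//.
  rewrite (telescope_sumr (fun k => W (t k) w)) ?bS//.
  by rewrite !tb// ltnW.
rewrite [LHS]big_nat [RHS]big_nat; apply: eq_bigr => k /andP[bk kb].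
have kL : (k < b L)%N by apply: leq_trans kb (bmono _ _ lL).
rewrite (sp_integral_gap W wfH (tS' _ kL) (fun y => gapH k y kL)).
rewrite -mulrBl.
congr ((_ - sigma _ w) * _); rewrite /grid_floor; congr (_%:R / _).
rewrite (truncn_fine_grid (lexx (x l)) (xS l)).
rewrite (@truncn_fine_grid l (t k)) //.
  by rewrite -/(x l) -tb ?tmono// ltnW.
by rewrite -/(x l.+1) -(tb l.+1)//; apply: lt_le_trans (tS' _ kL) (tmono _ _ kb).
Qed.

End Fixed.
End ItoStep.

Section OcvgSums.
Context d (T : measurableType d) (R : realType) (P : probability T R).

Lemma ocvg0_sqr (X : nat -> T -> R) : ocvg0 P X -> ocvg0 P (fun n w => X n w ^+ 2).
Proof.
move=> cX eps eta e0 et0; have m0 : 0 < Num.min eps 1 by rewrite lt_min e0 ltr01.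
have [N hN] := cX _ _ m0 et0; exists N => n Nn; apply: outer_leS (hN n Nn) => w /=.
rewrite normrX leNgt => h; rewrite leNgt; apply: contra h.
rewrite lt_min => /andP[h1 h2]; apply: le_lt_trans h1; rewrite expr2.
by rewrite -[leRHS]mulr1 ler_wpM2l// ltW.
Qed.

Lemma ocvg0_cst0 : ocvg0 P (fun _ _ => 0).
Proof.
move=> eps eta e0 et0; exists 0%N => n _; exists set0; last by rewrite measure0 lee_fin ltW.
by split => // w /=; rewrite normr0 leNgt e0.
Qed.

Lemma ocvg0_sum (a : nat -> nat -> T -> R) L :
  (forall l, (l < L)%N -> ocvg0 P (a l)) ->
  ocvg0 P (fun n w => \sum_(l < L) a l n w).
Proof.
elim: L => [|L IH] h.
  apply: ocvg0_le ocvg0_cst0 => n w; by rewrite big_ord0.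
apply: (@ocvg0_le _ _ _ _ _ (fun n w => \sum_(l < L) a l n w + a L n w)).
  by move=> n w; rewrite big_ord_recr.
apply: ocvg0D; last exact: h.
by apply: IH => l lL; apply: h; exact: ltnW.
Qed.

End OcvgSums.

Section ParamIntegral.
Context d (T : measurableType d) (R : realType).
Local Notation mu := (@lebesgue_measure R).

Lemma measurable_param_integral (phi : R * T -> R) :
  measurable_fun setT phi -> (forall z, 0 <= phi z) ->
  measurable_fun setT (fun w => \int[mu]_(u in `[0%R, 1%R]) (phi (u, w))%:E)%E.
Proof.
move=> mphi phi0.
pose f (z : measurableTypeR R * T) : \bar R := (phi z * \1_(`[0, 1] : set R) z.1)%:E.
have mf : measurable_fun setT f.
  apply/measurable_EFinP; apply: measurable_funM => //.
  by apply: measurableT_comp measurable_fst; exact: measurable_indic.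
have f0 z : (0 <= f z)%E by rewrite lee_fin mulr_ge0.
have := measurable_fun_fubini_tonelli_G (m1 := mu) f mf f0.
congr (measurable_fun _ _); apply/funext => w; rewrite /fubini_G.
rewrite [RHS]integral_mkcond; apply: eq_integral => u _.
rewrite patchE /f /= indicE; case: ifPn => _; by rewrite ?mulr1 ?mulr0.
Qed.

Lemma bounded_param_integral_lty (phi : R -> R) C :
  measurable_fun setT phi -> (forall u, 0 <= phi u) ->
  (forall u, 0 <= u <= 1 -> phi u <= C) ->
  (\int[mu]_(u in `[0%R, 1%R]) (phi u)%:E < +oo)%E.
Proof.
move=> mphi phi0 phiC.
apply: (@le_lt_trans _ _ (\int[mu]_(u in `[0%R, 1%R]) (cst C%:E u))%E); last first.
  by rewrite integral_cst//= lebesgue_measure_itv /= lte_fin ltr01 -EFinB -EFinM ltry.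
apply: ge0_le_integral => //=.
- by move=> u _; rewrite lee_fin.
- by apply: measurable_funTS; exact/measurable_EFinP.
Qed.

End ParamIntegral.

(** * Squared increments of the Ito integral against those of sigma dW *)

Section ItoRange.
Context d (T : measurableType d) (R : realType) (P : probability T R).
Local Notation mu := (@lebesgue_measure R).
Variables (F : R -> set (set T)) (W sigma I : R -> T -> R) (m : nat).
Hypotheses (hF : filtration F) (hW : brownian_motion P F W) (m0 : (0 < m)%N).
Hypotheses (hs : adapted F sigma) (cs : forall w, cadlag (sigma ^~ w)).

Let mW t : 0 <= t -> measurable_fun setT (W t).
Proof.
move=> t0; have [_ Fm _] := hF; have [aW _ _ _ _] := hW.
exact: (measurable_wrt_fun (Fm _ t0) (aW _ t0)).
Qed.

Let msigma t : 0 <= t -> measurable_fun setT (sigma t).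
Proof.
by move=> t0; have [_ Fm _] := hF; exact: (measurable_wrt_fun (Fm _ t0) (hs t0)).
Qed.

Lemma measurable_process_grid n :
  measurable_fun setT (fun z : R * T => sigma (grid_floor n z.1) z.2).
Proof.
apply: (measurable_fun_nat_index (g := fun z : R * T => Num.truncn (n.+1%:R * z.1))
    (Y := fun k (z : R * T) => sigma (k%:R / n.+1%:R) z.2)).
  by apply: (measurableT_comp measurable_truncn); exact: measurable_funM.
by move=> k; apply: (measurableT_comp (msigma _) measurable_snd); rewrite divr_ge0.
Qed.

Lemma measurable_process_pos :
  measurable_fun setT (fun z : R * T => sigma (Num.max z.1 0) z.2).
Proof. exact: measurable_cadlag_process. Qed.

Lemma measurable_sp_integral (H : simple_process) t :
  simple_process_wf F H -> 0 <= t -> measurable_fun setT (sp_integral H W t).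
Proof.
move=> wfH t0; have [_ Fm _] := hF; have [_ hS hc] := wfH.
apply: measurable_sum => k.
have k0 := sp_time_ge0 wfH (ltnW (ltn_ord k)).
have k0' := sp_time_ge0 wfH (ltn_ord k).
apply: measurable_funM.
  exact: (measurable_wrt_fun (Fm _ k0) (proj1 (hc _ (ltn_ord k)))).
by apply: measurable_funB; apply: mW; rewrite le_min t0.
Qed.

Lemma measurable_sp_eval2 (H : simple_process) : simple_process_wf F H ->
  measurable_fun setT (fun z : R * T => sp_eval H z.1 z.2).
Proof.
move=> wfH; have [_ Fm _] := hF; have [_ hS hc] := wfH.
apply: measurable_sum => k.
have k0 := sp_time_ge0 wfH (ltnW (ltn_ord k)).
apply: measurable_funM.
  apply: measurableT_comp measurable_snd.
  exact: (measurable_wrt_fun (Fm _ k0) (proj1 (hc _ (ltn_ord k)))).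
by apply: measurableT_comp measurable_fst; exact: measurable_indic.
Qed.

Let sq_grid n w : \bar R := (\int[mu]_(u in `[0%R, 1%R])
  ((sigma (Num.max u 0) w - sigma (grid_floor n u) w) ^+ 2)%:E)%E.

Lemma ocvg0_sq_grid : ocvg0 P (fun n w => fine (sq_grid n w)).
Proof.
apply: ae_ocvg0.
  move=> n; apply: (measurableT_comp (fine_measurable measurableT)) => //.
  apply: (measurable_param_integral (phi := fun z : R * T =>
    (sigma (Num.max z.1 0) z.2 - sigma (grid_floor n z.1) z.2) ^+ 2)).
    apply: measurable_funX; apply: measurable_funB.
      exact: measurable_process_pos.
    exact: measurable_process_grid.
  by move=> z; exact: sqr_ge0.
by apply: aeW => w; apply: fine_cvg; exact: (cadlag_grid_L2 (cs w)).
Qed.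

Lemma sq_grid_lty n w : (sq_grid n w < +oo)%E.
Proof.
have [M M0 fM] := cadlag_bounded (cs w).
apply: (@bounded_param_integral_lty _ (fun u =>
  (sigma (Num.max u 0) w - sigma (grid_floor n u) w) ^+ 2) ((2 * M) ^+ 2)).
- apply: measurable_funX; apply: measurable_funB.
    exact: (measurable_cadlag (cs w)).
  exact: (measurable_grid_step (sigma ^~ w) n).
- by move=> u; exact: sqr_ge0.
move=> u /andP[u0 u1]; rewrite max_l// -real_normK ?num_real//.
have h1 : `|sigma u w| <= M by apply: fM; rewrite u0.
have /andP[h2 h3] := grid_floor_dist n u0.
have h4 : `|sigma (grid_floor n u) w| <= M.
  by apply: fM; rewrite grid_floor_ge0 /=; apply: le_trans u1; rewrite -subr_ge0.
apply: lerXn2r; rewrite ?nnegrE ?mulr_ge0//.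
by apply: le_trans (ler_normB _ _) _; lra.
Qed.

Section SqErr.
Variable H : simple_process (T := T) (R := R).
Hypothesis wfH : simple_process_wf F H.
Let sq_err (w : T) : \bar R := (\int[mu]_(u in `[0%R, 1%R])
  ((sp_eval H u w - sigma u w) ^+ 2)%:E)%E.

Let sq_errE w : sq_err w = (\int[mu]_(u in `[0%R, 1%R])
  ((sp_eval H u w - sigma (Num.max u 0) w) ^+ 2)%:E)%E.
Proof.
apply: eq_integral => u; rewrite inE /= in_itv /= => /andP[u0 _].
by rewrite max_l.
Qed.

Lemma measurable_sq_err : measurable_fun setT (fun w => fine (sq_err w)).
Proof.
apply: (measurableT_comp (fine_measurable measurableT)) => //.
apply: (eq_measurable_fun (fun w => \int[mu]_(u in `[0%R, 1%R])
  ((sp_eval H u w - sigma (Num.max u 0) w) ^+ 2)%:E)%E) => [w _|].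
  by rewrite sq_errE.
apply: (measurable_param_integral (phi := fun z : R * T =>
    (sp_eval H z.1 z.2 - sigma (Num.max z.1 0) z.2) ^+ 2)).
  apply: measurable_funX; apply: measurable_funB.
    exact: measurable_sp_eval2.
  exact: measurable_process_pos.
by move=> z; exact: sqr_ge0.
Qed.

Lemma sq_err_lty w : (sq_err w < +oo)%E.
Proof.
have [M M0 fM] := cadlag_bounded (cs w).
pose C := \sum_(k < sp_size H) `|sp_coef H k w|.
have C0 : 0 <= C by exact: sumr_ge0.
rewrite sq_errE; apply: (@bounded_param_integral_lty _ (fun u =>
  (sp_eval H u w - sigma (Num.max u 0) w) ^+ 2) ((C + M) ^+ 2)).
- apply: measurable_funX; apply: measurable_funB.
    exact: measurable_sp_eval.
  exact: (measurable_cadlag (cs w)).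
- by move=> u; exact: sqr_ge0.
move=> u /andP[u0 u1]; rewrite max_l// -real_normK ?num_real//.
have h1 : `|sigma u w| <= M by apply: fM; rewrite u0.
have h2 : `|sp_eval H u w| <= C.
  apply: le_trans (ler_norm_sum _ _ _) _; apply: ler_sum => k _.
  rewrite normrM ler_piMr// indicE; case: (_ \in _); by rewrite ?normr1 ?normr0.
apply: lerXn2r; rewrite ?nnegrE ?addr_ge0//.
by apply: le_trans (ler_normB _ _) _; lra.
Qed.

End SqErr.

Hypothesis itoI : ito_integral P F W sigma I.

Let mI t : 0 <= t -> measurable_fun setT (I t).
Proof. by move=> t0; have [h _ _] := itoI; exact: h. Qed.

Lemma ocvg0_ito_increments :
  ocvg0 P (fun n w => \sum_(l < n.+1 * m)
    (I (l.+1%:R / (n.+1 * m)%:R) w - I (l%:R / (n.+1 * m)%:R) w -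
     sigma (grid_floor n (l%:R / (n.+1 * m)%:R)) w *
      (W (l.+1%:R / (n.+1 * m)%:R) w - W (l%:R / (n.+1 * m)%:R) w)) ^+ 2).
Proof.
have [_ _ [H [wfH cH]]] := itoI => eps h eps0 h0.
(* At threshold eps / 4 the Lenglart term is eta / (eps / 4) = h / 4. With both squared errors below
   de = eta / 64, 16 times their sum stays below eta. The probabilities spent add up to 3 h / 4. *)
pose eta := h * eps / 16; have eta0 : 0 < eta by rewrite divr_gt0// mulr_gt0.
pose de := eta / 64; have de0 : 0 < de by rewrite divr_gt0.
have h8 : 0 < h / 8 by rewrite divr_gt0.
have h4 : 0 < h / 4 by rewrite divr_gt0.
have e4 : 0 < eps / 4 by rewrite divr_gt0.
have [N hN] := ocvg0_sq_grid de0 h8.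
exists N => n Nn; have gridn := hN n Nn.
pose x l : R := l%:R / (n.+1 * m)%:R.
have x0 l : 0 <= x l by rewrite divr_ge0.
pose err j w := fine (\int[mu]_(u in `[0%R, 1%R]) ((sp_eval (H j) u w - sigma u w) ^+ 2)%:E)%E.
have cerr : ocvg0 P err.
  have [h1 _] := cH 1 ler01.
  have := cvgp_ocvg0 (fun j => measurable_sq_err (wfH j)) (measurable_cst _) h1.
  by apply: ocvg0_le => j w; rewrite subr0.
pose diff l j w := sp_integral (H j) W (x l) w - I (x l) w.
have cdiff l : ocvg0 P (diff l).
  have [_ h2] := cH _ (x0 l).
  exact: cvgp_ocvg0 (fun j => measurable_sp_integral (wfH j) (x0 l)) (mI (x0 l)) h2.
pose L := (n.+1 * m)%N.
have csum : ocvg0 P (fun j w => \sum_(l < L) (diff l.+1 j w - diff l j w) ^+ 2).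
  apply: (@ocvg0_sum _ _ _ P (fun l j w => (diff l.+1 j w - diff l j w) ^+ 2)) => l _.
  apply: ocvg0_sqr; apply: ocvg0_le (ocvg0D (cdiff l.+1) (ocvg0Z (-1) (cdiff l))).
  by move=> j w; rewrite mulN1r.
have [J1 hJ1] := cerr _ _ de0 h8; have [J2 hJ2] := csum _ _ e4 h4.
(* j depends on n: the sum [csum] has (n + 1) m terms, each of which vanishes only as j grows. *)
pose j := maxn J1 J2.
have errj := hJ1 j (leq_maxl _ _); have sumj := hJ2 j (leq_maxr _ _).
have V : outer_le P [set w | (eta%:E < 16%:E * (\int[mu]_(u in `[0%R, 1%R])
    ((sp_eval (H j) u w - sigma u w) ^+ 2)%:E + sq_grid n w))%E] (h / 8 + h / 8).
  apply: outer_leS (outer_leU errj gridn) => w /= hw.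
  have [?|e1] := leP de `|err j w|; first by left.
  right; rewrite leNgt; apply/negP => e2; move: hw; apply/negP; rewrite -leNgt.
  (* [fine] would send an infinite integral to 0; finiteness holds because both paths are bounded on
     [0, 1]. *)
  have ef : (\int[mu]_(u in `[0%R, 1%R]) ((sp_eval (H j) u w - sigma u w) ^+ 2)%:E
      = (err j w)%:E)%E.
    rewrite /err fineK// ge0_fin_numE ?sq_err_lty//.
    by apply: integral_ge0 => u _; rewrite lee_fin sqr_ge0.
  have eg : sq_grid n w = (fine (sq_grid n w))%:E.
    rewrite fineK// ge0_fin_numE ?sq_grid_lty//.
    by apply: integral_ge0 => u _; rewrite lee_fin sqr_ge0.
  rewrite ef eg -EFinD -EFinM lee_fin; move: e1 e2; rewrite /de.
  have := ler_norm (err j w); have := ler_norm (fine (sq_grid n w)); lra.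
have := sp_increments_outer hF hW hs cs (wfH j) m0 e4 eta0 V => Q.
have hE : h / 4 + (eta / (eps / 4) + (h / 8 + h / 8)) <= h.
  have -> : eta / (eps / 4) = h / 4 by rewrite /eta; field; rewrite gt_eqF.
  by lra.
apply: outer_le_trans hE _; apply: outer_leS (outer_leU sumj Q) => w /= hw.
have sq0 (K : nat) (f : nat -> R) : 0 <= \sum_(l < K) f l ^+ 2.
  by apply: sumr_ge0 => l _; exact: sqr_ge0.
rewrite ger0_norm ?(sq0 _ (fun l => diff l.+1 j w - diff l j w))//.
set A := \sum_(l < L) _; set B := \sum_(l < _) _.
have [?|A4] := leP (eps / 4) A; [by left|right].
suff : eps <= 2 * A + 2 * B by lra.
move: hw; rewrite ger0_norm; last first.
  by apply: sumr_ge0 => l _; exact: sqr_ge0.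
move=> hw; apply: le_trans hw _; rewrite /A /B !mulr_sumr -big_split /=.
apply: ler_sum => l _; rewrite /diff /x.
set a := I _ w; set b := I _ w; set c := sp_integral _ _ _ w.
set e := sp_integral _ _ _ w; set g := sigma _ w * _.
rewrite -subr_ge0 (_ : _ - _ = ((c - a) - (e - b) + (c - e - g)) ^+ 2); last by ring.
exact: sqr_ge0.
Qed.

End ItoRange.

(** * Realized range of the Ito integral *)

Section Blocks.
Context d (T : measurableType d) (R : realType) (P : probability T R).
Local Notation mu := (@lebesgue_measure R).
Variables (F : R -> set (set T)) (W sigma I : R -> T -> R) (m : nat).
Hypotheses (hF : filtration F) (hW : brownian_motion P F W) (m0 : (0 < m)%N).
Hypotheses (hs : adapted F sigma) (cs : forall w, cadlag (sigma ^~ w)).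

Definition block_incr (f : R -> R) n i : nat -> R :=
  grid_incr f (i%:R / n.+1%:R) n.+1%:R^-1 m.

Lemma block_incrE f n i k : block_incr f n i k =
  f ((i * m + k).+1%:R / (n.+1 * m)%:R) - f ((i * m + k)%:R / (n.+1 * m)%:R).
Proof.
have m0' : 0 < m%:R :> R by rewrite ltr0n.
have E j : i%:R / n.+1%:R + j%:R / m%:R * n.+1%:R^-1 =
    (i * m + j)%:R / (n.+1 * m)%:R :> R.
  rewrite natrD !natrM; have : n.+1%:R != 0 :> R by [].
  by move: (n.+1%:R) => N N0; field; rewrite N0 gt_eqF.
by rewrite /block_incr /grid_incr !E addnS.
Qed.

Lemma sum_blocks (a : nat -> R) n :
  \sum_(i < n) \sum_(0 <= k < m) a (i * m + k)%N = \sum_(l < n * m) a l.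
Proof.
rewrite -(big_mkord xpredT a).
rewrite -[RHS](big_blocks _ a (b := fun i => i * m)%N); last first.
  by move=> l; rewrite leq_pmul2r.
apply: eq_bigr => i _.
have -> : \sum_((i * m)%N <= k < (i.+1 * m)%N) a k =
  \sum_((0 + i * m)%N <= k < (i.+1 * m)%N) a k by rewrite add0n.
by rewrite big_addn mulSn addnK; apply: eq_bigr => k _; rewrite addnC.
Qed.

Section IBlocks.
Hypothesis itoI : ito_integral P F W sigma I.

(** By Cauchy-Schwarz a squared range is at most m times the sum of the m squared increments of the
    block; the factor m is fixed. *)
Lemma ocvg0_block_error : ocvg0 P (fun n w => \sum_(i < n.+1)
  path_range m (fun k => block_incr (I ^~ w) n i k -
    sigma (i%:R / n.+1%:R) w * block_incr (W ^~ w) n i k) ^+ 2).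
Proof.
apply: ocvg0_le (ocvg0Z m%:R (ocvg0_ito_increments hF hW m0 hs cs itoI)) => n w.
rewrite ger0_norm; last by apply: sumr_ge0 => i _; exact: sqr_ge0.
apply: le_trans (ler_norm _).
rewrite -(sum_blocks (fun l => (I (l.+1%:R / (n.+1 * m)%:R) w -
  I (l%:R / (n.+1 * m)%:R) w - sigma (grid_floor n (l%:R / (n.+1 * m)%:R)) w *
  (W (l.+1%:R / (n.+1 * m)%:R) w - W (l%:R / (n.+1 * m)%:R) w)) ^+ 2)) mulr_sumr.
apply: ler_sum => i _.
set z := (fun k => _ - _).
apply: (@le_trans _ _ ((\sum_(0 <= k < m) `|z k|) ^+ 2)).
  by apply: lerXn2r (path_range_le_sum _ _); rewrite nnegrE ?path_range_ge0 ?sumr_ge0.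
apply: le_trans (sqr_sum_le _ _) _; rewrite ler_wpM2l// le_eqVlt; apply/orP; left.
apply/eqP; rewrite big_nat [RHS]big_nat; apply: eq_bigr => k /andP[_ km].
rewrite -normrX ger0_norm ?sqr_ge0//; congr (_ ^+ 2); rewrite /z !block_incrE.
congr (_ - sigma _ w * _); rewrite /grid_floor; congr (_%:R / _).
have nm0 : 0 < (n.+1 * m)%:R :> R by rewrite ltr0n muln_gt0.
rewrite (truncn_fine_grid m0 (lexx _)); last by rewrite ltr_pM2r ?invr_gt0// ltr_nat.
by rewrite divnMDl// divn_small// addn0.
Qed.

End IBlocks.

(** [lenglart] with weights sigma^2 and variances K / (n + 1)^2: along each path the predictable sum
    is at most M^4 K / (n + 1), where M bounds |sigma| on [0, 1]. *)
Lemma ocvg0_weighted_range :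
  ocvg0 P (fun n w => \sum_(i < n.+1) sigma (i%:R / n.+1%:R) w ^+ 2 *
    centered_range P W m (i%:R / n.+1%:R) n.+1%:R^-1 w).
Proof.
have [sF Fm FS] := hF.
have [K K0 hK] := centered_range_sqr_le hF hW m0.
have cV : ocvg0 P (fun n w => \sum_(0 <= i < n.+1)
    (sigma (i%:R / n.+1%:R) w ^+ 2) ^+ 2 * (K * n.+1%:R^-1 ^+ 2)).
  apply: ae_ocvg0.
    move=> n; apply: measurable_sum => i; apply: measurable_funM => //.
    do 2 apply: measurable_funX.
    have i0 : 0 <= i%:R / n.+1%:R :> R by rewrite divr_ge0.
    exact: (measurable_wrt_fun (Fm _ i0) (hs i0)).
  apply: aeW => w; have [M M0 fM] := cadlag_bounded (cs w).
  apply: (@squeeze_cvgr _ _ _ _ (fun=> 0) (fun n => M ^+ 4 * K * n.+1%:R^-1)).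
  - near=> n; apply/andP; split.
      apply: sumr_ge0 => i _; rewrite mulr_ge0 ?sqr_ge0// mulr_ge0 ?sqr_ge0//.
      exact: ltW.
    apply: (@le_trans _ _ (\sum_(0 <= i < n.+1) M ^+ 4 * (K * n.+1%:R^-1 ^+ 2))).
      rewrite big_nat [leRHS]big_nat; apply: ler_sum => i /andP[_ iN].
      rewrite ler_wpM2r//; first by rewrite mulr_ge0 ?sqr_ge0 ?(ltW K0).
      rewrite -exprM -[leLHS]ger0_norm ?exprn_even_ge0// normrX.
      apply: lerXn2r; rewrite ?nnegrE//; apply: fM.
      by rewrite divr_ge0//= ler_pdivrMr// mul1r ler_nat ltnW.
    rewrite big_const_nat subn0 iter_addr_0 -mulr_natr le_eqVlt; apply/orP; left.
    by apply/eqP; field.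
  - exact: cvg_cst.
  - rewrite -[X in _ --> X](mulr0 (M ^+ 4 * K)); apply: cvgM; first exact: cvg_cst.
    exact: cvg_harmonic.
move=> eps h eps0 h0; pose eta := h / 2 * eps ^+ 2.
have e2 : 0 < eps ^+ 2 by exact: exprn_gt0.
have h2 : 0 < h / 2 by rewrite divr_gt0.
have eta0 : 0 < eta by rewrite mulr_gt0.
have [N hN] := cV _ _ eta0 h2; exists N => n Nn.
have n0 : 0 < n.+1%:R^-1 :> R by rewrite invr_gt0.
pose g k : R := k%:R / n.+1%:R.
have g0 k : 0 <= g k by rewrite divr_ge0.
have gS k : g k + n.+1%:R^-1 = g k.+1 by rewrite /g -[k.+1]addn1 natrD mulrDl mul1r.
have hY : mart_diff P (fun k => F (g k)) n.+1
    (fun k => centered_range P W m (g k) n.+1%:R^-1) (fun _ => K * n.+1%:R^-1 ^+ 2).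
  split => [k|k|k|k _]; [exact: sF|exact: Fm| |].
    by apply: FS => //; rewrite -gS lerDl ltW.
  split.
  - by rewrite -gS; exact: measurable_wrt_centered_range.
  - exact: centered_range_indep.
  - exact: (centered_range_integral0 hF hW m0 (g0 k) n0).
  - by rewrite mulr_gt0// exprn_gt0.
  - exact: hK.
have mG k : (k < n.+1)%N -> measurable_wrt (F (g k)) (fun w => sigma (g k) w ^+ 2).
  move=> _; apply/measurable_wrtP; first exact: sF.
  by apply: measurable_funX; apply/measurable_wrtP; [exact: sF|exact: hs].
(* A single block: [lenglart] then controls the square of the whole sum, which is why the threshold
   is eps^2. *)
pose b l := if l is 0%N then 0%N else n.+1.
have bS l : (b l <= b l.+1)%N by case: l.
have V : outer_le P [set w | eta < \sum_(0 <= k < n.+1)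
    (sigma (g k) w ^+ 2) ^+ 2 * (K * n.+1%:R^-1 ^+ 2)] (h / 2).
  apply: outer_leS (hN n Nn) => w /= hw.
  by apply: le_trans (ltW hw) (ler_norm _).
have := lenglart hY mG bS (leqnn (b 1%N)) e2 eta0 V (L := 1%N).
rewrite /eta mulfK ?gt_eqF// -splitr; apply: outer_leS => w /= hw.
rewrite big_ord1 /= (big_mkord xpredT) -[leRHS]real_normK ?num_real//.
by apply: lerXn2r; rewrite ?nnegrE// ltW.
Unshelve. all: by end_near. Qed.

End Blocks.

(** * Limit of the squared ranges of the Ito integral *)

Section RangeIto.
Context d (T : measurableType d) (R : realType) (P : probability T R).
Local Notation mu := (@lebesgue_measure R).

Lemma ocvg0_range_perturb (r s E : nat -> nat -> T -> R) (Y : T -> R) :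
  measurable_fun setT Y ->
  (forall n i w, 0 <= s n i w) -> (forall n i w, 0 <= r n i w) ->
  (forall n i w, `|r n i w - s n i w| <= E n i w) ->
  ocvg0 P (fun n w => \sum_(i < n.+1) E n i w ^+ 2) ->
  ocvg0 P (fun n w => \sum_(i < n.+1) s n i w ^+ 2 - Y w) ->
  ocvg0 P (fun n w => \sum_(i < n.+1) r n i w ^+ 2 - Y w).
Proof.
move=> mY s0 r0 rsE cE cS.
suff : ocvg0 P (fun n w => \sum_(i < n.+1) r n i w ^+ 2 - \sum_(i < n.+1) s n i w ^+ 2).
  move=> h; apply: ocvg0_le (ocvg0D h cS) => n w.
  by rewrite addrA subrK.
move=> eps h eps0 h0; have h3 : 0 < h / 3 by rewrite divr_gt0.
(* Tightness of Y: it provides a level k + 1 that |Y| reaches with probability at most h / 3. *)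
have cY : ocvg0 P (fun k w => Y w * k.+1%:R^-1).
  apply: ae_ocvg0; first by move=> k; exact: measurable_funM.
  apply: aeW => w; rewrite -[X in _ --> X](mulr0 (Y w)).
  by apply: cvgM; [exact: cvg_cst|exact: cvg_harmonic].
have [k /(_ k (leqnn k)) hk] := cY _ _ ltr01 h3.
(* K bounds the sum of the s^2, which is within 1 of Y on the good event. The choices of de and of
   the threshold eps / (2 c) make each of the two error terms smaller than eps / 2. *)
pose K : R := k.+1%:R + 1; have K0 : 0 < K by rewrite addr_gt0.
pose de := eps / (2 * K); have de0 : 0 < de by rewrite divr_gt0// mulr_gt0.
pose c := 1 + de^-1; have c0 : 0 < c by rewrite addr_gt0// invr_gt0.
have e0 : 0 < eps / (2 * c) by rewrite divr_gt0// mulr_gt0.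
have [N1 hN1] := cE _ _ e0 h3; have [N2 hN2] := cS _ _ ltr01 h3.
exists (maxn N1 N2) => n; rewrite geq_max => /andP[n1 n2].
have hh : h / 3 + h / 3 + h / 3 <= h by lra.
apply: outer_le_trans hh _.
apply: outer_leS (outer_leU (outer_leU hk (hN1 _ n1)) (hN2 _ n2)) => w /= hw.
have [?|a1] := leP 1 `|Y w * k.+1%:R^-1|; first by left; left.
have [?|a2] := leP (eps / (2 * c)) `|\sum_(i < n.+1) E n i w ^+ 2|; first by left; right.
right; rewrite leNgt; apply/negP => a3; move: hw; apply/negP; rewrite -ltNge.
set Er := \sum_(i < n.+1) E n i w ^+ 2 in a2.
set S := \sum_(i < n.+1) s n i w ^+ 2 in a3 *.
have YK : `|Y w| < k.+1%:R.
  by move: a1; rewrite normrM (ger0_norm (_ : 0 <= k.+1%:R^-1)) ?invr_ge0// ltr_pdivrMr// mul1r.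
have SK : S < K.
  by move: a3; rewrite ltr_norml => /andP[_]; have := ler_norm (Y w); rewrite /K; lra.
have Ere : Er < eps / (2 * c) by apply: le_lt_trans a2; exact: ler_norm.
have key : `|\sum_(i < n.+1) r n i w ^+ 2 - S| <= de * S + c * Er.
  rewrite /S /Er -sumrB !mulr_sumr -big_split /=.
  apply: le_trans (ler_norm_sum _ _ _) _; apply: ler_sum => i _.
  have := rsE n i w; set a := r n i w; set b := s n i w; set e := E n i w => abe.
  have b0 : 0 <= b := s0 _ _ _.
  have e00 : 0 <= e := le_trans (normr_ge0 _) abe.
  have -> : a ^+ 2 - b ^+ 2 = (a - b) * ((a - b) + 2 * b) by ring.
  rewrite normrM; apply: (@le_trans _ _ (e * (e + 2 * b))).
    apply: ler_pM => //; apply: le_trans (ler_normD _ _) _.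
    by rewrite (ger0_norm (_ : 0 <= 2 * b)) ?mulr_ge0// lerD2r.
  rewrite -subr_ge0 (_ : _ - _ = (de * b - e) ^+ 2 / de); last first.
    by rewrite /c; field; rewrite gt_eqF.
  by rewrite divr_ge0 ?sqr_ge0// ltW.
apply: le_lt_trans key _.
have : de * S < eps / 2.
  have -> : eps / 2 = de * K by rewrite /de; field; rewrite gt_eqF.
  by rewrite ltr_pM2l.
have : c * Er < eps / 2.
  have -> : eps / 2 = c * (eps / (2 * c)) by field; rewrite gt_eqF.
  by rewrite ltr_pM2l.
by lra.
Qed.

Variables (F : R -> set (set T)) (W sigma I : R -> T -> R) (m : nat).
Hypotheses (hF : filtration F) (hW : brownian_motion P F W) (m0 : (0 < m)%N).
Hypotheses (hs : adapted F sigma) (cs : forall w, cadlag (sigma ^~ w)).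
Hypothesis itoI : ito_integral P F W sigma I.

Let lam := range_moment P W 2 m.
Let IV w : R := \int[mu]_(u in `[0, 1]) (sigma u w ^+ 2).

Lemma measurable_integrated_variance : measurable_fun setT IV.
Proof.
have [_ Fm _] := hF.
apply: (eq_measurable_fun (fun w => fine (\int[mu]_(u in `[0%R, 1%R])
    (sigma (Num.max u 0) w ^+ 2)%:E)%E)) => [w _|].
  congr fine; apply: eq_integral => u; rewrite inE /= in_itv /= => /andP[u0 _].
  by rewrite max_l.
apply: (measurableT_comp (fine_measurable measurableT)) => //.
apply: (measurable_param_integral (phi := fun z : R * T => sigma (Num.max z.1 0) z.2 ^+ 2)).
  apply: measurable_funX; apply: (measurable_cadlag_process _ cs) => t t0.
  exact: (measurable_wrt_fun (Fm _ t0) (hs t0)).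
by move=> z; exact: sqr_ge0.
Qed.

Lemma ocvg0_range_ito : ocvg0 P (fun n w =>
  \sum_(i < n.+1) path_range m (block_incr m (I ^~ w) n i) ^+ 2 - lam * IV w).
Proof.
have [_ Fm _] := hF.
apply: (@ocvg0_range_perturb
  (fun n i w => path_range m (block_incr m (I ^~ w) n i))
  (fun n i w => path_range m (fun k => sigma (i%:R / n.+1%:R) w * block_incr m (W ^~ w) n i k))
  (fun n i w => path_range m (fun k => block_incr m (I ^~ w) n i k -
      sigma (i%:R / n.+1%:R) w * block_incr m (W ^~ w) n i k))
  (fun w => lam * IV w)).
- by apply: measurable_funM => //; exact: measurable_integrated_variance.
- by move=> n i w; exact: path_range_ge0.
- by move=> n i w; exact: path_range_ge0.
- by move=> n i w; exact: path_range_dist.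
- exact: (ocvg0_block_error hF hW m0 hs cs itoI).
have cR : ocvg0 P (fun n w => n.+1%:R^-1 *
    \sum_(0 <= k < n.+1) sigma (k%:R / n.+1%:R) w ^+ 2 - IV w).
  apply: ae_ocvg0.
    move=> n; apply: measurable_funB; last exact: measurable_integrated_variance.
    apply: measurable_funM => //; apply: measurable_sum => k; apply: measurable_funX.
    have k0 : 0 <= k%:R / n.+1%:R :> R by rewrite divr_ge0.
    exact: (measurable_wrt_fun (Fm _ k0) (hs k0)).
  apply: aeW => w; rewrite -[X in _ --> X](subrr (IV w)); apply: cvgB; last exact: cvg_cst.
  exact: (cadlag_riemann (cs w)).
apply: ocvg0_le (ocvg0D (ocvg0_weighted_range hF hW m0 hs cs) (ocvg0Z lam cR)) => n w.
rewrite le_eqVlt; apply/orP; left; apply/eqP; congr (`|_|).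
rewrite mulrBr addrA; congr (_ - _); rewrite (big_mkord xpredT) mulrA mulr_sumr -big_split /=.
apply: eq_bigr => i _.
rewrite path_rangeZ exprMn real_normK ?num_real// /centered_range discrete_rangeE.
by rewrite mulrBr -/lam /block_incr; ring.
Qed.

End RangeIto.

(** * Drift and jumps *)

Section Pathwise.
Context {R : realType}.
Implicit Types (p A I : R -> R) (c : R -> nat) (J : nat -> R).

Lemma within_continuous_uniform I eps : {within `[0, +oo[, continuous I} -> 0 < eps ->
  exists2 delta, 0 < delta & forall s t, 0 <= s <= 1 -> 0 <= t <= 1 ->
    `|s - t| < delta -> `|I s - I t| < eps.
Proof.
move=> /subspace_continuousP cI e0; apply: unit_lebesgue_number => x /andP[x0 x1].
have e20 : 0 < eps / 2 by rewrite divr_gt0.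
have := cI x; rewrite /= in_itv /= x0 => /(_ isT) /cvgrPdist_lt/(_ _ e20).
move=> /nbhs_ballP[delta /= d0 hd]; exists delta => // s t /andP[s0 _] /andP[t0 _] xs xt.
have h1 : `|I x - I s| < eps / 2 by apply: hd => //=; rewrite in_itv /= s0.
have h2 : `|I x - I t| < eps / 2 by apply: hd => //=; rewrite in_itv /= t0.
by have := ler_distD (I x) (I s) (I t); rewrite (distrC (I s) (I x)); lra.
Qed.

(** [e k] is the number of jumps up to the k-th grid point of a block. With at most one jump the
    sampled path takes at most two values, J apart; the sum on the right covers the case without a
    jump as well. *)
Lemma jump_path_range (e : nat -> nat) J m :
  (forall k, (e k <= e k.+1)%N) -> (e m <= (e 0%N).+1)%N ->
  path_range m (fun k => \sum_(0 <= q < e k.+1) J q - \sum_(0 <= q < e k) J q) =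
  \sum_(e 0%N <= q < e m) `|J q|.
Proof.
move=> eS em.
have emono k k' : (k <= k')%N -> (e k <= e k')%N.
  move=> /subnKC <-; elim: (k' - k)%N => [|i IH]; first by rewrite addn0.
  by rewrite addnS; apply: leq_trans IH (eS _).
set x := (fun k => _ - _).
have xE t : \sum_(0 <= k < t) x k = \sum_(e 0%N <= q < e t) J q.
  rewrite (telescope_sumr (fun k => \sum_(0 <= q < e k) J q))//.
  by rewrite (big_cat_nat (leq0n (e 0%N)) (emono _ _ (leq0n t))) /= addrAC subrr add0r.
have tcase t : (t <= m)%N -> e t = e 0%N \/ (e t = (e 0%N).+1 /\ e m = (e 0%N).+1).
  move=> tm; have h1 := emono _ _ (leq0n t); have h2 := emono _ _ tm.
  have [->|ne] := eqVneq (e t) (e 0%N); [by left|right].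
  have h3 : (e 0%N < e t)%N by rewrite ltn_neqAle eq_sym ne.
  by split; apply/eqP; rewrite eqn_leq; apply/andP; split => //;
    [exact: leq_trans em|exact: leq_trans h2].
have sum1 : \sum_(e 0%N <= q < (e 0%N).+1) J q = J (e 0%N) by rewrite big_nat1.
have [e0|[_ e1]] := tcase m (leqnn _).
  rewrite e0 [RHS]big_geq//; apply/eqP; rewrite eq_le path_range_ge0 andbT.
  apply: path_range_le => // s t sm tm; rewrite !xE.
  have eE u : (u <= m)%N -> e u = e 0%N.
    by move=> um; apply/eqP; rewrite eqn_leq -{1}e0 !emono.
  by rewrite (eE _ sm) (eE _ tm) subrr.
rewrite e1 big_nat1; apply/eqP; rewrite eq_le; apply/andP; split.
  apply: path_range_le => // s t sm tm; rewrite !xE.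
  have zero : \sum_(e 0%N <= q < e 0%N) J q = 0 by rewrite big_geq.
  have := ler_norm (J (e 0%N)); have := lerNnormlW (lexx (`|J (e 0%N)|)).
  by have [->|[-> _]] := tcase s sm; have [->|[-> _]] := tcase t tm;
    rewrite ?sum1 ?zero; lra.
have h1 := le_path_range x (leq0n m) (leqnn m).
have h2 := le_path_range x (leqnn m) (leq0n m).
have zero : \sum_(e 0%N <= q < e 0%N) J q = 0 by rewrite big_geq.
move: h1 h2; rewrite !xE e1 sum1 zero.
by rewrite subr0 sub0r ler_norml lerNl => -> ->.
Qed.

(** a, i and s stand for drift, Ito part and jumps. The range of i + s lies between |r - g| and r +
    g, so its square differs from r^2 + g^2 by at most 2 r g; adding a moves the range by at most
    that of a. *)
Lemma path_range_jump_le m (a i s : nat -> R) :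
  `|path_range m (fun k => a k + i k + s k) ^+ 2 -
    path_range m i ^+ 2 - path_range m s ^+ 2| <=
  2 * path_range m i * path_range m s +
  path_range m a * (2 * path_range m i + 2 * path_range m s + path_range m a).
Proof.
set r := path_range m i; set g := path_range m s; set al := path_range m a.
set q := path_range m (fun k => a k + i k + s k).
pose u := path_range m (fun k => i k + s k).
have r0 : 0 <= r := path_range_ge0 _ _. have g0 : 0 <= g := path_range_ge0 _ _.
have al0 : 0 <= al := path_range_ge0 _ _. have u0 : 0 <= u := path_range_ge0 _ _.
have q0 : 0 <= q := path_range_ge0 _ _.
have urg : u <= r + g by exact: path_rangeD.
have uE1 : `|u - r| <= g.
  have := path_range_dist m (fun k => i k + s k) i.
  by congr (_ <= _); apply: eq_path_range => k _; rewrite addrAC subrr add0r.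
have uE2 : `|u - g| <= r.
  have := path_range_dist m (fun k => i k + s k) s.
  by congr (_ <= _); apply: eq_path_range => k _; rewrite addrK.
have qu : `|q - u| <= al.
  have := path_range_dist m (fun k => a k + i k + s k) (fun k => i k + s k).
  by congr (_ <= _); apply: eq_path_range => k _; ring.
clearbody r g al q u.
have h1 : `|u ^+ 2 - r ^+ 2 - g ^+ 2| <= 2 * r * g.
  have hu : u ^+ 2 <= (r + g) ^+ 2 by rewrite lerXn2r ?nnegrE ?addr_ge0.
  have hl : (r - g) ^+ 2 <= u ^+ 2.
    rewrite -[leLHS]real_normK ?num_real// lerXn2r ?nnegrE//.
    by move: uE1 uE2; rewrite !ler_norml => /andP[? ?] /andP[? ?]; apply/andP; split; lra.
  by rewrite ler_norml; clear -hu hl; apply/andP; split; lra.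
have h2 : `|q ^+ 2 - u ^+ 2| <= al * (2 * r + 2 * g + al).
  have -> : q ^+ 2 - u ^+ 2 = (q - u) * ((q - u) + 2 * u) by ring.
  rewrite normrM; apply: ler_pM => //; apply: le_trans (ler_normD _ _) _.
  by rewrite (ger0_norm (_ : 0 <= 2 * u)) ?mulr_ge0//; lra.
have -> : q ^+ 2 - r ^+ 2 - g ^+ 2 = (u ^+ 2 - r ^+ 2 - g ^+ 2) + (q ^+ 2 - u ^+ 2) by ring.
by apply: le_trans (ler_normD _ _) _; exact: lerD.
Qed.

Section BlockGrid.
Variable m : nat.
Hypothesis m0 : (0 < m)%N.

Let x n l : R := l%:R / (n.+1 * m)%:R.

Let nm0 n : 0 < (n.+1 * m)%:R :> R.
Proof. by rewrite ltr0n muln_gt0. Qed.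

Let xmono n l l' : (l <= l')%N -> x n l <= x n l'.
Proof. by move=> ll'; rewrite ler_pM2r ?invr_gt0// ler_nat. Qed.

Let x01 n i k : (i < n.+1)%N -> (k <= m)%N -> 0 <= x n (i * m + k) <= 1.
Proof.
move=> iN km; rewrite divr_ge0//= ler_pdivrMr// mul1r ler_nat.
by apply: (@leq_trans (i.+1 * m)); [rewrite mulSn addnC leq_add2r|rewrite leq_pmul2r].
Qed.

Let x_dist n i s t : (s <= m)%N -> (t <= m)%N ->
  `|x n (i * m + s) - x n (i * m + t)| <= n.+1%:R^-1.
Proof.
move=> sm tm; rewrite -mulrBl normrM (ger0_norm (_ : 0 <= (n.+1 * m)%:R^-1)) ?invr_ge0//.
rewrite ler_pdivrMr// natrM mulrA mulVf// mul1r !natrD opprD addrACA subrr add0r.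
have : s%:R <= m%:R :> R by rewrite ler_nat.
have : t%:R <= m%:R :> R by rewrite ler_nat.
have := ler0n R s; have := ler0n R t.
by rewrite ler_norml; lra.
Qed.

Lemma sum_block_incr (f : R -> R) n i t : \sum_(0 <= k < t) block_incr m f n i k =
  f (x n (i * m + t)) - f (x n (i * m)).
Proof.
under eq_bigr do rewrite block_incrE// -addnS.
by rewrite (telescope_sumr (fun k => f (x n (i * m + k))))// addn0.
Qed.

Lemma block_range_le (f : R -> R) n i (D : R) : (i < n.+1)%N -> 0 <= D ->
  (forall u v, 0 <= u <= 1 -> 0 <= v <= 1 -> `|u - v| <= n.+1%:R^-1 ->
    `|f u - f v| <= D) -> path_range m (block_incr m f n i) <= D.
Proof.
move=> iN D0 hf; apply: path_range_le => // s t sm tm.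
rewrite !sum_block_incr opprB addrA subrK.
by apply: le_trans (ler_norm _) _; apply: hf; [exact: x01|exact: x01|exact: x_dist].
Qed.

(** On a block the range of I is at most om and that of A at most C / (n + 1), while the jump ranges
    add up to the finite [Gam]. Summing [path_range_jump_le] bounds the error by 2 om Gam + 2 om C +
    (2 C Gam + C^2) / (n + 1). *)
Lemma range_decomposition_cvg p A I c J C : 0 <= C ->
  (forall t, 0 <= t -> p t = p 0 + A t + I t + \sum_(0 <= q < c t) J q) ->
  (forall s t, 0 <= s -> s <= t -> t <= 1 -> `|A t - A s| <= C * (t - s)) ->
  {within `[0, +oo[, continuous I} -> simple_counting_path c ->
  \sum_(i < n.+1) path_range m (block_incr m p n i) ^+ 2 -
  \sum_(i < n.+1) path_range m (block_incr m I n i) ^+ 2 -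
  \sum_(0 <= q < c 1) J q ^+ 2 @[n --> \oo] --> (0 : R).
Proof.
move=> C0 hp hA cI hc; have [c0 cmono _ _] := hc.
apply/cvgrPdist_lt => eps eps0.
pose Gam := \sum_(0 <= q < c 1) `|J q|.
have G0 : 0 <= Gam by exact: sumr_ge0.
(* [om] makes the first two terms of the error at most eps / 3, and [d3] below does the same for the
   last one; the summand 1 keeps the denominators positive when there is neither drift nor jump. *)
pose om := eps / (3 * (2 * Gam + 2 * C + 1)).
have den0 : 0 < 2 * Gam + 2 * C + 1 by lra.
have om0 : 0 < om by rewrite divr_gt0// mulr_gt0.
have [d1 d10 hd1] := within_continuous_uniform cI om0.
have [d2 d20 hd2] := counting_path_incr_le1 hc.
pose d3 := eps / (3 * (2 * C * Gam + C ^+ 2 + 1)).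
have den30 : 0 < 2 * C * Gam + C ^+ 2 + 1.
  by have := mulr_ge0 C0 G0; have := sqr_ge0 C; lra.
have d30 : 0 < d3 by rewrite divr_gt0// mulr_gt0.
have omE : om * (2 * Gam + 2 * C + 1) = eps / 3 by rewrite /om; field; rewrite gt_eqF.
have d3E : d3 * (2 * C * Gam + C ^+ 2 + 1) = eps / 3 by rewrite /d3; field; rewrite gt_eqF.
clearbody om d3.
have [N1 _ hN1] := near_infty_natSinv_lt (PosNum d10).
have [N2 _ hN2] := near_infty_natSinv_lt (PosNum d20).
have [N3 _ hN3] := near_infty_natSinv_lt (PosNum d30).
exists (maxn N1 (maxn N2 N3)) => // n /=; rewrite !geq_max => /and3P[n1 n2 n3].
have {}n1 : n.+1%:R^-1 < d1 := hN1 _ n1. have {}n2 : n.+1%:R^-1 < d2 := hN2 _ n2.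
have {}n3 : n.+1%:R^-1 < d3 := hN3 _ n3.
have iv0 : 0 < n.+1%:R^-1 :> R by rewrite invr_gt0.
pose S t := \sum_(0 <= q < c t) J q.
pose e i k := c (x n (i * m + k)).
have eS i k : (e i k <= e i k.+1)%N.
  by apply: cmono; [rewrite divr_ge0|apply: xmono; rewrite leq_add2l].
pose g i := \sum_(e i 0%N <= q < e i m) `|J q|.
have em i : (i < n.+1)%N -> (e i m <= (e i 0%N).+1)%N.
  move=> iN; apply: hd2; try exact: x01.
  exact: le_lt_trans (x_dist _ _ (leq0n m) (leqnn m)) n2.
have gE i : (i < n.+1)%N -> path_range m (block_incr m S n i) = g i.
  move=> iN; rewrite /g -jump_path_range//; last exact: em.
  by apply: eq_path_range => k _; rewrite block_incrE// /S /e addnS.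
have eiE i : e i m = e i.+1 0%N by rewrite /e mulSn addn0 addnC.
have e0 : e 0%N 0%N = 0%N by rewrite /e /x mul0r.
have e1 : e n.+1 0%N = c 1 by rewrite /e /x addn0 mulfV// gt_eqF.
have blocks (f : nat -> R) : \sum_(i < n.+1) \sum_(e i 0%N <= q < e i m) f q =
    \sum_(0 <= q < c 1) f q.
  have e_ge i k : (e i 0%N <= e i k)%N.
    by elim: k => // k h; exact: leq_trans (eS i k).
  have em' i : (e i 0%N <= e i.+1 0%N)%N by rewrite -eiE.
  have := @big_blocks _ _ _ f (fun i => e i 0%N) n.+1 em'.
  rewrite e0 e1 => <-.
  by apply: eq_bigr => i _; rewrite eiE.
have sumg : \sum_(i < n.+1) g i = Gam by exact: blocks.
(* The square of the sum is the sum of the squares because there is at most one term. *)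
have g2 i : (i < n.+1)%N -> g i ^+ 2 = \sum_(e i 0%N <= q < e i m) J q ^+ 2.
  move=> /em; rewrite /g leq_eqVlt => /orP[/eqP ->|].
    by rewrite !big_nat1 real_normK ?num_real.
  by rewrite ltnS => h; rewrite !big_geq// expr0n.
rewrite sub0r normrN -blocks.
have r_le i : (i < n.+1)%N -> path_range m (block_incr m I n i) <= om.
  move=> iN; apply: block_range_le => //; first exact: ltW.
  by move=> u v u01 v01 uv; apply/ltW/hd1 => //; exact: le_lt_trans uv n1.
have a_le i : (i < n.+1)%N -> path_range m (block_incr m A n i) <= C * n.+1%:R^-1.
  move=> iN; apply: block_range_le => //; first by rewrite mulr_ge0// ltW.
  have hA' u v : 0 <= u <= 1 -> 0 <= v <= 1 -> u <= v -> `|u - v| <= n.+1%:R^-1 ->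
      `|A u - A v| <= C * n.+1%:R^-1.
    move=> /andP[u0 u1] /andP[v0 v1] uv duv; rewrite distrC.
    apply: le_trans (hA _ _ u0 uv v1) _; rewrite ler_wpM2l//.
    by move: duv; rewrite distrC ger0_norm ?subr_ge0.
  move=> u v u01 v01 duv; have [uv|/ltW vu] := leP u v; first exact: hA'.
  by rewrite distrC; apply: hA' => //; rewrite distrC.
have iv1 : n.+1%:R * n.+1%:R^-1 = 1 :> R by rewrite mulfV.
set iv : R := n.+1%:R^-1 in n1 n2 n3 iv0 iv1 a_le *.
apply: (@le_lt_trans _ _ (\sum_(i < n.+1) (2 * om * g i +
    C * iv * (2 * om + 2 * g i + C * iv)))).
  rewrite -!sumrB; apply: le_trans (ler_norm_sum _ _ _) _; apply: ler_sum => i _.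
  have iN := ltn_ord i; rewrite -g2// -gE//.
  have pE : path_range m (block_incr m p n i) = path_range m (fun k =>
      block_incr m A n i k + block_incr m I n i k + block_incr m S n i k).
    apply: eq_path_range => k _; rewrite !block_incrE// /S.
    by rewrite (hp (_ / _)) ?divr_ge0// (hp (_%:R / _)) ?divr_ge0//; ring.
  rewrite pE; apply: le_trans (path_range_jump_le _ _ _ _) _.
  have := r_le _ iN; have := a_le _ iN.
  have := path_range_ge0 m (block_incr m I n i).
  have := path_range_ge0 m (block_incr m A n i).
  have := path_range_ge0 m (block_incr m S n i).
  move: (path_range m (block_incr m I n i)) (path_range m (block_incr m A n i))
    (path_range m (block_incr m S n i)) => r a h h0 a0 r0 aC rom.
  have h1 : 2 * r * h <= 2 * om * h by rewrite ler_wpM2r// ler_pM2l.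
  have h2 : a * (2 * r + 2 * h + a) <= C * iv * (2 * om + 2 * h + C * iv).
    by apply: ler_pM => //; lra.
  by lra.
rewrite big_split /= -!mulr_sumr !big_split /= -!mulr_sumr sumg !sumr_const card_ord.
rewrite -(mulr_natr om) -(mulr_natr iv) [ltLHS](_ : _ = 2 * om * Gam + 2 * om * C * (n.+1%:R * iv) +
  2 * C * Gam * iv + C ^+ 2 * iv * (n.+1%:R * iv)); last by ring.
rewrite iv1 !mulr1.
have : iv * (2 * C * Gam + C ^+ 2 + 1) < eps / 3 by rewrite -d3E ltr_pM2r.
by lra.
Qed.

End BlockGrid.
End Pathwise.

(** * Path regularity of the drift *)

Section Drift.
Context d (T : measurableType d) (R : realType).
Local Notation leb := (@lebesgue_measure R).

(* The sets of R * T whose section at w is measurable form a sigma-algebra that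
   contains the predictable rectangles. *)
Lemma measurable_predictable_section (F : R -> set (set T)) (X : R -> T -> R) (w : T) :
  predictable F X -> measurable_fun (`[0%R, +oo[ : set R) (X ^~ w).
Proof.
move=> hX _ B mB.
pose S : set (set (R * T)) := [set E | measurable [set t : R | E (t, w)]].
suff sub : <<s `[0%R, +oo[ `*` [set: T], predictable_rectangle F >> `<=` S.
  have := sub _ (hX B mB); rewrite /S /=.
  by congr measurable; apply/seteqP; split => t /=; [move=> [[]]|move=> []].
apply: smallest_sub; last first.
  move=> C [[A _ ->]|[s [t [A [_ _ _ ->]]]]]; rewrite /S /=.
    have [Aw|nAw] := pselect (A w).
      rewrite (_ : mkset _ = [set 0])//.
      by apply/seteqP; split => [u []//|u /= ->].
    by rewrite (_ : mkset _ = set0)//; apply/seteqP; split => [u []|].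
  have [Aw|nAw] := pselect (A w).
    by rewrite (_ : mkset _ = `]s, t]%classic)//; apply/seteqP; split => [u []|u].
  by rewrite (_ : mkset _ = set0)//; apply/seteqP; split => [u []|].
split; rewrite /S /=.
- by rewrite (_ : mkset _ = set0)//; apply/seteqP; split.
- move=> A mA; rewrite (_ : mkset _ = `[0%R, +oo[%classic `\` [set t | A (t, w)]).
    exact: measurableD.
  by apply/seteqP; split => [t [[? _] ?]|t [? ?]].
- move=> A mA; rewrite (_ : mkset _ = \bigcup_n [set t | A n (t, w)]).
    exact: bigcup_measurable.
  by apply/seteqP; split => [t [n _ ?]|t [n _ ?]]; exists n.
Qed.

Lemma bounded_primitive_lipschitz (f : R -> R) C : measurable_fun (`[0%R, +oo[ : set R) f ->
  (forall t, 0 < t <= 1 -> `|f t| <= C) ->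
  forall s t, 0 <= s -> s <= t -> t <= 1 ->
  `|\int[leb]_(u in `[0, t]) f u - \int[leb]_(u in `[0, s]) f u| <= C * (t - s).
Proof.
move=> mf hC s t s0 st t1.
have fin a b (i j : bool) : (leb [set` Interval (BSide i a) (BSide j b)] < +oo)%E.
  by rewrite lebesgue_measure_itv/=; case: ifP => _; rewrite ?ltry.
have i1 : leb.-integrable `[0, t] (EFin \o f).
  apply: measurable_bounded_integrable => //; first exact: fin.
    have sub : `[0, t] `<=` (`[0, +oo[ : set R).
      by move=> u /=; rewrite !in_itv/= => /andP[->].
    by apply: (measurable_funS _ sub mf); exact: measurable_itv.
  (* C bounds f only at positive times, as local boundedness does, so the value at 0 is added. *)
  exists (Num.max `|f 0| C); split; first exact: num_real.
  move=> M hM u /=; rewrite in_itv /= => /andP[u0 ut].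
  apply: le_trans (ltW hM); rewrite le_max.
  have [->|un0] := eqVneq u 0; first by rewrite lexx.
  by rewrite hC ?orbT// lt_neqAle eq_sym un0 u0 (le_trans ut).
rewrite Rintegral_itvB ?bnd_simp//.
have i2 : leb.-integrable `]s, t] (EFin \o f).
  apply: integrableS i1 => //; apply: subset_itvr; by rewrite bnd_simp.
apply: le_trans (le_normr_Rintegral _ i2) _ => //.
have -> : C * (t - s) = \int[leb]_(_ in `]s, t]) C.
  rewrite Rintegral_cst//= lebesgue_measure_itv/= lte_fin.
  case: ltP => [//|ts]; have -> : t = s by apply/eqP; rewrite eq_le ts.
  by rewrite subrr.
apply: le_Rintegral => //.
- exact: integrable_norm i2.
- apply: integrableS (integrable_unit_cst C) => // u /=; rewrite !in_itv/= => /andP[su ut].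
  by rewrite (ltW (le_lt_trans s0 su)) (le_trans ut).
- move=> u /=; rewrite in_itv /= => /andP[su ut]; apply: hC.
  by rewrite (le_lt_trans s0 su) (le_trans ut).
Qed.

End Drift.

(** * Combining the Ito part with drift and jumps *)

Section Assembly.
Context d (T : measurableType d) (R : realType) (P : probability T R).

Lemma measurable_sum_range (X : R -> T -> R) m n : (0 < m)%N ->
  (forall t, 0 <= t -> measurable_fun setT (X t)) ->
  measurable_fun setT (fun w =>
    \sum_(i < n.+1) path_range m (block_incr m (X ^~ w) n i) ^+ 2).
Proof.
move=> m0 mX; apply: measurable_sum => i; apply: measurable_funX.
apply: (measurable_path_range (x := fun k w => block_incr m (X ^~ w) n i k)) => k _.
rewrite (_ : (fun w => _) = fun w => X ((i * m + k).+1%:R / (n.+1 * m)%:R) w -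
    X ((i * m + k)%:R / (n.+1 * m)%:R) w); last by apply/funext => w; rewrite block_incrE.
by apply: measurable_funB; apply: mX; exact: divr_ge0.
Qed.

(** On almost every path some [tau k] is at least 1, and the constant of that k bounds X on ]0,
    1]. *)
Lemma locally_bounded_unit (F : R -> set (set T)) (X : R -> T -> R) :
  locally_bounded P F X ->
  {ae P, forall w, exists2 C, 0 <= C & forall t, 0 < t <= 1 -> `|X t w| <= C}.
Proof.
move=> [tau [C [_ _ + hC]]]; apply: filterS => w /cvgeyPge /(_ 1) [k _ hk].
exists (Num.max 0 (C k)) => [|t /andP[t0 t1]]; first by rewrite le_max lexx.
rewrite le_max hC ?orbT//; apply: le_trans (hk k _) => //=.
Qed.

End Assembly.

Theorem theorem1 (d : measure_display) (T : measurableType d) (R : realType)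
  (P : probability T R) (F : R -> set (set T))
  (p mu sigma W : R -> T -> R) (N : R -> T -> nat) (J : nat -> T -> R)
  (m : nat)
  (hF : filtration F)
  (hp : adapted F p)
  (hmu_pred : predictable F mu)
  (hmu_bnd : locally_bounded P F mu)
  (hsigma : adapted F sigma)
  (hsigma_cadlag : forall w, cadlag (sigma ^~ w))
  (hW : brownian_motion P F W)
  (hN : simple_counting_process P N)
  (hJ : forall i, measurable_fun setT (J i))
  (hJ0 : forall i, {ae P, forall w, J i w != 0})
  (hmodel : jump_diffusion P F p mu sigma W N J)
  (hm : (0 < m)%N) :
  cvg_in_probability P (fun n => RRV P W p m n)
    (fun w => \int[lebesgue_measure]_(u in `[0, 1]) (sigma u w) ^+ 2
              + (range_moment P W 2 m)^-1 * \sum_(i < N 1 w) J i w ^+ 2).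
Proof.
have [I itoI hI] := hmodel; have [mI cI _] := itoI; have [mN cN] := hN.
have [_ Fm _] := hF.
have lam0 : 0 < range_moment P W 2 m := range_moment_gt0 hF hW hm.
set lam := range_moment P W 2 m in lam0 *.
have mp t : 0 <= t -> measurable_fun setT (p t).
  by move=> t0; exact: measurable_wrt_fun (Fm _ t0) (hp _ t0).
pose S2 w := \sum_(i < N 1 w) J i w ^+ 2.
have mS2 : measurable_fun setT S2.
  apply: (measurable_fun_nat_index (Y := fun k w => \sum_(i < k) J i w ^+ 2)).
    exact: mN.
  by move=> k; apply: measurable_sum => i; exact: measurable_funX.
pose V (X : R -> T -> R) n w := \sum_(i < n.+1) path_range m (block_incr m (X ^~ w) n i) ^+ 2.
have mV X n : (forall t, 0 <= t -> measurable_fun setT (X t)) -> measurable_fun setT (V X n).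
  by move=> mX; exact: (measurable_sum_range n hm mX).
(* A pathwise limit on an event of full probability, turned into convergence in probability by
   Egorov. *)
have jumps : ocvg0 P (fun n w => V p n w - V I n w - S2 w).
  apply: ae_ocvg0.
    by move=> n; apply: measurable_funB => //; apply: measurable_funB; exact: mV.
  have reg : {ae P, forall w, {within `[0, +oo[, continuous (I ^~ w)} /\
      simple_counting_path (N ^~ w)} by move: cI cN; apply: filterS2.
  have := locally_bounded_unit hmu_bnd; move: reg hI.
  apply: filterS3 => w [cIw cNw] hIw [C C0 hC].
  rewrite /S2 -(big_mkord xpredT (fun i => J i w ^+ 2)).
  apply: (range_decomposition_cvg hm C0 _ _ cIw cNw
    (A := fun t => \int[lebesgue_measure]_(u in `[0, t]) mu u w)).
    by move=> t t0; rewrite hIw// -(big_mkord xpredT (fun i => J i w)).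
  exact: bounded_primitive_lipschitz (measurable_predictable_section w hmu_pred) hC.
have RRVE n w : RRV P W p m n.+1 w = lam^-1 * V p n w.
  by congr (_ * _); apply: eq_bigr => i _; rewrite discrete_rangeE.
have cvS : cvg_in_probability P (fun n => RRV P W p m n.+1)
    (fun w => \int[lebesgue_measure]_(u in `[0, 1]) (sigma u w) ^+ 2 + lam^-1 * S2 w).
  apply: ocvg0_cvgp.
  - move=> n; rewrite (_ : RRV P W p m n.+1 = fun w => lam^-1 * V p n w); last exact/funext.
    by apply: measurable_funM => //; exact: mV.
  - apply: measurable_funD; last exact: measurable_funM.
    exact: measurable_integrated_variance hF hsigma hsigma_cadlag.
  - have := ocvg0Z lam^-1 (ocvg0D jumps (ocvg0_range_ito hF hW hm hsigma hsigma_cadlag itoI)).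
    apply: ocvg0_le => n w; rewrite RRVE -/lam -/(V I n w).
    set v := Rintegral _ _ _; rewrite [leLHS](_ : _ =
      `|lam^-1 * (V p n w - V I n w - S2 w + (V I n w - lam * v))|)//.
    by congr (`|_|); field; rewrite gt_eqF.
(* Passing to n + 1 does not affect the limit and avoids the empty grid at n = 0. *)
by move=> eps eps0; rewrite -cvg_shiftS; exact: cvS.
Qed.
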